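(* Assume that $H$ is a Gorenstein ring. The right transfer of the Gorenstein projective model structure on $\mathrm{Mod}(H)$ exists along the adjunction $F:\mathrm{Mod}(H)\rightleftarrows\mathrm{Rep}^\infty_k(G):U$.
   Context: Let $k$ be a field of characteristic $p>0$ and $G$ a topological group (possibly discrete) admitting an open pro-$p$ subgroup $I$. $\mathrm{Rep}_k^\infty(G)$ is the category of smooth $k$-linear $G$-representations (stabilizers of vectors are open). $\mathbb{X}=\mathrm{ind}_I^G(k)$ is the space of compactly supported $f:G\to k$ with $f(gi)=f(g)$ for $i\in I$, with action $(gf)(g')=f(g^{-1}g')$; $H=\mathrm{End}_G(\mathbb{X})^{\mathrm{op}}$; $\mathrm{Mod}(H)$ is the category of left $H$-modules. There is an adjunction $F:\mathrm{Mod}(H)\rightleftarrows\mathrm{Rep}^\infty_k(G):U$ ($F$ left adjoint), $FM=\mathbb{X}\otimes_HM$, $UV=V^I\cong\mathrm{Hom}_G(\mathbb{X},V)$. A ring is Gorenstein if it is left and right noetherian with finite injective dimension as a left and right module over itself. An $H$-module $M$ is Gorenstein projective if $M=\ker(d_0)=\mathrm{im}(d_1)$ for an acyclic complex $(Y_\bullet,d_\bullet)$ of projectives which stays exact under $\mathrm{Hom}_H(\cdot,P)$ for all projective $P$. The Gorenstein projective model structure on $\mathrm{Mod}(H)$ is Hovey's cofibrantly generated model structure whose cofibrations are the monomorphisms with Gorenstein projective cokernel, whose fibrations are the epimorphisms, and whose trivial objects are the modules of finite projective dimension (its trivial cofibrations are the monomorphisms with projective cokernel, its trivial fibrations the epimorphisms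 with kernel of finite projective dimension, its weak equivalences the composites of a trivial cofibration followed by a trivial fibration). Right transfer along an adjunction $F:\mathcal{C}\rightleftarrows\mathcal{D}:U$ with $\mathcal{C}$ a model category and $\mathcal{D}$ bicomplete: a morphism $f$ of $\mathcal{D}$ is declared a fibration (resp. weak equivalence, resp. trivial fibration) if $Uf$ is one in $\mathcal{C}$, and a cofibration if it has the left lifting property with respect to all trivial fibrations. The right transfer is said to exist if these classes form part of a model structure on $\mathcal{D}$ (model structures are in the sense of Hovey's book, with functorial factorizations). *)

(* Defs.v *)
From HB Require Import structures.
From mathcomp Require Import all_boot all_order all_algebra.
From mathcomp Require Import finmap all_classical.
From mathcomp Require Import topology.

Set Implicit Arguments.
Unset Strict Implicit.
Unset Printing Implicit Defensive.

Import GRing.Theory.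
Local Open Scope classical_set_scope.
Local Open Scope ring_scope.

Record category := Category {
  obj :> Type;
  hom : obj -> obj -> Type;
  idm : forall x, hom x x;
  comp : forall x y z, hom y z -> hom x y -> hom x z;
  comp1m : forall x y (f : hom x y), comp (idm y) f = f;
  compm1 : forall x y (f : hom x y), comp f (idm x) = f;
  compmA : forall x y z t (h : hom z t) (g : hom y z) (f : hom x y),
    comp h (comp g f) = comp (comp h g) f }.

Arguments hom {c} _ _.
Arguments idm {c} _.
Arguments comp {c x y z} _ _.

Declare Scope cat_scope.
Delimit Scope cat_scope with cat.
Notation "g ∘ f" := (comp g f) (at level 40, left associativity) : cat_scope.
Local Open Scope cat_scope.

Record functor (C D : category) := Functor {
  fobj :> C -> D;
  fmap : forall x y : C, hom x y -> hom (fobj x) (fobj y);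
  fmap_id : forall x, fmap (idm x) = idm (fobj x);
  fmap_comp : forall x y z (g : hom y z) (f : hom x y),
    fmap (g ∘ f) = fmap g ∘ fmap f }.

Arguments fmap {C D} _ {x y} _.

Record adjunction (C D : category) (F : functor C D) (U : functor D C) :=
  Adjunction {
  adj : forall x y, hom (F x) y -> hom x (U y);
  adj_bij : forall x y, bijective (@adj x y);
  adj_natl : forall x x' y (a : hom x' x) (f : hom (F x) y),
    adj (f ∘ fmap F a) = adj f ∘ a;
  adj_natr : forall x y y' (b : hom y y') (f : hom (F x) y),
    adj (b ∘ f) = fmap U b ∘ adj f }.

Definition morphism_class (C : category) := forall x y : C, hom x y -> Prop.

Record is_subcategory (C : category) (W : morphism_class C) : Prop := {
  subcat_id : forall x, W x x (idm x);
  subcat_comp : forall x y z (g : hom y z) (f : hom x y),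
    W _ _ g -> W _ _ f -> W _ _ (g ∘ f) }.

Definition is_retract (C : category) (x y x' y' : C)
    (f : hom x y) (g : hom x' y') : Prop :=
  exists (i : hom x x') (r : hom x' x) (j : hom y y') (s : hom y' y),
    [/\ r ∘ i = idm x, s ∘ j = idm y, g ∘ i = j ∘ f & f ∘ r = s ∘ g].

Definition retract_closed (C : category) (W : morphism_class C) : Prop :=
  forall (x y x' y' : C) (f : hom x y) (g : hom x' y'),
    is_retract f g -> W _ _ g -> W _ _ f.

Definition two_of_three (C : category) (W : morphism_class C) : Prop :=
  forall (x y z : C) (f : hom x y) (g : hom y z),
    [/\ W _ _ f -> W _ _ g -> W _ _ (g ∘ f),
        W _ _ f -> W _ _ (g ∘ f) -> W _ _ g &
        W _ _ g -> W _ _ (g ∘ f) -> W _ _ f].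

Definition has_lifting (C : category) (a b x y : C)
    (i : hom a b) (q : hom x y) : Prop :=
  forall (f : hom a x) (g : hom b y), q ∘ f = g ∘ i ->
    exists h : hom b x, h ∘ i = f /\ q ∘ h = g.

Definition left_lifting (C : category) (W : morphism_class C) :
    morphism_class C :=
  fun a b i => forall (x y : C) (q : hom x y), W _ _ q -> has_lifting i q.

(* Functorial factorizations and model structures are those of Hovey, Model
   Categories, Section 1.1; bicompleteness is not part of a model structure.
   Functoriality is with respect to the morphisms [(a, b)] of the arrow
   category, i.e. commutative squares from [f] to [f']. *)
Record functorial_factorization (C : category) := FunctorialFactorization {
  ff_mid : forall x y : C, hom x y -> C;
  ff_left : forall (x y : C) (f : hom x y), hom x (ff_mid f);
  ff_right : forall (x y : C) (f : hom x y), hom (ff_mid f) y;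
  ff_fact : forall (x y : C) (f : hom x y), ff_right f ∘ ff_left f = f;
  ff_map : forall (x y x' y' : C) (f : hom x y) (f' : hom x' y')
    (a : hom x x') (b : hom y y'), b ∘ f = f' ∘ a ->
    hom (ff_mid f) (ff_mid f');
  ff_map_left : forall (x y x' y' : C) (f : hom x y) (f' : hom x' y')
    (a : hom x x') (b : hom y y') (e : b ∘ f = f' ∘ a),
    ff_map e ∘ ff_left f = ff_left f' ∘ a;
  ff_map_right : forall (x y x' y' : C) (f : hom x y) (f' : hom x' y')
    (a : hom x x') (b : hom y y') (e : b ∘ f = f' ∘ a),
    ff_right f' ∘ ff_map e = b ∘ ff_right f;
  ff_map_id : forall (x y : C) (f : hom x y) (e : idm y ∘ f = f ∘ idm x),
    ff_map e = idm (ff_mid f);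
  ff_map_comp : forall (x y x' y' x'' y'' : C)
    (f : hom x y) (f' : hom x' y') (f'' : hom x'' y'')
    (a : hom x x') (b : hom y y') (a' : hom x' x'') (b' : hom y' y'')
    (e : b ∘ f = f' ∘ a) (e' : b' ∘ f' = f'' ∘ a')
    (e'' : (b' ∘ b) ∘ f = f'' ∘ (a' ∘ a)),
    ff_map e'' = ff_map e' ∘ ff_map e }.

Record model_classes (C : category) := ModelClasses {
  weq : morphism_class C;
  cof : morphism_class C;
  fib : morphism_class C }.

Definition tcof (C : category) (M : model_classes C) : morphism_class C :=
  fun x y f => cof M f /\ weq M f.

Definition tfib (C : category) (M : model_classes C) : morphism_class C :=
  fun x y f => fib M f /\ weq M f.

Definition factors_as (C : category) (L R : morphism_class C)
    (T : functorial_factorization C) : Prop :=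
  forall (x y : C) (f : hom x y), L _ _ (ff_left T f) /\ R _ _ (ff_right T f).

Record is_model_structure (C : category) (M : model_classes C) : Prop := {
  model_weq_subcat : is_subcategory (weq M);
  model_cof_subcat : is_subcategory (cof M);
  model_fib_subcat : is_subcategory (fib M);
  model_two_of_three : two_of_three (weq M);
  model_weq_retract : retract_closed (weq M);
  model_cof_retract : retract_closed (cof M);
  model_fib_retract : retract_closed (fib M);
  model_lift_tcof : forall (a b x y : C) (i : hom a b) (q : hom x y),
    tcof M i -> fib M q -> has_lifting i q;
  model_lift_tfib : forall (a b x y : C) (i : hom a b) (q : hom x y),
    cof M i -> tfib M q -> has_lifting i q;
  model_fact_tfib : exists T, factors_as (cof M) (tfib M) T;
  model_fact_tcof : exists T, factors_as (tcof M) (fib M) T }.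

Definition preimage_class (C D : category) (U : functor D C)
    (W : morphism_class C) : morphism_class D :=
  fun x y f => W _ _ (fmap U f).

(* The trivial fibrations [tfib] of these classes are, by definition, the
   preimages under [U] of the trivial fibrations of [M]. *)
Definition transferred_classes (C D : category) (F : functor C D)
    (U : functor D C) (A : adjunction F U) (M : model_classes C) :
    model_classes D :=
  {| weq := preimage_class U (weq M);
     cof := left_lifting (preimage_class U (tfib M));
     fib := preimage_class U (fib M) |}.

Definition right_transfer_exists (C D : category) (F : functor C D)
    (U : functor D C) (A : adjunction F U) (M : model_classes C) : Prop :=
  is_model_structure (transferred_classes A M).

Lemma linear_eq (R : pzRingType) (M N : lmodType R) (f g : {linear M -> N}) :
  f =1 g -> f = g.
Proof.
case: f => f [[fz] [fs]]; case: g => g [[gz] [gs]] /= efg.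
have e : f = g by apply/funext.
case: _ / e in gz gs efg *.
by rewrite (Prop_irrelevance fz gz) (Prop_irrelevance fs gs).
Qed.

Section ModuleCategory.
Variable R : pzRingType.

Definition mod_id (M : lmodType R) : {linear M -> M} := idfun.
Definition mod_comp (M N P : lmodType R) (g : {linear N -> P})
  (f : {linear M -> N}) : {linear M -> P} := g \o f.

Definition Mod : category.
Proof.
refine (@Category (lmodType R) (fun M N => {linear M -> N}) mod_id mod_comp
  _ _ _) => *; exact: linear_eq.
Defined.
End ModuleCategory.

Section Modules.
Variable R : pzRingType.
Implicit Types (M N P : lmodType R).

Definition exact_at M N P (f : {linear M -> N}) (g : {linear N -> P}) : Prop :=
  forall y, g y = 0 <-> exists x, f x = y.

Definition surj M N (f : {linear M -> N}) : Prop := forall y, exists x, f x = y.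

Definition projective P : Prop :=
  forall M N (e : {linear M -> N}) (f : {linear P -> N}), surj e ->
    exists g : {linear P -> M}, e \o g =1 f.

Definition injective_module N : Prop :=
  forall M P (i : {linear M -> P}) (f : {linear M -> N}), injective i ->
    exists g : {linear P -> N}, g \o i =1 f.

(* A projective resolution [0 -> P_n -> ... -> P_0 -> M -> 0]. *)
Definition pdim_le M (n : nat) : Prop :=
  exists (P : nat -> lmodType R) (d : forall i, {linear P i.+1 -> P i})
      (e : {linear P 0%N -> M}),
    [/\ forall i, projective (P i),
        forall i, (n < i)%N -> forall x : P i, x = 0,
        surj e, exact_at (d 0%N) e & forall i, exact_at (d i.+1) (d i)].

Definition finite_pdim M : Prop := exists n, pdim_le M n.

Definition idim_le M (n : nat) : Prop :=
  exists (E : nat -> lmodType R) (d : forall i, {linear E i -> E i.+1})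
      (e : {linear M -> E 0%N}),
    [/\ forall i, injective_module (E i),
        forall i, (n < i)%N -> forall x : E i, x = 0,
        injective e, exact_at e (d 0%N) & forall i, exact_at (d i) (d i.+1)].

Definition finite_idim M : Prop := exists n, idim_le M n.

Definition left_ideal (J : set R) : Prop :=
  [/\ J 0, forall x y, J x -> J y -> J (x + y) & forall a x, J x -> J (a * x)].

Definition left_noetherian : Prop :=
  forall J : nat -> set R, (forall n, left_ideal (J n)) ->
    (forall n, J n `<=` J n.+1) -> exists n, forall m, (n <= m)%N -> J m = J n.

(* [d i] is the differential from degree [i + 1] to degree [i]. *)
Definition gorenstein_projective M : Prop :=
  exists (Y : int -> lmodType R) (d : forall i, {linear Y (i + 1) -> Y i})
      (e : {linear M -> Y 0}),
    [/\ forall i, projective (Y i),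
        forall i, exact_at (d (i + 1)) (d i),
        forall P, projective P ->
          forall i (f : {linear Y (i + 1) -> P}), (forall y, f (d (i + 1) y) = 0) ->
          exists g : {linear Y i -> P}, g \o d i =1 f,
        injective e & exact_at e (d (-1))].

Definition is_kernel M N (K : lmodType R) (f : {linear M -> N}) (i : {linear K -> M}) : Prop :=
  injective i /\ exact_at i f.

Definition is_cokernel M N (Q : lmodType R) (f : {linear M -> N}) (q : {linear N -> Q}) : Prop :=
  surj q /\ exact_at f q.

Definition gp_cof : morphism_class (Mod R) := fun M N f =>
  injective f /\ exists (Q : lmodType R) (q : {linear N -> Q}),
    is_cokernel f q /\ gorenstein_projective Q.

Definition gp_fib : morphism_class (Mod R) := fun M N f => surj f.

Definition gp_tcof : morphism_class (Mod R) := fun M N f =>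
  injective f /\ exists (Q : lmodType R) (q : {linear N -> Q}), is_cokernel f q /\ projective Q.

Definition gp_tfib : morphism_class (Mod R) := fun M N f =>
  surj f /\ exists (K : lmodType R) (i : {linear K -> M}), is_kernel f i /\ finite_pdim K.

Definition gp_weq : morphism_class (Mod R) := fun M N f =>
  exists (P : Mod R) (i : @hom (Mod R) M P) (q : @hom (Mod R) P N),
    [/\ gp_tcof i, gp_tfib q & f = q ∘ i].

Definition gorenstein_projective_model : model_classes (Mod R) :=
  {| weq := gp_weq; cof := gp_cof; fib := gp_fib |}.

End Modules.

(* Right [R]-modules are left modules over the converse ring [R^c]. *)
Definition gorenstein_ring (R : pzRingType) : Prop :=
  [/\ left_noetherian R, left_noetherian R^c,
      finite_idim (R^o : lmodType R) & finite_idim (R^c^o : lmodType R^c)].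
HB.mixin Record Group_isTopological G of Group G & Topological G := {
  mulg_continuous : continuous (fun x : G * G => (x.1 * x.2)%g);
  invg_continuous : continuous (fun x : G => x^-1%g) }.

#[short(type="topologicalGroupType")]
HB.structure Definition TopologicalGroup :=
  {G of Group G & Topological G & Group_isTopological G}.

Section TopologicalGroups.
Variable G : topologicalGroupType.
Local Open Scope group_scope.

Definition is_subgroup (A : set G) : Prop :=
  [/\ A 1, forall x y, A x -> A y -> A (x * y) & forall x, A x -> A x^-1].

Record open_subgroup := OpenSubgroup {
  subgroup_set :> set G;
  subgroup_is_subgroup : is_subgroup subgroup_set;
  subgroup_open : open subgroup_set }.

Definition left_coset (A : set G) (g : G) : set G := [set (g * a) | a in A].

Definition normal_in (N A : set G) : Prop :=
  forall a x, A a -> N x -> N (a * x * a^-1).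

Definition has_index (A N : set G) (n : nat) : Prop :=
  ([set left_coset N a | a in A] #= `I_n)%card.

(* Since [I] is open, its open subgroups (for the subspace topology) are the
   open subgroups of [G] contained in [I]. *)
Definition profinite (I : open_subgroup) : Prop :=
  [/\ compact (I : set G), hausdorff_space (set_type I) &
      forall W : set G, nbhs 1 W ->
        exists N : open_subgroup, N `<=` I /\ N `<=` W].

Definition pro_p (p : nat) (I : open_subgroup) : Prop :=
  profinite I /\
  forall N : open_subgroup, N `<=` I -> normal_in N I ->
    exists n, has_index I N (p ^ n).

End TopologicalGroups.

Section SmoothRepresentations.
Variables (k : fieldType) (G : topologicalGroupType).

Record smooth_rep := SmoothRep {
  rep_space :> lmodType k;
  rep_act : G -> {linear rep_space -> rep_space};
  rep_act1 : forall v, rep_act 1%g v = v;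
  rep_actM : forall g h v, rep_act (g * h)%g v = rep_act g (rep_act h v);
  rep_smooth : forall v, open [set g | rep_act g v = v] }.

Arguments rep_act {s} _.

Record rep_hom (V W : smooth_rep) := RepHom {
  rep_hom_fun :> {linear V -> W};
  rep_hom_act : forall g v,
    rep_hom_fun (rep_act g v) = rep_act g (rep_hom_fun v) }.

Lemma rep_hom_eq (V W : smooth_rep) (f g : rep_hom V W) : f =1 g -> f = g.
Proof.
case: f => f fP; case: g => g gP /= /linear_eq efg.
by case: _ / efg in gP *; rewrite (Prop_irrelevance fP gP).
Qed.

Definition rep_id (V : smooth_rep) : rep_hom V V :=
  @RepHom V V (mod_id V) (fun _ _ => erefl).

Lemma rep_comp_subproof (V W Z : smooth_rep) (g : rep_hom W Z)
    (f : rep_hom V W) x v :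
  mod_comp g f (rep_act x v) = rep_act x (mod_comp g f v).
Proof. by rewrite /= !rep_hom_act. Qed.

Definition rep_comp (V W Z : smooth_rep) (g : rep_hom W Z) (f : rep_hom V W) :=
  RepHom (rep_comp_subproof g f).

Definition Rep : category.
Proof.
by refine (@Category smooth_rep rep_hom rep_id rep_comp _ _ _) => *;
  exact: rep_hom_eq.
Defined.

Section Additive.
Variables V W : smooth_rep.
Implicit Types f g : rep_hom V W.

Lemma rep_hom0_subproof x v : (\0 : {linear V -> W}) (rep_act x v) =
  rep_act x ((\0 : {linear V -> W}) v).
Proof. by rewrite /= linear0. Qed.
Definition rep_hom0 := RepHom rep_hom0_subproof.

Lemma rep_homN_subproof f x v :
  (\- f : {linear V -> W}) (rep_act x v) = rep_act x ((\- f : {linear V -> W}) v).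
Proof. by rewrite /= rep_hom_act linearN. Qed.
Definition rep_homN f := RepHom (rep_homN_subproof f).

Lemma rep_homD_subproof f g x v :
  (f \+ g : {linear V -> W}) (rep_act x v) = rep_act x ((f \+ g : {linear V -> W}) v).
Proof. by rewrite /= !rep_hom_act linearD. Qed.
Definition rep_homD f g := RepHom (rep_homD_subproof f g).

HB.instance Definition _ := gen_eqMixin (rep_hom V W).
HB.instance Definition _ := gen_choiceMixin (rep_hom V W).

Lemma rep_homDA : associative rep_homD.
Proof. by move=> f g h; apply: rep_hom_eq => v; exact: addrA. Qed.
Lemma rep_homDC : commutative rep_homD.
Proof. by move=> f g; apply: rep_hom_eq => v; exact: addrC. Qed.
Lemma rep_homD0 : left_id rep_hom0 rep_homD.
Proof. by move=> f; apply: rep_hom_eq => v; exact: add0r. Qed.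
Lemma rep_homDN : left_inverse rep_hom0 rep_homN rep_homD.
Proof. by move=> f; apply: rep_hom_eq => v; exact: addNr. Qed.

HB.instance Definition _ :=
  GRing.isZmodule.Build (rep_hom V W) rep_homDA rep_homDC rep_homD0 rep_homDN.
End Additive.

Definition rep_end (V : smooth_rep) := rep_hom V V.

Section EndRing.
Variable V : smooth_rep.
HB.instance Definition _ := GRing.Zmodule.on (rep_end V).

Lemma rep_endMA : associative (@rep_comp V V V).
Proof. by move=> f g h; exact: rep_hom_eq. Qed.
Lemma rep_end1M : left_id (rep_id V) (@rep_comp V V V).
Proof. by move=> f; exact: rep_hom_eq. Qed.
Lemma rep_endM1 : right_id (rep_id V) (@rep_comp V V V).
Proof. by move=> f; exact: rep_hom_eq. Qed.
Lemma rep_endMDl : left_distributive (@rep_comp V V V) (@rep_homD V V).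
Proof. by move=> f g h; exact: rep_hom_eq. Qed.
Lemma rep_endMDr : right_distributive (@rep_comp V V V) (@rep_homD V V).
Proof. by move=> f g h; apply: rep_hom_eq => v; exact: linearD. Qed.

HB.instance Definition _ := GRing.Zmodule_isPzRing.Build (rep_end V)
  rep_endMA rep_end1M rep_endM1 rep_endMDl rep_endMDr.
End EndRing.

End SmoothRepresentations.

Arguments rep_act {k G s} _.

Section Cosets.
Variable G : topologicalGroupType.
Local Open Scope group_scope.

Lemma mulg_continuousl (x : G) : continuous (fun y => x * y).
Proof.
move=> y; apply: (@continuous_comp _ _ _ (fun y => (x, y))
  (fun z : G * G => z.1 * z.2)); last exact: mulg_continuous.
by apply: cvg_pair; [exact: cvg_cst|exact: cvg_id].
Qed.

Lemma mulg_continuousr (x : G) : continuous (fun y => y * x).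
Proof.
move=> y; apply: (@continuous_comp _ _ _ (fun y => (y, x))
  (fun z : G * G => z.1 * z.2)); last exact: mulg_continuous.
by apply: cvg_pair; [exact: cvg_id|exact: cvg_cst].
Qed.

Lemma left_cosetE (A : set G) g : left_coset A g = (fun x => g^-1 * x) @^-1` A.
Proof.
apply/seteqP; split=> [_ [a Aa <-]|x Agx] /=; first by rewrite mulKg.
by exists (g^-1 * x) => //; rewrite mulVKg.
Qed.

Lemma open_left_coset (A : set G) g : open A -> open (left_coset A g).
Proof.
by rewrite left_cosetE => oA; apply: open_comp => // x _; exact: mulg_continuousl.
Qed.

Variable I : open_subgroup G.

Lemma subgroup1 : (I : set G) 1.
Proof. by case: (subgroup_is_subgroup I). Qed.
Lemma subgroupM x y : (I : set G) x -> (I : set G) y -> (I : set G) (x * y).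
Proof. by case: (subgroup_is_subgroup I) => _ + _; exact. Qed.
Lemma subgroupV x : (I : set G) x -> (I : set G) x^-1.
Proof. by case: (subgroup_is_subgroup I) => _ _; exact. Qed.

Definition coset_repr (g : G) : G := xget 1 (left_coset I g).

Lemma coset_reprP g : (I : set G) (g^-1 * coset_repr g).
Proof.
have: left_coset I g (coset_repr g).
  apply: (@xgetI _ _ _ g); exists 1; [exact: subgroup1|exact: mulg1].
by rewrite left_cosetE.
Qed.

Lemma coset_repr_eq g h : (I : set G) (g^-1 * h) -> coset_repr g = coset_repr h.
Proof.
move=> Igh; rewrite /coset_repr; congr xget.
rewrite !left_cosetE; apply/seteqP; split=> x /= Ix.
  rewrite (_ : h^-1 * x = (g^-1 * h)^-1 * (g^-1 * x)).
    exact: subgroupM (subgroupV _) _.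
  by rewrite invgM invgK mulgA mulgK.
rewrite (_ : g^-1 * x = (g^-1 * h) * (h^-1 * x)); first exact: subgroupM.
by rewrite mulgA mulgK.
Qed.

Definition transversal : set G := range coset_repr.

Lemma coset_repr_id t : transversal t -> coset_repr t = t.
Proof. by case=> g _ <-; apply/esym/coset_repr_eq/coset_reprP. Qed.

Lemma transversal_shift x :
  set_bij transversal transversal (fun t => coset_repr (x * t)).
Proof.
split=> [t _|s t|t Tt]; first by exists (x * t).
- rewrite !inE => Ts Tt e.
  rewrite -(coset_repr_id Ts) -(coset_repr_id Tt); apply: coset_repr_eq.
  have Is := coset_reprP (x * s); have It := coset_reprP (x * t).
  rewrite -e in It; have := subgroupM Is (subgroupV It).
  by rewrite !invgM !invgK -!mulgA mulVKg mulKg.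
- exists (coset_repr (x^-1 * t)); first by exists (x^-1 * t).
  rewrite -[RHS](coset_repr_id Tt); apply/esym/coset_repr_eq.
  have := coset_reprP (x^-1 * t).
  by rewrite invgM invgK -mulgA.
Qed.

Lemma compact_transversal (K : set G) :
  compact K -> finite_set (transversal `&` K).
Proof.
pose PG : ptopologicalType := HB.pack (TopologicalGroup.sort G) (isPointed.Build G 1).
rewrite -[compact K]/(@compact PG K) compact_cover.
move=> /(_ G transversal (left_coset I)).
case=> [t _|x _|D DT KD].
- exact: open_left_coset (subgroup_open I).
- exists (coset_repr x); first by exists x.
  by rewrite left_cosetE /=; have := subgroupV (coset_reprP x); rewrite invgM invgK.
- apply: (sub_finite_set _ (finite_fset D)) => t [Tt /KD[d /= dD]].
  rewrite left_cosetE /= => Idt.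
  by rewrite -(coset_repr_id Tt) -(coset_repr_eq Idt) coset_repr_id //; apply/set_mem/DT.
Qed.

End Cosets.

Lemma open_stabilizer (G : topologicalGroupType) (T : Type) (a : G -> T -> T)
    (v : T) : (forall g h w, a (g * h)%g w = a g (a h w)) ->
  (\forall g \near (1%g : G), a g v = v) -> open [set g | a g v = v].
Proof.
move=> aM near1; rewrite openE => g /= gv; rewrite /interior /=.
have := @mulg_continuousl G g^-1%g g; rewrite /continuous_at /= mulVg.
move=> /(_ _ near1); rewrite /nbhs /=; apply: filterS => x /= xv.
by rewrite -(mulVKg g x) aM xv.
Qed.

Section Induction.
Variables (k : fieldType) (G : topologicalGroupType) (I : open_subgroup G).

Record cind := Cind {
  cind_fun :> G -> k;
  cind_inv : forall g i, (I : set G) i -> cind_fun (g * i)%g = cind_fun g;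
  cind_supp : compact (closure [set g | cind_fun g != 0]) }.

Implicit Types f h : cind.

Lemma cind_eq f h : f =1 h -> f = h.
Proof.
case: f => f fI fs; case: h => h hI hs /= /funext efh.
case: _ / efh in hI hs *.
by rewrite (Prop_irrelevance fI hI) (Prop_irrelevance fs hs).
Qed.

HB.instance Definition _ := gen_eqMixin cind.
HB.instance Definition _ := gen_choiceMixin cind.

Lemma compact_supp_sub (a : G -> k) (K : set G) : closed K -> compact K ->
  [set g | a g != 0] `<=` K -> compact (closure [set g | a g != 0]).
Proof.
move=> cK kK aK; apply: (subclosed_compact _ kK); first exact: closed_closure.
by rewrite ((closure_id _).1 cK); exact: closure_subset.
Qed.

Definition cind0 : cind.
Proof.
exists (fun=> 0) => //.
by apply: (compact_supp_sub closed0 compact0) => g /=; rewrite eqxx.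
Defined.

Definition cindN f : cind.
Proof.
exists (fun g => - f g) => [g i Ii|]; first by rewrite cind_inv.
apply: (compact_supp_sub (@closed_closure _ _) (cind_supp (c := f))) => g /=.
by rewrite oppr_eq0 => fg; exact: (@subset_closure _ [set g | f g != 0]).
Defined.

Definition cindD f h : cind.
Proof.
exists (fun g => f g + h g) => [g i Ii|]; first by rewrite !cind_inv.
apply: (compact_supp_sub _ (compactU (cind_supp (c := f)) (cind_supp (c := h)))).
  by apply: closedU; exact: closed_closure.
move=> g /= fhg; have [fg|fg] := eqVneq (f g) 0.
  by right; apply: (@subset_closure _ [set g | h g != 0]); rewrite fg add0r in fhg.
by left; exact: (@subset_closure _ [set g | f g != 0]).
Defined.

Definition cindZ (c : k) f : cind.
Proof.
exists (fun g => c * f g) => [g i Ii|]; first by rewrite !cind_inv.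
apply: (compact_supp_sub (@closed_closure _ _) (cind_supp (c := f))) => g /=.
by rewrite mulf_eq0 negb_or => /andP[_ fg]; exact: (@subset_closure _ [set g | f g != 0]).
Defined.

Definition cind_act (x : G) f : cind.
Proof.
exists (fun g => f (x^-1 * g)%g) => [g i Ii|]; first by rewrite mulgA cind_inv.
pose S := [set g | f g != 0].
apply: (@compact_supp_sub _ ((fun g => x^-1 * g)%g @^-1` closure S)).
- have := @mulg_continuousl G x^-1%g; rewrite continuous_closedP; apply.
  exact: closed_closure.
- rewrite -left_cosetE; apply: continuous_compact; last exact: cind_supp.
  by apply: continuous_subspaceT; exact: mulg_continuousl.
- by move=> g /= fg; exact: (@subset_closure _ S).
Defined.

Lemma cindDA : associative cindD.
Proof. by move=> a b c; apply: cind_eq => g; exact: addrA. Qed.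
Lemma cindDC : commutative cindD.
Proof. by move=> a b; apply: cind_eq => g; exact: addrC. Qed.
Lemma cindD0 : left_id cind0 cindD.
Proof. by move=> a; apply: cind_eq => g; exact: add0r. Qed.
Lemma cindDN : left_inverse cind0 cindN cindD.
Proof. by move=> a; apply: cind_eq => g; exact: addNr. Qed.
HB.instance Definition _ := GRing.isZmodule.Build cind cindDA cindDC cindD0 cindDN.

Lemma cindZA a b f : cindZ a (cindZ b f) = cindZ (a * b) f.
Proof. by apply: cind_eq => g; exact: mulrA. Qed.
Lemma cindZ1 : left_id 1 cindZ.
Proof. by move=> f; apply: cind_eq => g; exact: mul1r. Qed.
Lemma cindZDr : right_distributive cindZ +%R.
Proof. by move=> a f h; apply: cind_eq => g; exact: mulrDr. Qed.
Lemma cindZDl f : {morph cindZ^~ f : a b / a + b}.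
Proof. by move=> a b; apply: cind_eq => g; exact: mulrDl. Qed.
HB.instance Definition _ :=
  GRing.Zmodule_isLmodule.Build k cind cindZA cindZ1 cindZDr cindZDl.

Lemma cind_act_linear x : linear (cind_act x).
Proof. by move=> a f h; exact: cind_eq. Qed.
HB.instance Definition _ x :=
  GRing.isLinear.Build k cind cind *:%R (cind_act x) (cind_act_linear x).

Lemma cind_act1 f : cind_act 1%g f = f.
Proof. by apply: cind_eq => g /=; rewrite invg1 mul1g. Qed.
Lemma cind_actM x y f : cind_act (x * y)%g f = cind_act x (cind_act y f).
Proof. by apply: cind_eq => g /=; rewrite invgM mulgA. Qed.

Lemma cind_fin f : finite_set (transversal I `&` [set g | f g != 0]).
Proof.
apply: sub_finite_set (compact_transversal I (cind_supp (c := f))).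
by apply: setIS; exact: subset_closure.
Qed.

Definition cind_seq f : seq G :=
  (fset_set (transversal I `&` [set g | f g != 0]) : {fset G}).

Lemma cind_seqP f t : (t \in cind_seq f) = (t \in transversal I `&` [set g | f g != 0]).
Proof. by rewrite in_fset_set //; exact: cind_fin. Qed.

Lemma cind_repr f g : f (coset_repr I g) = f g.
Proof. by rewrite -(@cind_inv f g _ (coset_reprP I g)) mulVKg. Qed.

Lemma cind_smooth f : open [set x | cind_act x f = f].
Proof.
apply: open_stabilizer; first exact: cind_actM.
have : \forall x \near (1%g : G),
    forall t, t \in cind_seq f -> (I : set G) (t^-1 * x^-1 * t)%g.
  elim: (cind_seq f) => [|t r IHr]; first by apply: nearW.
  have It : \forall x \near (1%g : G), (I : set G) (t^-1 * x^-1 * t)%g.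
    have c : continuous (fun x : G => t^-1 * x^-1 * t)%g.
      move=> x; apply: (@continuous_comp _ _ _ (fun x : G => t^-1 * x^-1)%g
        (fun x => x * t)%g); last exact: mulg_continuousr.
      apply: (@continuous_comp _ _ _ (fun x : G => x^-1)%g); first exact: invg_continuous.
      exact: mulg_continuousl.
    have := c 1%g; apply; rewrite invg1 mulg1 mulVg.
    by apply: open_nbhs_nbhs; split; [exact: subgroup_open|exact: subgroup1].
  by near=> x => s; rewrite inE => /orP[/eqP->|sr];
    [near: x; exact: It|move: s sr; near: x; exact: IHr].
apply: filterS => x /= Ix; apply: cind_eq => g /=.
have aux y z : (f y != 0) -> (y = x * z \/ z = x * y)%g -> f z = f y.
  move=> fy0 yz; pose t := coset_repr I y.
  have /Ix It : t \in cind_seq f.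
    by rewrite cind_seqP inE; split; [exists y|rewrite /= cind_repr].
  rewrite -(cind_repr f y) -/t.
  have Iyt : (I : set G) (t^-1 * y)%g.
    by have := subgroupV (coset_reprP I y); rewrite invgM invgK.
  suff Itz : (I : set G) (t^-1 * z)%g by rewrite -(@cind_inv f t _ Itz) mulVKg.
  case: yz => [yE|->].
    have -> : z = (x^-1 * y)%g by rewrite yE mulKg.
    rewrite (_ : _ * _ = (t^-1 * x^-1 * t) * (t^-1 * y))%g; first exact: subgroupM.
    by rewrite !mulgA mulgK.
  rewrite (_ : _ * _ = (t^-1 * x^-1 * t)^-1 * (t^-1 * y))%g.
    exact: subgroupM (subgroupV _) _.
  by rewrite !invgM !invgK !mulgA mulgK.
have [fg|fg] := eqVneq (f g) 0; last first.
  by apply: aux => //; left; rewrite mulVKg.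
have [fxg|fxg] := eqVneq (f (x^-1 * g)%g) 0; first by rewrite fg fxg.
by apply/esym/aux => //; right; rewrite mulVKg.
Unshelve. all: by end_near. Qed.

Definition ind_rep : smooth_rep k G :=
  @SmoothRep k G cind cind_act cind_act1 cind_actM cind_smooth.

Section Frobenius.
Variable V : smooth_rep k G.

(* The sum over G/I of [f(t) t v]; it has finite support. *)
Definition frob_fun (v : V) (f : ind_rep) : V :=
  \sum_(t \in transversal I) f t *: rep_act t v.

Lemma frobE v f (r : seq G) : uniq r -> {subset cind_seq f <= r} ->
  {subset r <= transversal I} ->
  frob_fun v f = \sum_(t <- r) f t *: rep_act t v.
Proof.
move=> ur fr rT.
rewrite /frob_fun -(fsbig_widen [set` r] (transversal I)).
- by rewrite -fsbig_seq.
- by move=> t /rT; rewrite inE.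
- move=> t [Tt /= tr]; apply/eqP; rewrite scaler_eq0; apply/orP; left.
  apply: contra_notT tr => ft; apply: fr; rewrite cind_seqP inE; by split.
Qed.

Lemma frob_linear v : linear (frob_fun v).
Proof.
move=> a f h; pose r := undup (cind_seq f ++ cind_seq h).
have rT : {subset r <= transversal I}.
  by move=> t; rewrite mem_undup mem_cat !cind_seqP => /orP[]/set_mem[Tt _]; exact/mem_set.
have fr : {subset cind_seq f <= r}.
  by move=> t tf; rewrite mem_undup mem_cat tf.
have hr : {subset cind_seq h <= r}.
  by move=> t tf; rewrite mem_undup mem_cat tf orbT.
have fhr : {subset cind_seq (a *: f + h) <= r}.
  move=> t; rewrite cind_seqP inE /= => -[Tt]; have [ft|ft _] := eqVneq (f t) 0.
    rewrite /= ft mulr0 add0r => ht.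
    by apply: hr; rewrite cind_seqP inE.
  by apply: fr; rewrite cind_seqP inE.
rewrite !(@frobE v _ r) ?undup_uniq // scaler_sumr -big_split /=.
by apply: eq_bigr => t _; rewrite scalerA scalerDl.
Qed.
HB.instance Definition _ v :=
  GRing.isLinear.Build k ind_rep V *:%R (frob_fun v) (frob_linear v).

Definition I_invariant (v : V) : Prop :=
  forall i, (I : set G) i -> rep_act i v = v.

Lemma frob_act v : I_invariant v -> forall x (f : ind_rep),
  frob_fun v (rep_act x f) = rep_act x (frob_fun v f).
Proof.
move=> vI x f; have fT : {subset cind_seq f <= transversal I}.
  by move=> t; rewrite cind_seqP !inE => -[].
rewrite [in RHS](@frobE v f (cind_seq f)) ?fset_uniq //.
rewrite linear_sum /= /frob_fun (reindex_fsbig _ _ _ _ (transversal_shift I x)).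
under eq_fsbigr => t Tt.
  have It := coset_reprP I (x * t)%g.
  have -> : rep_act x f (coset_repr I (x * t)%g) = f t.
    rewrite /= -[RHS](@cind_inv f t _ It).
    by congr (cind_fun f _); rewrite invgM -!mulgA mulVKg.
  have -> : rep_act (coset_repr I (x * t)%g) v = rep_act x (rep_act t v).
    by rewrite -rep_actM -{2}(vI _ It) -rep_actM mulVKg.
  over.
rewrite -(fsbig_widen [set` cind_seq f] (transversal I)).
- by rewrite -fsbig_seq ?fset_uniq //; apply: eq_bigr => t _; rewrite linearZ.
- by move=> t /fT; rewrite inE.
- move=> t [Tt /= tr]; apply/eqP; rewrite scaler_eq0; apply/orP; left.
  by apply: contra_notT tr => ft; rewrite cind_seqP inE.
Qed.

Definition frob (v : V) (vI : I_invariant v) : rep_hom ind_rep V :=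
  @RepHom k G ind_rep V (frob_fun v) (frob_act vI).

End Frobenius.
End Induction.

Record open_pro_p_subgroup (p : nat) (G : topologicalGroupType) := OpenProP {
  pro_p_subgroup :> open_subgroup G;
  pro_p_subgroup_pro_p : pro_p p pro_p_subgroup }.

Section Hecke.
Variables (k : fieldType) (p : nat) (G : topologicalGroupType).
Variable I : open_pro_p_subgroup p G.

Local Notation X := (ind_rep k I).

(* The converse ring [R^c] is the opposite ring. *)
Definition hecke : pzRingType := (rep_end X)^c.

Lemma closed_open_subgroup (J : open_subgroup G) : closed (J : set G).
Proof.
rewrite -openC openE => x /= nJx; rewrite /interior /=.
apply: (filterS (P := left_coset J x)); last first.
  apply: open_nbhs_nbhs; split; first exact: open_left_coset (subgroup_open J).
  by exists 1%g; [exact: subgroup1|exact: mulg1].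
rewrite left_cosetE => y /= Jxy Jy; apply: nJx.
by have := subgroupM Jy (subgroupV Jxy); rewrite invgM invgK mulVKg.
Qed.

Definition ind_one : X.
Proof.
exists (fun g => if `[< (I : set G) g >] then 1 else 0) => [g i Ii|].
  congr (if _ then _ else _); apply: asbool_equiv_eq; split=> Ig.
    by have := subgroupM Ig (subgroupV Ii); rewrite mulgK.
  exact: subgroupM.
apply: (@compact_supp_sub _ _ _ (I : set G)).
- exact: closed_open_subgroup.
- by case: (pro_p_subgroup_pro_p I) => -[].
- by move=> g /=; case: asboolP => //; rewrite eqxx.
Defined.

Lemma ind_oneE (g : G) :
  (ind_one : cind k I) g = if `[< (I : set G) g >] then 1 else 0.
Proof. by []. Qed.

Lemma ind_one_invariant : I_invariant I ind_one.
Proof.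
move=> i Ii; apply: cind_eq => g /=.
congr (if _ then _ else _); apply: asbool_equiv_eq; split=> Ig.
  by have := subgroupM Ii Ig; rewrite mulVKg.
by apply: subgroupM => //; exact: subgroupV.
Qed.

Lemma ind_span (f : X) :
  f = \sum_(t <- cind_seq f) (f : cind k I) t *: rep_act t ind_one.
Proof.
apply: cind_eq => g.
rewrite (big_morph (fun a : cind k I => a g) (id1 := 0) (op1 := +%R)) //.
have E t : ((f : cind k I) t *: rep_act t ind_one : cind k I) g =
    (f : cind k I) t * (if `[< (I : set G) (t^-1 * g)%g >] then 1 else 0) by [].
have tE t : t \in cind_seq f -> (I : set G) (t^-1 * g)%g -> t = coset_repr I g.
  rewrite cind_seqP => /set_mem[Tt _] It.
  by rewrite -(coset_repr_id Tt); exact: coset_repr_eq.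
have Ig : (I : set G) ((coset_repr I g)^-1 * g)%g.
  by have := subgroupV (coset_reprP I g); rewrite invgM invgK.
have [gf|gf] := boolP (coset_repr I g \in cind_seq f).
  rewrite (bigD1_seq (coset_repr I g)) ?fset_uniq //= big_seq_cond big1.
    rewrite addr0 (asboolT Ig) mulr1; exact/esym/cind_repr.
  move=> t /andP[tf ntg]; case: asboolP => It; last exact: mulr0.
  by rewrite (tE _ tf It) eqxx in ntg.
rewrite big_seq big1 => [|t tf]; last first.
  rewrite E; case: asboolP => It; last exact: mulr0.
  by rewrite -(tE _ tf It) tf in gf.
apply/eqP; apply: contraNT gf => fg; rewrite cind_seqP.
by apply/mem_set; split; [exists g|rewrite /= cind_repr].
Qed.

Lemma rep_hom_invariant (V W : smooth_rep k G) (a : rep_hom V W) (v : V) :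
  I_invariant I v -> I_invariant I (a v).
Proof. by move=> vI i Ii; rewrite -rep_hom_act vI. Qed.

Section Reciprocity.
Variable V : smooth_rep k G.

Lemma frob_one (v : V) : I_invariant I v -> frob_fun v ind_one = v.
Proof.
move=> vI; have I1 : (I : set G) (coset_repr I 1%g).
  by have := coset_reprP I 1%g; rewrite invg1 mul1g.
rewrite /frob_fun -(fsbig_widen [set coset_repr I 1%g] (transversal I)).
- by rewrite fsbig_set1 ind_oneE (asboolT I1) scale1r vI.
- by move=> _ ->; exists 1%g.
- move=> t [Tt nt]; suff t0 : (ind_one : cind k I) t = 0.
    by rewrite /preimage /mkset t0 scale0r.
  rewrite ind_oneE; case: asboolP => // It.
  case: nt; rewrite /= -(coset_repr_id Tt); apply/esym/coset_repr_eq.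
  by rewrite invg1 mul1g.
Qed.

Lemma frob_uniq (a b : rep_hom X V) : a ind_one = b ind_one -> a =1 b.
Proof.
move=> ab f; rewrite (ind_span f) !linear_sum; apply: eq_bigr => t _.
by rewrite !linearZ /= !rep_hom_act ab.
Qed.

Lemma frob_reciprocity :
  (forall a : rep_hom X V, I_invariant I (a ind_one)) /\
  (forall v (vI : I_invariant I v),
     exists! a : rep_hom X V, a ind_one = v).
Proof.
split=> [a|v vI]; first exact/rep_hom_invariant/ind_one_invariant.
exists (frob vI); split=> [|a av]; first exact: frob_one.
by apply/rep_hom_eq/frob_uniq; rewrite av; exact: frob_one.
Qed.

Record invariants := Invariant {
  inv_val :> V;
  inv_valP : I_invariant I inv_val }.

Lemma inv_eq (u v : invariants) : inv_val u = inv_val v -> u = v.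
Proof.
case: u => u uI; case: v => v vI /= uv.
by case: _ / uv in vI *; rewrite (Prop_irrelevance uI vI).
Qed.

HB.instance Definition _ := gen_eqMixin invariants.
HB.instance Definition _ := gen_choiceMixin invariants.

Definition inv0 : invariants.
Proof. by exists 0 => i _; rewrite linear0. Defined.
Definition invN (u : invariants) : invariants.
Proof. by exists (- inv_val u) => i Ii; rewrite linearN /= inv_valP. Defined.
Definition invD (u v : invariants) : invariants.
Proof. by exists (inv_val u + inv_val v) => i Ii; rewrite linearD /= !inv_valP. Defined.

Lemma invDA : associative invD.
Proof. by move=> a b c; apply: inv_eq; exact: addrA. Qed.
Lemma invDC : commutative invD.
Proof. by move=> a b; apply: inv_eq; exact: addrC. Qed.
Lemma invD0 : left_id inv0 invD.
Proof. by move=> a; apply: inv_eq; exact: add0r. Qed.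
Lemma invDN : left_inverse inv0 invN invD.
Proof. by move=> a; apply: inv_eq; exact: addNr. Qed.
HB.instance Definition _ := GRing.isZmodule.Build invariants invDA invDC invD0 invDN.

(* Precomposition with [h] on Hom_G(X, V), transported to V^I along the
   bijection [a |-> a 1_I] of [frob_reciprocity]; explicitly [h v] is the sum
   over [t] in G/I of [(h 1_I)(t) *: t v]. *)
Definition hecke_scale (h : hecke) (v : invariants) : invariants :=
  Invariant (rep_hom_invariant (frob (inv_valP v))
    (rep_hom_invariant (h : rep_end X) ind_one_invariant)).

Lemma frob_hecke_scale (h : hecke) (v : invariants) f :
  frob (inv_valP (hecke_scale h v)) f = frob (inv_valP v) ((h : rep_end X) f).
Proof.
pose b := rep_comp (frob (inv_valP v)) (h : rep_end X).
apply: (@frob_uniq _ b).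
exact: (frob_one (inv_valP (hecke_scale h v))).
Qed.

Lemma hecke_scaleA a b v : hecke_scale a (hecke_scale b v) = hecke_scale (a * b) v.
Proof. by apply: inv_eq; exact: (frob_hecke_scale b v). Qed.
Lemma hecke_scale1 : left_id 1 hecke_scale.
Proof. by move=> v; apply: inv_eq; exact: (frob_one (inv_valP v)). Qed.
Lemma hecke_scaleDr : right_distributive hecke_scale +%R.
Proof.
move=> h u v; apply: inv_eq => /=.
pose a := rep_homD (frob (inv_valP u)) (frob (inv_valP v)).
apply: (@frob_uniq (frob (inv_valP (u + v))) a).
apply: etrans (frob_one (inv_valP (u + v))) _.
exact/esym/(congr2 +%R (frob_one (inv_valP u)) (frob_one (inv_valP v))).
Qed.
Lemma hecke_scaleDl v : {morph hecke_scale^~ v : a b / a + b}.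
Proof. by move=> a b; apply: inv_eq; exact: (linearD (frob_fun v)). Qed.
HB.instance Definition _ := GRing.Zmodule_isLmodule.Build hecke invariants
  hecke_scaleA hecke_scale1 hecke_scaleDr hecke_scaleDl.

End Reciprocity.

Section InvariantsMap.
Variables (V W : smooth_rep k G) (a : rep_hom V W).

Definition inv_map (v : invariants V) : invariants W :=
  Invariant (rep_hom_invariant a (inv_valP v)).

Lemma inv_map_linear : linear inv_map.
Proof.
move=> h u v; apply: inv_eq; rewrite /= linearD; congr (_ + _).
pose b := rep_comp a (frob (inv_valP u)).
apply: (@frob_uniq W b (frob (inv_valP (inv_map u)))).
apply: etrans (esym (frob_one (inv_valP (inv_map u)))).
exact/(congr1 a)/(frob_one (inv_valP u)).
Qed.
HB.instance Definition _ := GRing.isLinear.Build hecke (invariants V) (invariants W)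
  *:%R inv_map inv_map_linear.
End InvariantsMap.

Definition invariants_functor : functor (Rep k G) (Mod hecke).
Proof.
refine (@Functor (Rep k G) (Mod hecke)
  (fun V => (invariants V : lmodType hecke))
  (fun V W (a : rep_hom V W) => (inv_map a : {linear _ -> _})) _ _).
- by move=> V; apply: linear_eq => v; exact: inv_eq.
- by move=> V W Z b a; apply: linear_eq => v; exact: inv_eq.
Defined.

Section Tensor.
Variable M : lmodType hecke.

(* [X] is a right [hecke]-module through [x h = h x]. *)
Record balanced (A : zmodType) (b : X -> M -> A) : Prop := Balanced {
  balancedDl : forall x y m, b (x + y) m = b x m + b y m;
  balancedDr : forall x m n, b x (m + n) = b x m + b x n;
  balancedM : forall x (h : hecke) m, b ((h : rep_end X) x) m = b x (h *: m) }.

Definition formal_eval (A : zmodType) (b : X -> M -> A) (s : seq (X * M)) : A :=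
  \sum_(z <- s) b z.1 z.2.

(* Formal sums of elementary tensors are identified when all balanced maps
   agree on them. *)
Definition tensor_eq (s t : seq (X * M)) : bool :=
  `[< forall (A : zmodType) (b : X -> M -> A), balanced b ->
        formal_eval b s = formal_eval b t >].

Lemma tensor_eq_refl : reflexive tensor_eq.
Proof. by move=> s; apply/asboolP. Qed.
Lemma tensor_eq_sym : symmetric tensor_eq.
Proof.
by move=> s t; apply: asbool_equiv_eq; split=> st A b bb; rewrite st.
Qed.
Lemma tensor_eq_trans : transitive tensor_eq.
Proof.
move=> s r t /asboolP rs /asboolP st; apply/asboolP => A b bb.
by rewrite rs ?st.
Qed.
Canonical tensor_equiv :=
  EquivRel tensor_eq tensor_eq_refl tensor_eq_sym tensor_eq_trans.

Definition tensor : Type := {eq_quot tensor_eq}%qT.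
HB.instance Definition _ := Choice.copy tensor {eq_quot tensor_eq}%qT.

Definition tensor_class (s : seq (X * M)) : tensor :=
  (\pi_({eq_quot tensor_eq}%qT) s)%qT.

Definition tensor_lift (A : zmodType) (b : X -> M -> A) (z : tensor) : A :=
  formal_eval b (repr (z : {eq_quot tensor_eq}%qT)).

Lemma tensor_lift_class (A : zmodType) (b : X -> M -> A) s :
  balanced b -> tensor_lift b (tensor_class s) = formal_eval b s.
Proof.
move=> bb; have : tensor_eq (repr (tensor_class s : {eq_quot tensor_eq}%qT)) s.
  by apply/eqmodP; rewrite reprK.
by move=> /asboolP/(_ A b bb).
Qed.

Lemma tensor_ext (z w : tensor) :
  (forall (A : zmodType) (b : X -> M -> A), balanced b ->
     tensor_lift b z = tensor_lift b w) -> z = w.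
Proof.
move=> zw; rewrite -[z](reprK (z : {eq_quot tensor_eq}%qT)).
rewrite -[w](reprK (w : {eq_quot tensor_eq}%qT)).
by apply/eqmodP/asboolP; exact: zw.
Qed.

Lemma balanced0l (A : zmodType) (b : X -> M -> A) m : balanced b -> b 0 m = 0.
Proof.
move=> bb; have := balancedDl bb 0 0 m.
by rewrite addr0 => /eqP; rewrite -subr_eq subrr eq_sym => /eqP.
Qed.

Lemma balancedNl (A : zmodType) (b : X -> M -> A) x m :
  balanced b -> b (- x) m = - b x m.
Proof.
move=> bb; apply/eqP; rewrite -addr_eq0 -(balancedDl bb) addNr.
by rewrite balanced0l.
Qed.

Definition tensor0 : tensor := tensor_class [::].
Definition tensorN (z : tensor) : tensor :=
  tensor_class [seq (- u.1, u.2) | u <- repr (z : {eq_quot tensor_eq}%qT)].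
Definition tensorD (z w : tensor) : tensor :=
  tensor_class (repr (z : {eq_quot tensor_eq}%qT) ++
                repr (w : {eq_quot tensor_eq}%qT)).

Section Lift.
Variables (A : zmodType) (b : X -> M -> A).
Hypothesis bb : balanced b.

Lemma tensor_lift0 : tensor_lift b tensor0 = 0.
Proof. by rewrite tensor_lift_class // /formal_eval big_nil. Qed.
Lemma tensor_liftN z : tensor_lift b (tensorN z) = - tensor_lift b z.
Proof.
rewrite tensor_lift_class // /tensor_lift /formal_eval big_map -sumrN.
by apply: eq_bigr => u _; exact: balancedNl.
Qed.
Lemma tensor_liftD z w :
  tensor_lift b (tensorD z w) = tensor_lift b z + tensor_lift b w.
Proof. by rewrite tensor_lift_class // /formal_eval big_cat. Qed.
End Lift.

Lemma tensorDA : associative tensorD.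
Proof. by move=> x y z; apply: tensor_ext => A b bb; rewrite !tensor_liftD ?addrA. Qed.
Lemma tensorDC : commutative tensorD.
Proof. by move=> x y; apply: tensor_ext => A b bb; rewrite !tensor_liftD ?(addrC (tensor_lift b x)). Qed.
Lemma tensorD0 : left_id tensor0 tensorD.
Proof. by move=> x; apply: tensor_ext => A b bb; rewrite tensor_liftD ?tensor_lift0 ?add0r. Qed.
Lemma tensorDN : left_inverse tensor0 tensorN tensorD.
Proof.
move=> x; apply: tensor_ext => A b bb.
by rewrite tensor_liftD ?tensor_liftN ?tensor_lift0 ?addNr.
Qed.
HB.instance Definition _ :=
  GRing.isZmodule.Build tensor tensorDA tensorDC tensorD0 tensorDN.

Definition pure (x : X) (m : M) : tensor := tensor_class [:: (x, m)].

Lemma tensor_lift_pure (A : zmodType) (b : X -> M -> A) x m :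
  balanced b -> tensor_lift b (pure x m) = b x m.
Proof. by move=> bb; rewrite tensor_lift_class // /formal_eval big_seq1. Qed.

Lemma tensor_lift_sum (A : zmodType) (b : X -> M -> A) (s : seq (X * M)) :
  balanced b ->
  tensor_lift b (\sum_(u <- s) pure u.1 u.2) = formal_eval b s.
Proof.
move=> bb; rewrite /formal_eval.
rewrite (big_morph (tensor_lift b) (tensor_liftD bb) (tensor_lift0 bb)).
by apply: eq_bigr => u _; rewrite tensor_lift_pure.
Qed.

Lemma tensor_span (z : tensor) : 
  z = \sum_(u <- repr (z : {eq_quot tensor_eq}%qT)) pure u.1 u.2.
Proof. by apply: tensor_ext => A b bb; rewrite tensor_lift_sum. Qed.

Lemma pure_balanced : balanced pure.
Proof.
split=> *; apply: tensor_ext => A b bb; rewrite ?tensor_liftD //.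
- by rewrite !tensor_lift_pure // (balancedDl bb).
- by rewrite !tensor_lift_pure // (balancedDr bb).
- by rewrite !tensor_lift_pure // (balancedM bb).
Qed.

Lemma eq_additive_tensor (A : zmodType) (f g : tensor -> A) :
  {morph f : x y / x + y} -> {morph g : x y / x + y} ->
  (forall x m, f (pure x m) = g (pure x m)) -> f =1 g.
Proof.
have zero (h : tensor -> A) : {morph h : x y / x + y} -> h 0 = 0.
  move=> hD; have := hD 0 0.
  by rewrite addr0 => /eqP; rewrite -subr_eq subrr eq_sym => /eqP.
move=> fD gD fg z; rewrite (tensor_span z).
rewrite (big_morph f fD (zero f fD)) (big_morph g gD (zero g gD)).
by apply: eq_bigr => u _.
Qed.

Definition tensor_scale (c : k) : tensor -> tensor :=
  tensor_lift (fun x m => pure (c *: x) m).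

Lemma scale_balanced c : balanced (fun x m => pure (c *: x) m).
Proof.
split=> [x y m|x m n|x h m].
- by rewrite scalerDr (balancedDl pure_balanced).
- exact: (balancedDr pure_balanced).
- by rewrite -linearZ (balancedM pure_balanced).
Qed.

Lemma tensor_scaleDr : right_distributive tensor_scale +%R.
Proof. by move=> c; exact: tensor_liftD (scale_balanced c). Qed.

Lemma tensor_scale_pure c x m : tensor_scale c (pure x m) = pure (c *: x) m.
Proof. exact: tensor_lift_pure (scale_balanced c). Qed.

Lemma tensor_scaleA a b z : tensor_scale a (tensor_scale b z) = tensor_scale (a * b) z.
Proof.
apply: (eq_additive_tensor (f := tensor_scale a \o tensor_scale b)) z.
- by move=> x y /=; rewrite !tensor_scaleDr.
- exact: tensor_scaleDr.
- by move=> x m; rewrite /= !tensor_scale_pure scalerA.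
Qed.
Lemma tensor_scale1 : left_id 1 tensor_scale.
Proof.
apply: (eq_additive_tensor (g := id)) => //; first exact: tensor_scaleDr.
by move=> x m; rewrite tensor_scale_pure scale1r.
Qed.
Lemma tensor_scaleDl z : {morph tensor_scale^~ z : a b / a + b}.
Proof.
move=> a b; apply: (eq_additive_tensor
  (g := fun z => tensor_scale a z + tensor_scale b z)) z.
- exact: tensor_scaleDr.
- by move=> x y; rewrite !tensor_scaleDr addrACA.
- by move=> x m; rewrite !tensor_scale_pure scalerDl (balancedDl pure_balanced).
Qed.
HB.instance Definition _ := GRing.Zmodule_isLmodule.Build k tensor
  tensor_scaleA tensor_scale1 tensor_scaleDr tensor_scaleDl.

Lemma tensor_lift_linear (V : lmodType k) (b : X -> M -> V) : balanced b ->
  (forall c x m, b (c *: x) m = c *: b x m) -> linear (tensor_lift b).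
Proof.
move=> bb bZ c z w; rewrite [LHS](tensor_liftD bb); congr (_ + _).
apply: (eq_additive_tensor (f := tensor_lift b \o tensor_scale c)
  (g := fun z => c *: tensor_lift b z)) z.
- by move=> x y /=; rewrite tensor_scaleDr (tensor_liftD bb).
- by move=> x y /=; rewrite (tensor_liftD bb) scalerDr.
- by move=> x m; rewrite /= tensor_scale_pure !tensor_lift_pure.
Qed.

Definition tensor_act (g : G) : tensor -> tensor :=
  tensor_lift (fun x m => pure (rep_act g x) m).

Lemma act_balanced g : balanced (fun x m => pure (rep_act g x) m).
Proof.
split=> [x y m|x m n|x h m].
- by rewrite linearD (balancedDl pure_balanced).
- exact: (balancedDr pure_balanced).
- by rewrite -rep_hom_act (balancedM pure_balanced).
Qed.

Lemma tensor_actD g : {morph tensor_act g : x y / x + y}.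
Proof. exact: tensor_liftD (act_balanced g). Qed.

Lemma tensor_act_pure g x m : tensor_act g (pure x m) = pure (rep_act g x) m.
Proof. exact: tensor_lift_pure (act_balanced g). Qed.

Lemma pureZ c x m : pure (c *: x) m = c *: pure x m.
Proof. exact/esym/tensor_scale_pure. Qed.

Lemma tensor_act_linear g : linear (tensor_act g).
Proof.
apply: tensor_lift_linear; first exact: act_balanced.
by move=> c x m; rewrite linearZ pureZ.
Qed.
HB.instance Definition _ g :=
  GRing.isLinear.Build k tensor tensor *:%R (tensor_act g) (tensor_act_linear g).

Lemma tensor_act1 z : tensor_act 1%g z = z.
Proof.
apply: (eq_additive_tensor (g := id)) z => //; first exact: tensor_actD.
by move=> x m; rewrite tensor_act_pure rep_act1.
Qed.
Lemma tensor_actM g h z : tensor_act (g * h)%g z = tensor_act g (tensor_act h z).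
Proof.
apply: (eq_additive_tensor (g := tensor_act g \o tensor_act h)) z.
- exact: tensor_actD.
- by move=> x y /=; rewrite !tensor_actD.
- by move=> x m; rewrite /= !tensor_act_pure rep_actM.
Qed.
Lemma tensor_smooth z : open [set g | tensor_act g z = z].
Proof.
apply: open_stabilizer; first exact: tensor_actM.
rewrite (tensor_span z); elim: (repr _) => [|u s IHs].
  by apply: nearW => g; rewrite big_nil linear0.
have u1 : \forall g \near (1%g : G), rep_act g u.1 = u.1.
  by apply: open_nbhs_nbhs; split; [exact: rep_smooth|exact: rep_act1].
near=> g; rewrite big_cons linearD /= tensor_act_pure; congr (pure _ _ + _).
  by near: g; exact: u1.
by near: g; exact: IHs.
Unshelve. all: by end_near. Qed.

Definition tensor_rep : smooth_rep k G :=
  @SmoothRep k G tensor tensor_act tensor_act1 tensor_actM tensor_smooth.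

Section TensorHom.
Variables (V : smooth_rep k G) (b : X -> M -> V).
Hypothesis bb : balanced b.
Hypothesis bZ : forall c x m, b (c *: x) m = c *: b x m.
Hypothesis bG : forall g x m, b (rep_act g x) m = rep_act g (b x m).

Definition tensor_linear : {linear tensor_rep -> V} :=
  HB.pack (tensor_lift b : tensor_rep -> V)
    (GRing.isLinear.Build k tensor_rep V *:%R (tensor_lift b)
       (tensor_lift_linear bb bZ)).

Lemma tensor_hom_act g z :
  tensor_linear (rep_act g z) = rep_act g (tensor_linear z).
Proof.
apply: (eq_additive_tensor (f := fun z => tensor_lift b (tensor_act g z))
  (g := fun z => rep_act g (tensor_lift b z))) z.
- by move=> x y; rewrite tensor_actD (tensor_liftD bb).
- by move=> x y; rewrite (tensor_liftD bb) linearD.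
- by move=> x m; rewrite /= tensor_act_pure !tensor_lift_pure.
Qed.

Definition tensor_hom : rep_hom tensor_rep V := RepHom tensor_hom_act.

Lemma tensor_homE x m : tensor_hom (pure x m) = b x m.
Proof. exact: tensor_lift_pure. Qed.
End TensorHom.

Lemma tensor_hom_eq (V : smooth_rep k G) (f g : rep_hom tensor_rep V) :
  (forall x m, f (pure x m) = g (pure x m)) -> f = g.
Proof.
by move=> fg; apply: rep_hom_eq; apply: eq_additive_tensor fg; exact: linearD.
Qed.

End Tensor.

Section TensorMap.
Variables (M N : lmodType hecke) (a : {linear M -> N}).

Lemma map_balanced : balanced (fun x m => pure x (a m)).
Proof.
split=> [x y m|x m n|x h m].
- exact: (balancedDl (pure_balanced N)).
- by rewrite linearD (balancedDr (pure_balanced N)).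
- by rewrite linearZ (balancedM (pure_balanced N)).
Qed.

Definition tensor_map : rep_hom (tensor_rep M) (tensor_rep N) :=
  @tensor_hom M (tensor_rep N) _ map_balanced (fun c x m => pureZ c x (a m))
    (fun g x m => esym (tensor_act_pure g x (a m))).

Lemma tensor_mapE x m : tensor_map (pure x m) = pure x (a m).
Proof. exact: (tensor_lift_pure _ _ map_balanced). Qed.
End TensorMap.

Definition tensor_functor : functor (Mod hecke) (Rep k G).
Proof.
refine (@Functor (Mod hecke) (Rep k G) tensor_rep
  (fun M N (a : {linear M -> N}) => tensor_map a) _ _).
- by move=> M; apply: tensor_hom_eq => x m; exact: tensor_mapE.
- move=> M N P b a; apply: tensor_hom_eq => x m.
  apply: etrans (tensor_mapE _ x m) (esym _).
  exact: etrans (congr1 (tensor_map b) (tensor_mapE a x m)) (tensor_mapE b x _).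
Defined.

Section Adjunction.
Variables (M : lmodType hecke) (V : smooth_rep k G).

Lemma unit_hom_act (f : rep_hom (tensor_rep M) V) (m : M) g x :
  f (pure (rep_act g x) m) = rep_act g (f (pure x m)).
Proof. by rewrite -rep_hom_act /= tensor_act_pure. Qed.

Definition unit_inv (f : rep_hom (tensor_rep M) V) (m : M) : invariants V.
Proof.
by exists (f (pure ind_one m)) => i Ii; rewrite -unit_hom_act ind_one_invariant.
Defined.

Lemma frob_unit_inv (f : rep_hom (tensor_rep M) V) m x :
  frob_fun (unit_inv f m) x = f (pure x m).
Proof.
rewrite (ind_span x) linear_sum.
pose pm y := pure y m : tensor_rep M.
have pmD : {morph pm : y z / y + z} by move=> y z; exact: (balancedDl (pure_balanced M)).
rewrite -/(pm _) (big_morph pm pmD (balanced0l _ (pure_balanced M))) linear_sum.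
apply: eq_bigr => t _; rewrite /pm pureZ !linearZ; congr (_ *: _).
rewrite unit_hom_act; apply: etrans (frob_act (inv_valP _) t ind_one) _.
congr (rep_act t _); exact: (frob_one (inv_valP (unit_inv f m))).
Qed.

Lemma unit_inv_linear f : linear (unit_inv f).
Proof.
move=> h m n; apply: inv_eq; rewrite /= (balancedDr (pure_balanced M)) linearD.
congr (_ + _); rewrite -(balancedM (pure_balanced M)).
exact/esym/frob_unit_inv.
Qed.
HB.instance Definition _ f := GRing.isLinear.Build hecke M (invariants V)
  *:%R (unit_inv f) (unit_inv_linear f).

Lemma counit_balanced (a : {linear M -> invariants V}) :
  balanced (fun x m => frob_fun (inv_val (a m)) x).
Proof.
split=> [x y m|x m n|x h m].
- exact: linearD.
- rewrite linearD.
  pose c := rep_homD (frob (inv_valP (a m))) (frob (inv_valP (a n))).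
  apply: (@frob_uniq V (frob (inv_valP (a m + a n))) c).
  apply: etrans (frob_one (inv_valP (a m + a n))) _.
exact/esym/(congr2 +%R (frob_one (inv_valP (a m))) (frob_one (inv_valP (a n)))).
- by rewrite linearZ; exact/esym/(frob_hecke_scale h (a m)).
Qed.

Lemma counit_scale (a : {linear M -> invariants V}) c (x : X) m :
  frob_fun (inv_val (a m)) (c *: x) = c *: frob_fun (inv_val (a m)) x.
Proof. exact: linearZ. Qed.

Definition counit_hom (a : {linear M -> invariants V}) : rep_hom (tensor_rep M) V :=
  tensor_hom (counit_balanced a) (counit_scale a)
    (fun g x m => frob_act (inv_valP (a m)) g x).

Lemma unit_inv_bij :
  bijective (fun f : rep_hom (tensor_rep M) V =>
    (unit_inv f : {linear M -> invariants V})).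
Proof.
exists counit_hom => [f|a].
  by apply: tensor_hom_eq => x m; rewrite tensor_homE; exact: frob_unit_inv.
apply: linear_eq => m; apply: inv_eq.
rewrite /= tensor_lift_pure; first by rewrite frob_one //; exact: inv_valP.
exact: counit_balanced.
Qed.
End Adjunction.

Definition hecke_adjunction : adjunction tensor_functor invariants_functor.
Proof.
refine (@Adjunction _ _ tensor_functor invariants_functor
  (fun M V f => (unit_inv f : {linear M -> invariants V})) _ _ _).
- exact: unit_inv_bij.
- move=> M N V a f; apply: linear_eq => m; apply: inv_eq => /=.
  by congr (rep_hom_fun f _); exact: tensor_mapE.
- by move=> M V W b f; apply: linear_eq => m; exact: inv_eq.
Defined.

End Hecke.

(* Main.v *)
(** The Gorenstein projective modules play no role for the transfer, as its
    cofibrations are defined by a lifting property.  Call a sequence of matrices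
    over H exact on column vectors a chain, and an H-module M acyclic if every
    chain is exact on M in degree 1.  Acyclicity is inherited by syzygies: chains
    can be shifted to the left, and continued to the right since H is right
    noetherian.  If n is the left injective dimension of H, then the tail, from
    degree n on, of a free resolution of H/J is a chain for each left ideal J.
    Hence Ext^(n+1)(H/J, -) vanishes on all syzygies of an acyclic M; these have
    injective dimension at most n by Baer's criterion, so that
    Ext^1(Omega^n M, Omega^(n+1) M) = 0 and Omega^n M is projective.  Thus acyclic
    means of finite projective dimension, and the weak equivalences turn out to be
    the maps that are bijective on the cohomology in degree 1 of all chains, which
    makes two-out-of-three and stability under retracts formal.

    In Rep, a trivial cofibration followed by a fibration is
    V -> V + X^(W^I) -> W, where X^I is free of rank one over H.  For the other
    factorization one adjoins to V generators of type X for the elements of W^I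
    and for all solutions demanded by the acyclicity of the kernel.  The demands
    concern the new generators as well, but instead of iterating over omega one
    takes all generators at once, as an inductive type of terms, modulo the
    smallest subrepresentation that imposes the equations.  Maps out of the
    resulting object, in particular the lifts against trivial fibrations, are
    defined by recursion on terms, so that neither the smallness of X nor any
    exactness property of the tensor product is needed. *)
From HB Require Import structures.
From mathcomp Require Import all_boot all_order all_algebra.
From mathcomp Require Import finmap all_classical.
From mathcomp Require Import topology.
Require Import Defs.

Set Implicit Arguments.
Unset Strict Implicit.
Unset Printing Implicit Defensive.

Import GRing.Theory.
Local Open Scope classical_set_scope.
Local Open Scope ring_scope.
Local Open Scope cat_scope.

Definition lin (R : pzRingType) (M N : lmodType R) (f : M -> N) (h : linear f) :
    {linear M -> N} :=
  HB.pack f (GRing.isLinear.Build R M N *:%R f h).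

(** * Submodules, quotients, free modules *)

Section Submodules.
Variables (R : pzRingType) (M : lmodType R).

Record submodule := Submodule {
  subm_set :> M -> Prop;
  subm0 : subm_set 0;
  subm_lin : forall a x y, subm_set x -> subm_set y -> subm_set (a *: x + y) }.

Variable S : submodule.

Lemma submD x y : S x -> S y -> S (x + y).
Proof. by move=> Sx Sy; rewrite -[x]scale1r; exact: subm_lin. Qed.
Lemma submZ a x : S x -> S (a *: x).
Proof. by move=> Sx; rewrite -[_ *: _]addr0; apply: subm_lin => //; exact: subm0. Qed.
Lemma submN x : S x -> S (- x).
Proof. by rewrite -scaleN1r; exact: submZ. Qed.
Lemma submB x y : S x -> S y -> S (x - y).
Proof. by move=> Sx Sy; apply/submD/submN. Qed.
Lemma subm_sum (J : Type) (r : seq J) (F : J -> M) :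
  (forall j, S (F j)) -> S (\sum_(j <- r) F j).
Proof. by move=> SF; elim/big_ind: _ => //; [exact: subm0|exact: submD]. Qed.

Record subm_type := SubmElt { subm_val :> M; subm_valP : S subm_val }.

Lemma subm_eq (u v : subm_type) : subm_val u = subm_val v -> u = v.
Proof.
case: u => u uI; case: v => v vI /= uv.
by case: _ / uv in vI *; rewrite (Prop_irrelevance uI vI).
Qed.

HB.instance Definition _ := gen_eqMixin subm_type.
HB.instance Definition _ := gen_choiceMixin subm_type.

Definition subm_type0 := SubmElt (subm0 S).
Definition subm_typeN (u : subm_type) := SubmElt (submN (subm_valP u)).
Definition subm_typeD (u v : subm_type) := SubmElt (submD (subm_valP u) (subm_valP v)).
Definition subm_typeZ a (u : subm_type) := SubmElt (submZ a (subm_valP u)).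

Lemma subm_typeDA : associative subm_typeD.
Proof. by move=> a b c; apply: subm_eq; exact: addrA. Qed.
Lemma subm_typeDC : commutative subm_typeD.
Proof. by move=> a b; apply: subm_eq; exact: addrC. Qed.
Lemma subm_typeD0 : left_id subm_type0 subm_typeD.
Proof. by move=> a; apply: subm_eq; exact: add0r. Qed.
Lemma subm_typeDN : left_inverse subm_type0 subm_typeN subm_typeD.
Proof. by move=> a; apply: subm_eq; exact: addNr. Qed.
HB.instance Definition _ := GRing.isZmodule.Build subm_type
  subm_typeDA subm_typeDC subm_typeD0 subm_typeDN.

Lemma subm_typeZA a b u : subm_typeZ a (subm_typeZ b u) = subm_typeZ (a * b) u.
Proof. by apply: subm_eq; exact: scalerA. Qed.
Lemma subm_typeZ1 : left_id 1 subm_typeZ.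
Proof. by move=> u; apply: subm_eq; exact: scale1r. Qed.
Lemma subm_typeZDr : right_distributive subm_typeZ +%R.
Proof. by move=> a u v; apply: subm_eq; exact: scalerDr. Qed.
Lemma subm_typeZDl u : {morph subm_typeZ^~ u : a b / a + b}.
Proof. by move=> a b; apply: subm_eq; exact: scalerDl. Qed.
HB.instance Definition _ := GRing.Zmodule_isLmodule.Build R subm_type
  subm_typeZA subm_typeZ1 subm_typeZDr subm_typeZDl.

Lemma subm_val_linear : linear subm_val. Proof. by []. Qed.
HB.instance Definition _ :=
  GRing.isLinear.Build R subm_type M *:%R subm_val subm_val_linear.

Definition subm_incl : {linear subm_type -> M} := subm_val.

Lemma subm_incl_inj : injective subm_incl. Proof. exact: subm_eq. Qed.

Section Corestriction.
Variables (N : lmodType R) (f : {linear N -> M}) (Sf : forall x, S (f x)).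

Definition corestr_fun (x : N) : subm_type := SubmElt (Sf x).
Lemma corestr_linear : linear corestr_fun.
Proof. by move=> a x y; apply: subm_eq; exact: linearP. Qed.
Definition corestr : {linear N -> subm_type} := lin corestr_linear.
End Corestriction.

Section Quotient.

(** The set of candidates depends only on the coset of [x], and so does the choice made in it. The
    quotient is encoded by these chosen representatives. *)
Definition quot_repr (x : M) : M := xget 0 [set y | S (x - y)].

Lemma quot_reprP x : S (x - quot_repr x).
Proof.
by apply: (@xgetI _ _ [set y | S (x - y)] x); rewrite /= subrr; exact: subm0.
Qed.

Lemma quot_repr_eq x y : S (x - y) -> quot_repr x = quot_repr y.
Proof.
move=> Sxy; rewrite /quot_repr; congr xget; apply/seteqP; split=> z /= Sz.
  by have := submB Sz Sxy; rewrite opprB addrC addrA subrK.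
by have := submD Sxy Sz; rewrite addrA subrK.
Qed.

Record quot := QuotElt { quot_val : M; quot_valP : quot_repr quot_val = quot_val }.

Lemma quot_val_inj (u v : quot) : quot_val u = quot_val v -> u = v.
Proof.
case: u => u uI; case: v => v vI /= uv.
by case: _ / uv in vI *; rewrite (Prop_irrelevance uI vI).
Qed.

HB.instance Definition _ := gen_eqMixin quot.
HB.instance Definition _ := gen_choiceMixin quot.

Lemma quot_repr_idem x : quot_repr (quot_repr x) = quot_repr x.
Proof. by apply/esym/quot_repr_eq/quot_reprP. Qed.

Definition quot_class (x : M) : quot := QuotElt (quot_repr_idem x).

Lemma quot_classE x y : (quot_class x = quot_class y) <-> S (x - y).
Proof.
split=> [/(congr1 quot_val) /= xy|Sxy]; last exact/quot_val_inj/quot_repr_eq.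
have := submB (quot_reprP x) (quot_reprP y); rewrite xy.
by rewrite opprB addrA subrK.
Qed.

Lemma quot_valK u : quot_class (quot_val u) = u.
Proof. by apply: quot_val_inj; exact: quot_valP. Qed.

Definition quot0 := quot_class 0.
Definition quotN (u : quot) := quot_class (- quot_val u).
Definition quotD (u v : quot) := quot_class (quot_val u + quot_val v).
Definition quotZ a (u : quot) := quot_class (a *: quot_val u).

Lemma quot_classN x : quot_class (- x) = quotN (quot_class x).
Proof. by apply/quot_classE; rewrite -opprD; exact/submN/quot_reprP. Qed.
Lemma quot_classD x y : quot_class (x + y) = quotD (quot_class x) (quot_class y).
Proof. by apply/quot_classE; rewrite opprD addrACA; apply: submD; exact: quot_reprP. Qed.
Lemma quot_classZ a x : quot_class (a *: x) = quotZ a (quot_class x).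
Proof. by apply/quot_classE; rewrite -scalerBr; exact/submZ/quot_reprP. Qed.

Lemma quot_ind (P : quot -> Prop) : (forall x, P (quot_class x)) -> forall u, P u.
Proof. by move=> Px u; rewrite -(quot_valK u). Qed.

Lemma quotDA : associative quotD.
Proof.
by elim/quot_ind=> x; elim/quot_ind=> y; elim/quot_ind=> z;
  rewrite -!quot_classD addrA.
Qed.
Lemma quotDC : commutative quotD.
Proof. by elim/quot_ind=> x; elim/quot_ind=> y; rewrite -!quot_classD addrC. Qed.
Lemma quotD0 : left_id quot0 quotD.
Proof. by elim/quot_ind=> x; rewrite -quot_classD add0r. Qed.
Lemma quotDN : left_inverse quot0 quotN quotD.
Proof. by elim/quot_ind=> x; rewrite -quot_classN -quot_classD addNr. Qed.
HB.instance Definition _ := GRing.isZmodule.Build quot quotDA quotDC quotD0 quotDN.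

Lemma quotZA a b u : quotZ a (quotZ b u) = quotZ (a * b) u.
Proof. by elim/quot_ind: u => x; rewrite -!quot_classZ scalerA. Qed.
Lemma quotZ1 : left_id 1 quotZ.
Proof. by elim/quot_ind=> x; rewrite -quot_classZ scale1r. Qed.
Lemma quotZDr : right_distributive quotZ +%R.
Proof.
move=> a; elim/quot_ind=> x; elim/quot_ind=> y.
by rewrite -[_ + _]quot_classD -!quot_classZ scalerDr quot_classD.
Qed.
Lemma quotZDl u : {morph quotZ^~ u : a b / a + b}.
Proof. by move=> a b; elim/quot_ind: u => x; rewrite -!quot_classZ scalerDl quot_classD. Qed.
HB.instance Definition _ := GRing.Zmodule_isLmodule.Build R quot
  quotZA quotZ1 quotZDr quotZDl.

Lemma quot_class_linear : linear quot_class.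
Proof. by move=> a x y; rewrite quot_classD quot_classZ. Qed.
Definition quot_proj : {linear M -> quot} := lin quot_class_linear.

Lemma quot_proj_surj : surj quot_proj.
Proof. by elim/quot_ind=> x; exists x. Qed.

Lemma quot_proj_eq0 x : quot_proj x = 0 <-> S x.
Proof. by rewrite -[0]/(quot_class 0) quot_classE subr0. Qed.
End Quotient.

End Submodules.

(** * Factorization of linear maps and short exact sequences *)

Section Factorization.
Variable R : pzRingType.
Implicit Types (M N A B E P : lmodType R).

(** A set-theoretic section of [e] followed by [f] is linear, because [f] does not see the ambiguity
    of the section. *)
Lemma factor_surj A B N (e : {linear A -> B}) (f : {linear A -> N}) :
  surj e -> (forall x, e x = 0 -> f x = 0) -> exists g : {linear B -> N}, g \o e =1 f.
Proof.
move=> /choice[s es] ef; have fs x : f (s (e x)) = f x.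
  by apply/eqP; rewrite -subr_eq0 -linearB ef // linearB es subrr.
have gP : linear (f \o s).
  move=> a x y; rewrite /= -linearP -[RHS]fs; congr (f (s _)).
  by rewrite linearP !es.
by exists (lin gP) => x; exact: fs.
Qed.

Definition ker_sub M N (f : {linear M -> N}) : submodule M.
Proof.
exists [set x | f x = 0] => [|a x y /= fx fy]; first exact: linear0.
by rewrite linearP fx fy scaler0 addr0.
Defined.

Definition im_sub M N (f : {linear M -> N}) : submodule N.
Proof.
exists (range f) => [|a _ _ [x _ <-] [y _ <-]]; first by exists 0; rewrite ?linear0.
by exists (a *: x + y); rewrite ?linearP.
Defined.

Definition ker M N (f : {linear M -> N}) : lmodType R := subm_type (ker_sub f).
Definition coker M N (f : {linear M -> N}) : lmodType R := quot (im_sub f).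

Definition ses M N A (i : {linear M -> N}) (e : {linear N -> A}) : Prop :=
  [/\ injective i, surj e & exact_at i e].

Lemma ses_ker M N (f : {linear M -> N}) : surj f -> ses (subm_incl (ker_sub f)) f.
Proof.
move=> fs; split=> //; first exact: subm_incl_inj.
move=> y; split=> [fy|[x <-]]; first by exists (SubmElt (S := ker_sub f) fy).
exact: (subm_valP x).
Qed.

Lemma ses_coker M N (f : {linear M -> N}) : injective f ->
  ses f (quot_proj (im_sub f)).
Proof.
move=> fi; split=> //; first exact: quot_proj_surj.
by move=> y; rewrite quot_proj_eq0; split=> [[x _ <-]|[x <-]]; exists x.
Qed.

Lemma ses_comp0 M N A (i : {linear M -> N}) (e : {linear N -> A}) x :
  ses i e -> e (i x) = 0.
Proof. by case=> _ _ ie; apply/ie; exists x. Qed.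

(** [f] descends to the image of [u], and injectivity extends it from this submodule to [B]. *)
Lemma injective_factor E A B (u : {linear A -> B}) (f : {linear A -> E}) :
  injective_module E -> (forall x, u x = 0 -> f x = 0) ->
  exists g : {linear B -> E}, g \o u =1 f.
Proof.
move=> injE uf; have uI x : im_sub u (u x) by exists x.
have cs : surj (corestr uI) by move=> y; have [x _ xy] := subm_valP y; exists x; exact: subm_eq.
have cf x : corestr uI x = 0 -> f x = 0.
  by move=> e; apply: uf; exact: (congr1 (@subm_val _ _ _) e).
have [f' f'P] := factor_surj cs cf.
have [g gP] := injE _ _ (subm_incl (im_sub u)) f' (@subm_incl_inj _ _ _).
by exists g => x; rewrite -f'P /= -gP.
Qed.

Lemma projective_section P N (e : {linear N -> P}) :
  projective P -> surj e -> exists s : {linear P -> N}, e \o s =1 id.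
Proof. by move=> pP es; exact: (pP _ _ e (mod_id P) es). Qed.

End Factorization.

(** * Direct sums of copies of a module *)

Section FiniteSupport.
Variables (R : pzRingType) (T : choiceType) (M : lmodType R).

Definition finsupp_sub : submodule (T -> M).
Proof.
exists (fun f => finite_set [set t | f t != 0]) => [|a f h fF hF].
  by apply: (sub_finite_set _ (@finite_set0 T)) => t /=; rewrite eqxx.
apply: (sub_finite_set (B := [set t | f t != 0] `|` [set t | h t != 0])); last first.
  by rewrite finite_setU.
move=> t /=; rewrite -[(_ + _) t]/(a *: f t + h t).
have [->|] := eqVneq (f t) 0; last by left.
by have [->|] := eqVneq (h t) 0; [rewrite scaler0 addr0 eqxx|right].
Defined.

Definition finsupp : lmodType R := subm_type finsupp_sub.

Definition coef (f : finsupp) (t : T) : M := subm_val f t.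
Arguments coef : simpl never.

Lemma coef_eq (f h : finsupp) : coef f =1 coef h -> f = h.
Proof. by move=> fh; apply/subm_eq/funext. Qed.

Lemma coef_linear t : linear (coef^~ t). Proof. by []. Qed.
Definition coef_map t : {linear finsupp -> M} := lin (coef_linear t).

Lemma coefD f h t : coef (f + h) t = coef f t + coef h t. Proof. by []. Qed.
Lemma coefZ a f t : coef (a *: f) t = a *: coef f t. Proof. by []. Qed.
Lemma coef_sum (J : Type) (r : seq J) (F : J -> finsupp) t :
  coef (\sum_(j <- r) F j) t = \sum_(j <- r) coef (F j) t.
Proof. exact: (linear_sum (coef_map t)). Qed.

Definition supp (f : finsupp) : seq T := (fset_set [set t | coef f t != 0] : {fset T}).

Lemma mem_supp f t : (t \in supp f) = (coef f t != 0).
Proof.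
by rewrite in_fset_set; [apply/idP/idP; rewrite in_setE|exact: (subm_valP f)].
Qed.

Definition single_fun (t : T) (x : M) (s : T) : M := if s == t then x else 0.

Lemma single_finite t x : finsupp_sub (single_fun t x).
Proof.
apply: (sub_finite_set (B := [set t])); last exact: finite_set1.
by move=> s; rewrite /= /single_fun; case: (s =P t) => // _; rewrite eqxx.
Qed.

Definition single t x : finsupp := SubmElt (single_finite t x).

Lemma coef_single t x s : coef (single t x) s = if s == t then x else 0.
Proof. by []. Qed.

Lemma single_linear t : linear (single t).
Proof.
move=> a x y; apply: coef_eq => s; rewrite coefD coefZ !coef_single.
by case: eqP; rewrite ?scaler0 ?addr0.
Qed.
HB.instance Definition _ t :=
  GRing.isLinear.Build R M finsupp *:%R (single t) (single_linear t).

Lemma finsupp_sum (f : finsupp) : f = \sum_(t <- supp f) single t (coef f t).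
Proof.
apply: coef_eq => s; rewrite coef_sum; have [sf|] := boolP (s \in supp f).
  rewrite (bigD1_seq s) ?fset_uniq //= coef_single eqxx big1 ?addr0 // => t ts.
  by rewrite coef_single eq_sym (negPf ts).
rewrite mem_supp negbK => /eqP sf; rewrite sf big1 // => t _.
by rewrite coef_single; case: eqP => // <-.
Qed.

Lemma finsupp_ext (N : lmodType R) (f h : {linear finsupp -> N}) :
  (forall t x, f (single t x) = h (single t x)) -> f =1 h.
Proof.
by move=> fh u; rewrite (finsupp_sum u) !linear_sum; apply: eq_bigr => t _.
Qed.

Section Lift.
Variables (N : lmodType R) (w : T -> {linear M -> N}).

Definition lift_fun (f : finsupp) : N := \sum_(t <- supp f) w t (coef f t).

Lemma lift_seq f (r : seq T) : uniq r -> {subset supp f <= r} ->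
  lift_fun f = \sum_(t <- r) w t (coef f t).
Proof.
move=> ur fr; rewrite (bigID (mem (supp f))) /= [X in _ + X]big1 => [|t]; last first.
  by rewrite mem_supp negbK => /eqP->; rewrite linear0.
rewrite addr0 -big_filter; apply: perm_big; apply: uniq_perm.
- exact: fset_uniq.
- exact: filter_uniq.
by move=> t; rewrite mem_filter /=; have [/fr->|] := boolP (t \in supp f).
Qed.

Lemma lift_linear : linear lift_fun.
Proof.
move=> a f h; pose r := undup (supp f ++ supp h).
have fr : {subset supp f <= r} by move=> t tf; rewrite mem_undup mem_cat tf.
have hr : {subset supp h <= r} by move=> t tf; rewrite mem_undup mem_cat tf orbT.
have fhr : {subset supp (a *: f + h) <= r}.
  move=> t; rewrite mem_undup mem_cat !mem_supp coefD coefZ.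
  by have [->|//] := eqVneq (coef f t) 0; rewrite scaler0 add0r.
rewrite !(lift_seq (r := r)) ?undup_uniq // scaler_sumr -big_split /=.
by apply: eq_bigr => t _; rewrite coefD coefZ linearP.
Qed.

Definition lift : {linear finsupp -> N} := lin lift_linear.

Lemma lift_single t x : lift (single t x) = w t x.
Proof.
rewrite [LHS](lift_seq (r := [:: t])) // => [|s].
  by rewrite big_seq1 coef_single eqxx.
by rewrite mem_supp coef_single inE; case: (s =P t) => // _; rewrite eqxx.
Qed.
End Lift.

End FiniteSupport.

(** * Free modules and syzygies *)

Section Free.
Variable R : pzRingType.
Implicit Types (M N P : lmodType R).

Definition free (T : choiceType) : lmodType R := finsupp T (R^o : lmodType R).

Lemma orbit_linear M (x : M) : linear (fun r : R^o => (r : R) *: x).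
Proof. by move=> a r s; rewrite scalerDl scalerA. Qed.
Definition orbit_map M (x : M) : {linear (R^o : lmodType R) -> M} := lin (orbit_linear x).

Definition free_lift (T : choiceType) M (w : T -> M) : {linear free T -> M} :=
  lift (fun t => orbit_map (w t)).

Definition basis (T : choiceType) (t : T) : free T :=
  @single R T (R^o : lmodType R) t (1 : R).

Lemma single_basis (T : choiceType) (t : T) (r : R) :
  @single R T (R^o : lmodType R) t r = r *: basis t.
Proof. by rewrite -linearZ; congr (single t _); rewrite -[LHS]mulr1. Qed.

Lemma free_lift_basis (T : choiceType) M (w : T -> M) t : free_lift w (basis t) = w t.
Proof. by rewrite /free_lift lift_single /= scale1r. Qed.

Lemma free_ext (T : choiceType) M (f h : {linear free T -> M}) :
  (forall t, f (basis t) = h (basis t)) -> f =1 h.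
Proof.
by move=> fh; apply: finsupp_ext => t r; rewrite single_basis !linearZ; congr (_ *: _).
Qed.

Lemma free_projective (T : choiceType) : projective (free T).
Proof.
move=> M N e f /choice[s es]; exists (free_lift (fun t => s (f (basis t)))).
apply: (free_ext (f := e \o free_lift _)) => t.
by apply: etrans (es _); congr (e _); exact: free_lift_basis.
Qed.

Definition cover M : {linear free M -> M} := free_lift id.

Lemma cover_surj M : surj (@cover M).
Proof. by move=> x; exists (basis x); rewrite free_lift_basis. Qed.

(** All elements of [M] serve as generators, so the syzygy is a function of [M] and can be
    iterated. *)
Definition syzygy M : lmodType R := ker (@cover M).

Lemma ses_syzygy M : ses (subm_incl (ker_sub (@cover M))) (@cover M).
Proof. exact/ses_ker/cover_surj. Qed.

End Free.

(** * Chains and acyclic modules *)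

Section Exactness.
Variable R : pzRingType.
Implicit Types (M N L P K Q : lmodType R).

(** This is Hom(-, M) applied to the map of free left modules that multiplies row vectors by [d] on
    the right; a column over [M] is a map from a free module to [M]. *)
Definition act M (p q : nat) (d : 'I_q -> 'I_p -> R) (a : 'I_p -> M) (l : 'I_q) : M :=
  \sum_j d l j *: a j.

Lemma act_map M N p q (d : 'I_q -> 'I_p -> R) (f : {linear M -> N}) (a : 'I_p -> M) l :
  f (act d a l) = act d (fun j => f (a j)) l.
Proof. by rewrite linear_sum; apply: eq_bigr => j _; rewrite linearZ. Qed.

Lemma eq_act M p q (d : 'I_q -> 'I_p -> R) (a b : 'I_p -> M) l :
  a =1 b -> act d a l = act d b l.
Proof. by move=> ab; apply: eq_bigr => j _; rewrite ab. Qed.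

Lemma actB M p q (d : 'I_q -> 'I_p -> R) (a b : 'I_p -> M) l :
  act d (fun j => a j - b j) l = act d a l - act d b l.
Proof. by rewrite -sumrB; apply: eq_bigr => j _; rewrite scalerBr. Qed.

Lemma actD M p q (d : 'I_q -> 'I_p -> R) (a b : 'I_p -> M) l :
  act d (fun j => a j + b j) l = act d a l + act d b l.
Proof. by rewrite -big_split; apply: eq_bigr => j _; rewrite scalerDr. Qed.

Lemma act0 M p q (d : 'I_q -> 'I_p -> R) (a : 'I_p -> M) l :
  (forall j, a j = 0) -> act d a l = 0.
Proof. by move=> a0; apply: big1 => j _; rewrite a0 scaler0. Qed.

Definition matrix_complex (p q r : nat) (d1 : 'I_r -> 'I_q -> R) (d0 : 'I_q -> 'I_p -> R) :=
  forall l j, \sum_k d1 l k * d0 k j = 0.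

Lemma act_act M p q r (d1 : 'I_r -> 'I_q -> R) (d0 : 'I_q -> 'I_p -> R)
    (a : 'I_p -> M) l :
  matrix_complex d1 d0 -> act d1 (act d0 a) l = 0.
Proof.
move=> d10; rewrite /act; under eq_bigr do rewrite scaler_sumr.
rewrite exchange_big big1 // => j _ /=.
under eq_bigr do rewrite scalerA.
by rewrite -scaler_suml d10 scale0r.
Qed.

Definition exact_on M p q r (d1 : 'I_r -> 'I_q -> R) (d0 : 'I_q -> 'I_p -> R) : Prop :=
  forall a : 'I_q -> M, (forall l, act d1 a l = 0) ->
    exists b : 'I_p -> M, forall j, a j = act d0 b j.

Section ShortExact.
Variables (L P M : lmodType R) (i : {linear L -> P}) (e : {linear P -> M}).
Hypothesis ie : ses i e.

(** Long exact sequence: the connecting map sends a class of [M] to the cohomology of [L] one degree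
    higher, which vanishes, so the class comes from [P], where it is zero. *)
Lemma exact_on_quotient p q r s (d2 : 'I_s -> 'I_r -> R) (d1 : 'I_r -> 'I_q -> R)
    (d0 : 'I_q -> 'I_p -> R) : matrix_complex d2 d1 ->
  exact_on P d1 d0 -> exact_on L d2 d1 -> exact_on M d1 d0.
Proof.
have [ii es iee] := ie.
move=> d21 exP exL a a0; have /choice[a' a'P] : forall j, exists x, e x = a j by move=> j.
have /choice[c cP] : forall l, exists x, i x = act d1 a' l.
  by move=> l; apply/iee; rewrite act_map -[RHS](a0 l); apply: eq_act.
have [l|b bP] := exL c.
  apply: ii; rewrite act_map (eq_act _ _ cP) act_act // linear0 //.
have [l|b' b'P] := exP (fun j => a' j - i (b j)).
  by rewrite actB -act_map -bP cP subrr.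
exists (fun j => e (b' j)) => j.
by rewrite -act_map -b'P linearB a'P (ses_comp0 _ ie) subr0.
Qed.

(** The same long exact sequence: a class of [L] dies in [P], hence comes from the cohomology of [M]
    one degree lower. *)
Lemma exact_on_sub p q r s (d2 : 'I_s -> 'I_r -> R) (d1 : 'I_r -> 'I_q -> R)
    (d0 : 'I_q -> 'I_p -> R) : matrix_complex d1 d0 ->
  exact_on P d2 d1 -> exact_on M d1 d0 -> exact_on L d2 d1.
Proof.
have [ii es iee] := ie.
move=> d10 exP exM a a0; have [l|b bP] := exP (fun j => i (a j)).
  by rewrite -act_map a0 linear0.
have [l|c cP] := exM (fun j => e (b j)).
  by rewrite -act_map -bP (ses_comp0 _ ie).
have /choice[c' c'P] : forall j, exists x, e x = c j by move=> j.
have /choice[b' b'P] : forall j, exists x, i x = b j - act d0 c' j.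
  move=> j; apply/iee; rewrite linearB act_map cP.
  by rewrite (eq_act _ _ c'P) subrr.
exists b' => l; apply: ii; rewrite bP act_map (eq_act _ _ b'P) actB.
by rewrite act_act // subr0.
Qed.
End ShortExact.

Lemma exact_on_retract M N (i : {linear M -> N}) (r : {linear N -> M}) p q s
    (d1 : 'I_s -> 'I_q -> R) (d0 : 'I_q -> 'I_p -> R) :
  r \o i =1 id -> exact_on N d1 d0 -> exact_on M d1 d0.
Proof.
move=> ri exN a a0; have [l|b bP] := exN (fun j => i (a j)).
  by rewrite -act_map a0 linear0.
by exists (fun j => r (b j)) => j; rewrite -act_map -bP; exact/esym/ri.
Qed.

Lemma exact_on_finsupp (T : choiceType) M p q s
    (d1 : 'I_s -> 'I_q -> R) (d0 : 'I_q -> 'I_p -> R) :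
  exact_on M d1 d0 -> exact_on (finsupp T M) d1 d0.
Proof.
move=> exM a a0.
(* Solutions are chosen coordinatewise. The second clause forces the zero solution wherever all
   entries of [a] vanish, which makes the supports finite in [bfin]. *)
have /choice[b bP] : forall t, exists b : 'I_p -> M,
    (forall j, coef (a j) t = act d0 b j) /\ ((forall j, coef (a j) t = 0) -> b = fun=> 0).
  move=> t; have [at0|nat0] := pselect (forall j, coef (a j) t = 0).
    by exists (fun=> 0); split=> // j; rewrite act0.
  have [l|b bP] := exM (fun j => coef (a j) t); last by exists b; split.
  by rewrite -(act_map _ (coef_map M t)) a0 linear0.
have bfin i : finsupp_sub T M (b^~ i).
  apply: (sub_finite_set (B := \bigcup_(j in [set: 'I_q]) [set t | coef (a j) t != 0])).
    move=> t /= bt; apply: contrapT => nt; case/eqP: bt.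
    rewrite (bP t).2 // => j; apply/eqP/negPn/negP => atj.
    by apply: nt; exists j.
  by apply: bigcup_finite => // j _; exact: (subm_valP (a j)).
exists (fun i => SubmElt (bfin i)) => j; apply: coef_eq => t.
by rewrite (bP t).1 -[RHS]/(coef_map M t _) act_map.
Qed.

Lemma exact_on_projective P p q s (d1 : 'I_s -> 'I_q -> R) (d0 : 'I_q -> 'I_p -> R) :
  projective P -> exact_on (R^o : lmodType R) d1 d0 -> exact_on P d1 d0.
Proof.
move=> pP exR; have [i iP] := projective_section pP (@cover_surj _ P).
exact: (exact_on_retract iP (exact_on_finsupp exR)).
Qed.

(* A complex of finitely generated free left modules that stays exact under
   [Hom(-, R)]; it need not be exact itself. *)
Record chain := Chain {
  dim : nat -> nat;
  dif : forall i, 'I_(dim i.+1) -> 'I_(dim i) -> R;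
  dif_complex : forall i, matrix_complex (dif (i := i.+1)) (dif (i := i));
  dif_exact : forall i, exact_on (R^o : lmodType R) (dif (i := i.+1)) (dif (i := i)) }.

Definition chain_drop (c : chain) : chain :=
  @Chain (fun i => dim c i.+1) (fun i => @dif c i.+1)
    (fun i => @dif_complex c i.+1) (fun i => @dif_exact c i.+1).

(** The additional matrix turns degree 0 of the given chain into degree 1 of [chain_cons], so that
    acyclicity gives exactness there as well. *)
Definition extendable_chains : Prop :=
  forall c : chain, exists (p : nat) (d : 'I_(dim c 0) -> 'I_p -> R),
    matrix_complex (@dif c 0) d /\ exact_on (R^o : lmodType R) (@dif c 0) d.

Definition chain_cons (c : chain) p (d : 'I_(dim c 0) -> 'I_p -> R)
    (dc : matrix_complex (@dif c 0) d)
    (de : exact_on (R^o : lmodType R) (@dif c 0) d) : chain.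
Proof.
refine (@Chain (fun i => if i is j.+1 then dim c j else p)
  (fun i => match i with 0 => d | j.+1 => @dif c j end) _ _).
  by case=> [|i]; [exact: dc|exact: dif_complex].
by case=> [|i]; [exact: de|exact: dif_exact].
Defined.

Definition acyclic M : Prop := forall c : chain, exact_on M (@dif c 1) (@dif c 0).

Lemma acyclic_projective P : projective P -> acyclic P.
Proof. by move=> pP c; apply: exact_on_projective => //; exact: dif_exact. Qed.

(** The cohomology of [L] is needed one degree up, that is, in degree 1 of the dropped chain. *)
Lemma acyclic_quotient L P M (i : {linear L -> P}) (e : {linear P -> M}) :
  ses i e -> acyclic L -> acyclic P -> acyclic M.
Proof.
move=> ie aL aP c; apply: (exact_on_quotient ie (@dif_complex c 1)) => //.
exact: (aL (chain_drop c)).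
Qed.

(** The cohomology of [M] is needed one degree down, whence the extension of the chain. *)
Lemma acyclic_sub L P M (i : {linear L -> P}) (e : {linear P -> M}) :
  extendable_chains -> ses i e -> acyclic P -> acyclic M -> acyclic L.
Proof.
move=> ext ie aP aM c; have [p [d [dc de]]] := ext c.
exact: (exact_on_sub ie dc (aP c) (aM (chain_cons dc de))).
Qed.

(* Bijectivity on ker(dif 1) / im(dif 0), the Tate cohomology of the chain. *)
Definition tate_iso M N (f : {linear M -> N}) : Prop := forall c : chain,
  (forall a : 'I_(dim c 1) -> M, (forall l, act (@dif c 1) a l = 0) ->
     (exists b, forall j, f (a j) = act (@dif c 0) b j) ->
     exists b, forall j, a j = act (@dif c 0) b j) /\
  (forall y : 'I_(dim c 1) -> N, (forall l, act (@dif c 1) y l = 0) ->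
     exists a b, (forall l, act (@dif c 1) a l = 0) /\
       forall j, y j = f (a j) + act (@dif c 0) b j).

Lemma tate_iso_comp M N L (f : {linear M -> N}) (g : {linear N -> L}) :
  tate_iso f -> tate_iso g -> tate_iso (mod_comp g f).
Proof.
move=> tf tg c; split=> [a a0 [b gfa]|y y0].
  apply: (tf c).1 => //; apply: (tg c).1; last by exists b.
  by move=> l; rewrite -act_map a0 linear0.
have [x [b [x0 yE]]] := (tg c).2 y y0; have [a [b' [a0 xE]]] := (tf c).2 x x0.
exists a, (fun j => g (b' j) + b j); split=> // j.
by rewrite yE xE linearD act_map actD addrA.
Qed.

Lemma tate_iso_cancel_left M N L (f : {linear M -> N}) (g : {linear N -> L}) :
  tate_iso f -> tate_iso (mod_comp g f) -> tate_iso g.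
Proof.
move=> tf tgf c; split=> [y y0 [b gy]|z z0].
  have [a [b' [a0 yE]]] := (tf c).2 y y0.
  have [|b'' aE] := (tgf c).1 a a0.
    exists (fun j => b j - g (b' j)) => j.
    by rewrite actB -gy -act_map -linearB yE addrK.
  by exists (fun j => f (b'' j) + b' j) => j; rewrite yE aE act_map actD.
have [a [b [a0 zE]]] := (tgf c).2 z z0.
by exists (fun j => f (a j)), b; split=> // l; rewrite -act_map a0 linear0.
Qed.

Lemma tate_iso_cancel_right M N L (f : {linear M -> N}) (g : {linear N -> L}) :
  tate_iso g -> tate_iso (mod_comp g f) -> tate_iso f.
Proof.
move=> tg tgf c; split=> [a a0 [b fa]|y y0].
  apply: (tgf c).1 => //; exists (fun j => g (b j)) => j.
  by rewrite -act_map -fa.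
have gy0 l : act (@dif c 1) (fun j => g (y j)) l = 0 by rewrite -act_map y0 linear0.
have [a [b [a0 gyE]]] := (tgf c).2 _ gy0.
have [||b' bE] := (tg c).1 (fun j => y j - f (a j)).
- by move=> l; rewrite actB y0 -act_map a0 linear0 subr0.
- by exists b => j; rewrite linearB gyE addrC addKr.
by exists a, b'; split=> // j; rewrite -bE addrC subrK.
Qed.

Lemma tate_iso_id M : tate_iso (mod_id M).
Proof.
move=> c; split=> [a _ [b ab]|y y0]; first by exists b.
by exists y, (fun=> 0); split=> // j; rewrite act0 ?addr0.
Qed.

Lemma tate_iso_retract M N M' N' (f : {linear M -> N}) (g : {linear M' -> N'})
    (i : {linear M -> M'}) (r : {linear M' -> M})
    (j : {linear N -> N'}) (s : {linear N' -> N}) :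
  r \o i =1 id -> s \o j =1 id -> g \o i =1 j \o f -> f \o r =1 s \o g ->
  tate_iso g -> tate_iso f.
Proof.
move=> ri sj gi fr tg c; split=> [a a0 [b fa]|y y0].
  have [||b' iaE] := (tg c).1 (fun l => i (a l)).
  - by move=> l; rewrite -act_map a0 linear0.
  - by exists (fun l => j (b l)) => l; rewrite -act_map -fa; exact: gi.
  by exists (fun l => r (b' l)) => l; rewrite -act_map -iaE; exact/esym/ri.
have [|a [b [a0 jyE]]] := (tg c).2 (fun l => j (y l)).
  by move=> l; rewrite -act_map y0 linear0.
exists (fun l => r (a l)), (fun l => s (b l)); split=> l.
  by rewrite -act_map a0 linear0.
by rewrite -act_map [f _](fr (a l)) /= -linearD -jyE; exact/esym/sj.
Qed.

(** Acyclicity of the kernel expressed inside [M]; for maps on invariants this avoids forming the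
    kernel of a map of representations. *)
Definition acyclic_kernel M N (f : {linear M -> N}) : Prop :=
  forall (c : chain) (a : 'I_(dim c 1) -> M), (forall l, act (@dif c 1) a l = 0) ->
    (forall j, f (a j) = 0) ->
    exists b : 'I_(dim c 0) -> M, (forall i, f (b i) = 0) /\
      forall j, a j = act (@dif c 0) b j.

Lemma acyclic_kernelP M N K (f : {linear M -> N}) (i : {linear K -> M}) :
  is_kernel f i -> acyclic_kernel f <-> acyclic K.
Proof.
case=> ii ifx; split=> [af c a a0|aK c a a0 fa].
  have [l||b [fb aE]] := af c (fun j => i (a j)).
  - by rewrite -act_map a0 linear0.
  - by move=> j; apply/ifx; exists (a j).
  have /choice[b' b'P] : forall j, exists x, i x = b j by move=> j; apply/ifx.
  exists b' => j; apply: ii; rewrite aE act_map.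
  by apply: eq_act => ?; rewrite b'P.
have /choice[a' a'P] : forall j, exists x, i x = a j by move=> j; apply/ifx.
have [l|b bE] := aK c a'.
  by apply: ii; rewrite act_map linear0 -[RHS](a0 l); exact: eq_act.
exists (fun j => i (b j)); split=> j; first by apply/ifx; exists (b j).
by rewrite -a'P bE act_map.
Qed.

(** Long exact sequence of the kernel. Surjectivity in degree 0, read off from the extended chain,
    and injectivity in degree 1 kill the cohomology of the kernel in degree 1. Conversely, its
    vanishing in degrees 1 and 2 gives injectivity and surjectivity in degree 1. *)
Lemma tate_iso_surj M N (f : {linear M -> N}) : extendable_chains -> surj f ->
  tate_iso f <-> acyclic_kernel f.
Proof.
move=> ext fs; split=> [tf c k k0 fk|af c].
  have [b kE] : exists b, forall j, k j = act (@dif c 0) b j.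
    by apply: (tf c).1 => //; exists (fun=> 0) => j; rewrite act0.
  have [p [d [dc de]]] := ext c.
  have [l|b' [y [b'0 fbE]]] := (tf (chain_cons dc de)).2 (fun j => f (b j)).
    by rewrite /= -act_map -kE fk.
  have /choice[y' y'P] : forall j, exists x, f x = y j by move=> j; exact: fs.
  (* The primitive [b] of [k] is moved into the kernel of [f] by subtracting the cocycle [b'] and
     the coboundary of [y'], both of which [dif c 0] kills. *)
  exists (fun j => b j - b' j - act d y' j); split=> j.
    rewrite !linearB /= fbE act_map (eq_act _ _ y'P).
    by rewrite addrAC addrK subrr.
  by rewrite !actB -kE [act _ b' j]b'0 act_act // !subr0.
split=> [a a0 [y faE]|y y0].
  have /choice[y' y'P] : forall j, exists x, f x = y j by move=> j; exact: fs.
  have [l||b [fb aE]] := af c (fun j => a j - act (@dif c 0) y' j).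
  - by rewrite actB a0 act_act ?subr0 //; exact: dif_complex.
  - by move=> j; rewrite linearB faE act_map (eq_act _ _ y'P) subrr.
  by exists (fun j => b j + y' j) => j; rewrite actD -aE subrK.
have /choice[a aP] : forall j, exists x, f x = y j by move=> j; exact: fs.
have [l||b [fb aE]] := af (chain_drop c) (act (@dif c 1) a).
- by apply: act_act; exact: (@dif_complex c 1).
- by move=> j; rewrite act_map (eq_act _ _ aP).
exists (fun j => a j - b j), (fun=> 0); split=> l.
  by rewrite actB aE subrr.
by rewrite linearB fb aP subr0 act0 ?addr0.
Qed.

(** A section [s] of [q] splits the sequence, [x - s (q x)] being the projection onto [M], and the
    complement [Q] is acyclic. *)
Lemma tate_iso_projective_cokernel M N Q (i : {linear M -> N}) (q : {linear N -> Q}) :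
  injective i -> is_cokernel i q -> projective Q -> tate_iso i.
Proof.
move=> ii [qs qi] pQ; have [s sP] := projective_section pQ qs.
have inv x : exists m, i m = x - s (q x).
  by apply/qi; rewrite linearB [q (s _)](sP (q x)) subrr.
have qi0 m : q (i m) = 0 by apply/qi; exists m.
move=> c; split=> [a a0 [b iaE]|y y0].
  have /choice[m mP] := fun j => inv (b j); exists m => j.
  apply: ii; rewrite act_map (eq_act _ _ mP) actB -iaE.
  rewrite -(act_map _ s (fun j => q (b j))) -(act_map _ q) -iaE.
  by rewrite qi0 linear0 subr0.
have [l|b bP] := @acyclic_projective Q pQ c (fun j => q (y j)).
  by rewrite -act_map y0 linear0.
have /choice[m mP] := fun j => inv (y j); exists m, (fun j => s (b j)); split=> l.
  apply: ii; rewrite act_map (eq_act _ _ mP) actB y0.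
  by rewrite -(act_map _ s (fun j => q (y j))) -(act_map _ q) y0 !(linear0, addr0).
by rewrite mP -act_map -bP subrK.
Qed.

Hypothesis ext : extendable_chains.
Hypothesis acyclicP : forall M, finite_pdim M <-> acyclic M.

Lemma gp_tfibP M N (f : {linear M -> N}) : gp_tfib f <-> surj f /\ acyclic_kernel f.
Proof.
split=> [[fs [K [i [ki /acyclicP aK]]]]|[fs af]].
  by split=> //; apply/(acyclic_kernelP ki).
split=> //; have [ii _ fi] := ses_ker fs.
exists (ker f), (subm_incl (ker_sub f)); split=> //.
by apply/acyclicP/(acyclic_kernelP (f := f) (i := subm_incl _)).
Qed.

Lemma gp_weqP M N (f : {linear M -> N}) : gp_weq f <-> tate_iso f.
Proof.
split=> [[P [i [q [[ii [Q [c [ci pQ]]]] /gp_tfibP[qs aq] ->]]]]|tf].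
  apply: tate_iso_comp; first exact: tate_iso_projective_cokernel ci pQ.
  exact/tate_iso_surj.
(* A free module covering [N] is added to [M]: the inclusion of [M] has a free cokernel, and the map
   to [N] becomes surjective. *)
pose P : lmodType R := (M * free R N)%type.
have iP : linear (fun x : M => (x, 0) : P).
  by move=> a x y; apply/eqP; rewrite xpair_eqE /= scaler0 addr0 !eqxx.
have qP : linear (fun x : P => f x.1 + @cover R N x.2).
  by move=> a x y; rewrite !linearP scalerDr addrACA.
have cP : linear (fun x : P => x.2) by [].
pose i := lin iP; pose q := lin qP; pose c := lin cP.
have fE : f = mod_comp q i.
  by apply: linear_eq => x; rewrite -[RHS]/(f x + @cover R N 0) linear0 addr0.
have ii : injective i by move=> x y [].
have ci : is_cokernel i c.
  split=> [y|[x y]]; first by exists (0, y).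
  by split=> [/= ->|[z [_ <-]]] //; exists x.
have pF := @free_projective R N.
have qs : surj q.
  move=> y; have [x xy] := cover_surj y; exists (0, x).
  by rewrite -[LHS]/(f 0 + @cover R N x) linear0 add0r.
exists P, i, q; split=> //; first by split=> //; exists (free R N), c; split.
apply/gp_tfibP; split=> //; apply/tate_iso_surj => //.
have ti := tate_iso_projective_cokernel ii ci pF.
by apply: (tate_iso_cancel_left ti); rewrite -fE.
Qed.

End Exactness.

(** * Noetherian rings, Baer's criterion, homological dimension *)

Section Noetherian.
Variable R : pzRingType.
Implicit Types (M N : lmodType R).

Fixpoint span M (s : seq M) (u : M) : Prop :=
  if s is x :: s' then exists a, span s' (u - a *: x) else u = 0.

Lemma span_lin M (s : seq M) a u v : span s u -> span s v -> span s (a *: u + v).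
Proof.
elim: s u v => [|x s IHs] u v /=; first by move=> -> ->; rewrite scaler0 addr0.
move=> [b ub] [c vc]; exists (a * b + c).
by have := IHs _ _ ub vc; rewrite scalerBr scalerA addrACA -opprD -scalerDl.
Qed.

Lemma span_cat M (s t : seq M) u v : span s u -> span t v -> span (s ++ t) (u + v).
Proof.
elim: s u => [|x s IHs] u /=; first by move=> ->; rewrite add0r.
by move=> [a ua] tv; exists a; rewrite addrAC; exact: IHs.
Qed.

Lemma span0 M (s : seq M) : span s 0.
Proof. by elim: s => //= x s IHs; exists 0; rewrite scale0r subr0. Qed.

Lemma span_sub M (S : submodule M) (s : seq M) u :
  (forall x, x \in s -> S x) -> span s u -> S u.
Proof.
elim: s u => [|x s IHs] u /= sS; first by move=> ->; exact: subm0.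
move=> [a /IHs ua]; rewrite -[u](subrK (a *: x)).
by apply: submD; [apply: ua => y ys|apply: submZ]; apply: sS; rewrite inE ?eqxx ?ys ?orbT.
Qed.

Lemma span_map M N (f : {linear M -> N}) (s : seq M) y :
  span (map f s) y -> exists x, span s x /\ f x = y.
Proof.
elim: s y => [|x s IHs] y /=; first by move=> ->; exists 0; rewrite linear0.
move=> [a /IHs[z [sz fz]]]; exists (z + a *: x); split.
  by exists a; rewrite addrK.
by rewrite linearD linearZ fz subrK.
Qed.

Lemma span_coord M (s : seq M) u : span s u ->
  exists v : 'I_(size s) -> R, u = \sum_i v i *: nth 0 s i.
Proof.
elim: s u => [|x s IHs] u /=; first by move=> ->; exists (fun=> 0); rewrite big_ord0.
move=> [a /IHs[v vE]].
exists (fun i => if unlift ord0 i is Some j then v j else a).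
rewrite big_ord_recl unlift_none /=; under eq_bigr do rewrite liftK.
by rewrite -vE addrC subrK.
Qed.

Hypothesis noeth : left_noetherian R.

Lemma left_ideal_fg (J : set R) : left_ideal J ->
  exists s : seq (R^o : lmodType R), (forall x, x \in s -> J x) /\
    forall u, J u -> span s u.
Proof.
case=> J0 JD JM; apply: contrapT => nfg.
have /choice[F FP] : forall s : seq (R^o : lmodType R), exists x : R,
    (forall y, y \in s -> J y) -> J x /\ ~ span s x.
  move=> s; have [sJ|] := pselect (forall y, y \in s -> J y); last by exists 0.
  apply: contrapT => nx; apply: nfg; exists s; split=> // u Ju.
  by apply: contrapT => su; apply: nx; exists u.
(* Each list extends the previous one by an element of [J] outside its span, so the spans increase
   strictly, against the chain condition. *)
pose t := fix t n : seq (R^o : lmodType R) := if n is m.+1 then F (t m) :: t m else [::].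
have tJ n : forall y, y \in t n -> J y.
  elim: n => [|n IHn] y //=; rewrite inE => /orP[/eqP->|]; last exact: IHn.
  by have [] := FP (t n) IHn.
have [|n u|n /(_ n.+1 (leqnSn n)) e] := noeth (J := fun n => [set u | span (t n) u]).
- move=> n; split=> [|u v tu tv|a u tu]; first exact: span0.
    by have := span_lin 1 tu tv; rewrite scale1r.
  by have := span_lin a tu (span0 _); rewrite addr0.
- by move=> tu; exists 0; rewrite scale0r subr0.
have [_ []] := FP _ (tJ n); have : [set u | span (t n.+1) u] (F (t n)).
  by exists 1; rewrite scale1r subrr; exact: span0.
by rewrite e.
Qed.

(** Induction on the list [r] of coordinates that may be non-zero: the entries at the first of them
    form a finitely generated ideal, and the elements vanishing there fall under the induction
    hypothesis. *)
Lemma submodule_fg p (S : submodule ('I_p -> (R^o : lmodType R))) :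
  exists s, (forall x, x \in s -> S x) /\ forall u, S u -> span s u.
Proof.
suff fg (r : seq 'I_p) (S' : submodule ('I_p -> (R^o : lmodType R))) :
    (forall u, S' u -> forall j, j \notin r -> u j = 0) ->
    exists s, (forall x, x \in s -> S' x) /\ forall u, S' u -> span s u.
  by apply: (fg (enum 'I_p)) => u _ j; rewrite mem_enum.
elim: r S' => [|j r IHr] {}S S0.
  by exists [::]; split=> // u /S0 u0; apply/funext => j; exact: u0.
have evP : linear (fun u : 'I_p -> (R^o : lmodType R) => u j) by [].
pose ev := lin evP; pose J : set R := [set x | exists2 u, S u & u j = x].
have [|gs [gJ Jg]] := @left_ideal_fg J.
  split=> [|_ _ [u Su <-] [v Sv <-]|a _ [u Su <-]].
  - by exists 0 => //; exact: subm0.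
  - by exists (u + v) => //; exact: submD.
  - by exists (a *: u) => //; exact: submZ.
have [us [usS usE]] : exists us, (forall x, x \in us -> S x) /\ map ev us = gs.
  elim: gs gJ {Jg} => [|g gs IHg] gJ; first by exists [::].
  have [|us [usS <-]] := IHg; first by move=> x xg; apply: gJ; rewrite inE xg orbT.
  have [|u Su ug] := gJ g; first by rewrite inE eqxx.
  by exists (u :: us); split=> [x|] /=; [rewrite inE => /orP[/eqP->|/usS]|rewrite -ug].
have [S' S'E] : exists S' : submodule ('I_p -> (R^o : lmodType R)),
    forall u, S' u <-> S u /\ u j = 0.
  unshelve eexists (@Submodule _ _ (fun u => S u /\ u j = 0) _ _) => //.
    by split; first exact: subm0.
  move=> a x y [Sx x0] [Sy y0]; split; first exact: subm_lin.
  by rewrite -[LHS]/(a *: x j + y j) x0 y0 scaler0 addr0.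
have [|s [sS' S's]] := IHr S'.
  move=> u /S'E[Su uj] l lr; have [->//|lj] := eqVneq l j.
  by apply: S0 => //; rewrite inE negb_or lj.
exists (us ++ s); split=> [x|u Su].
  by rewrite mem_cat => /orP[/usS//|/sS'/S'E[]].
have [|w [sw wu]] := @span_map _ _ ev us (u j); first by rewrite usE; apply: Jg; exists u.
rewrite -[u](subrK w) addrC; apply: span_cat => //; apply/S's/S'E; split.
  by apply: submB => //; exact: span_sub sw.
by rewrite -[LHS]/(u j - ev w) wu subrr.
Qed.

(** The row vectors killed by [d] form a submodule of a free module of finite rank; the rows of [d']
    generate it. *)
Lemma row_relations p q (d : 'I_q -> 'I_p -> R) :
  exists r (d' : 'I_r -> 'I_q -> R), forall u : 'I_q -> R,
    (forall j, \sum_l u l * d l j = 0) <->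
    exists v : 'I_r -> R, forall l, u l = \sum_k v k * d' k l.
Proof.
have [S SE] : exists S : submodule ('I_q -> (R^o : lmodType R)),
    forall u, S u <-> forall j, \sum_l u l * d l j = 0.
  unshelve eexists (@Submodule _ _
    (fun u : 'I_q -> (R^o : lmodType R) => forall j, \sum_l (u l : R) * d l j = 0)
    _ _) => // [j|a x y x0 y0 j].
    by rewrite big1 // => l _; exact: mul0r.
  rewrite (eq_bigr (fun l => a * ((x l : R) * d l j) + (y l : R) * d l j)).
    by rewrite big_split -mulr_sumr /= x0 y0 mulr0 addr0.
  by move=> l _; rewrite mulrA -mulrDl.
have [s [sS Ss]] := submodule_fg S.
exists (size s), (fun k => nth 0 s k) => u; split=> [/SE/Ss/span_coord[v ->]|[v vE]].
  by exists v => l; rewrite fct_sumE.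
apply/SE; have -> : u = \sum_k v k *: nth 0 s k.
  by apply/funext => l; rewrite vE fct_sumE.
by apply: subm_sum => k; apply/submZ/sS/mem_nth.
Qed.

End Noetherian.

Lemma sum_delta (R : pzRingType) q (i : 'I_q) (F : 'I_q -> R) :
  \sum_k (k == i)%:R * F k = F i.
Proof.
rewrite (bigD1 i) //= eqxx mul1r big1 ?addr0 // => k /negPf->.
by rewrite mul0r.
Qed.

(** Over the converse ring, the row relations of the transpose of [dif c 0] are the columns over [R]
    that [dif c 0] kills. Finitely many of them generate and form the columns of the new matrix. *)
Lemma right_noetherian_extendable (R : pzRingType) :
  left_noetherian R^c -> extendable_chains R.
Proof.
move=> noeth c.
have [r [d dE]] := @row_relations _ noeth _ _ (fun j l => @dif R c 0 l j).
exists r, (fun j m => d m j); split=> [l m|x x0].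
  apply: ((dE (fun j => d m j)).2 _ l).
  by exists (fun k => (k == m)%:R) => j; rewrite sum_delta.
have [|v vE] := (dE x).1; first by move=> l; exact: x0.
by exists v => j; rewrite vE.
Qed.

(** * Free resolutions of cyclic modules *)

Section Resolutions.
Variable R : pzRingType.
Implicit Types (M N L P E : lmodType R).

(* Sequences of matrices that are exact on row vectors. *)
Record resolution := Resolution {
  rdim : nat -> nat;
  rdif : forall i, 'I_(rdim i.+1) -> 'I_(rdim i) -> R;
  rdif_exact : forall i (u : 'I_(rdim i.+1) -> R),
    (forall j, \sum_l u l * @rdif i l j = 0) <->
    exists v : 'I_(rdim i.+2) -> R, forall l, u l = \sum_k v k * @rdif i.+1 k l }.

Lemma rdif_complex (r : resolution) i : matrix_complex (@rdif r i.+1) (@rdif r i).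
Proof.
move=> l; apply/rdif_exact; exists (fun k => (k == l)%:R) => j.
by rewrite sum_delta.
Qed.

Lemma ideal_resolution (J : set R) : left_noetherian R -> left_ideal J ->
  exists (r : resolution) (j0 : 'I_(rdim r 0)), (forall j, j = j0) /\
    forall x, J x <-> exists v, x = \sum_l v l * @rdif r 0 l j0.
Proof.
move=> noeth iJ; have [J0 JD JM] := iJ.
have [s [sJ Js]] := left_ideal_fg noeth iJ.
(* A state is a matrix with [q] rows and [p] columns. In [nx] the old number of rows becomes the
   number of columns by computation, so consecutive matrices fit without casts. *)
pose T := {q : nat & {p : nat & 'I_q -> 'I_p -> R}}.
pose H (t : T) := row_relations noeth (projT2 (projT2 t)).
pose nx (t : T) : T :=
  existT _ (projT1 (cid (H t)))
    (existT _ (projT1 t) (projT1 (cid (projT2 (cid (H t)))))).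
(* The generators of [J] form a single column: degree 0 is [R] itself, and the sequence resolves
   [R / J]. *)
pose t0 : T := existT _ (size s) (existT _ 1%N (fun (l : 'I_(size s)) _ => nth 0 s l)).
pose t := fix t n := if n is m.+1 then nx (t m) else t0.
exists (@Resolution (fun i => projT1 (projT2 (t i))) (fun i => projT2 (projT2 (t i)))
  (fun i => projT2 (cid (projT2 (cid (H (t i))))))), ord0.
split=> [j|x]; first exact: ord1.
split=> [/Js/span_coord[v ->]|[v ->]]; first by exists v.
elim/big_ind: _ => // l _; first by apply: JM; apply: sJ; exact: mem_nth.
Qed.

(** Hom(-, E) is exact. The column [a] is a map from row vectors to [E]; by [a0] it kills the kernel
    of multiplication by [d], hence extends along that multiplication. *)
Lemma exact_on_injective E (r : resolution) i : injective_module E ->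
  exact_on E (@rdif r i.+1) (@rdif r i).
Proof.
move=> injE a a0; set d := @rdif r i in a0 *.
pose A q : lmodType R := 'I_q -> (R^o : lmodType R).
have uP : linear (fun x : A _ => (fun j => \sum_l (x l : R) * d l j) : A (rdim r i)).
  move=> c x y; apply/funext => j; rewrite -[RHS]/(c * (\sum_l _) + \sum_l _).
  by rewrite mulr_sumr -big_split; apply: eq_bigr => l _; rewrite mulrDl mulrA.
have fP : linear (fun x : A _ => \sum_l (x l : R) *: a l).
  move=> c x y; rewrite scaler_sumr -big_split; apply: eq_bigr => l _.
  by rewrite scalerDl scalerA.
have [x ux|g gP] := @injective_factor _ _ _ _ (lin uP) (lin fP) injE.
  have [v vE] : exists v : 'I_(rdim r i.+2) -> R, forall l, x l = \sum_k v k * @rdif r i.+1 k l.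
    by apply/rdif_exact => j; exact: (congr1 (fun f => f j) ux).
  rewrite -[LHS]/(\sum_l _); under eq_bigr do rewrite vE scaler_suml.
  rewrite exchange_big big1 // => k _ /=.
  under eq_bigr do rewrite -scalerA.
  by rewrite -scaler_sumr -[\sum_l _]/(act _ a k) a0 scaler0.
pose delta q (l : 'I_q) : A q := fun k => (k == l)%:R.
have sumA q (x : A q) : x = \sum_l (x l : R) *: delta q l.
  apply/funext => k; rewrite fct_sumE (bigD1 k) //= big1 => [|l lk].
    by rewrite addr0 -[RHS]/(x k * (k == k)%:R) eqxx mulr1.
  by rewrite -[LHS]/(x l * (k == l)%:R) eq_sym (negPf lk) mulr0.
exists (fun j => g (delta _ j)) => l.
have -> : a l = lin fP (delta _ l).
  rewrite -[RHS]/(\sum_k (k == l)%:R *: a k) (bigD1 l) //= eqxx scale1r big1 ?addr0 //.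
  by move=> k /negPf->; rewrite scale0r.
rewrite -gP /= [X in g X]sumA linear_sum; apply: eq_bigr => j _.
by rewrite linearZ /=; congr (_ *: _); exact: sum_delta.
Qed.

End Resolutions.

(** * Baer's criterion *)

Section Baer.
Variable R : pzRingType.
Implicit Types (M N L P E : lmodType R).

(* Zorn's lemma is applied to the graphs of partial extensions. *)
Lemma baer N :
  (forall (J : set R) (f : R -> N), left_ideal J ->
     (forall a x y, J x -> J y -> f (a * x + y) = a *: f x + f y) ->
     exists n, forall x, J x -> f x = x *: n) -> injective_module N.
Proof.
move=> crit M P i f ii.
pose good (A : set (P * N)) := [/\ (forall m, A (i m, f m)),
  (forall a u v, A u -> A v -> A (a *: u + v)) & (forall n, A (0, n) -> n = 0)].
have [F FP totF|A [AP Amax]] := @Zorn_bigcup _ [set A | A = set0 \/ good A].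
  have [[A FA [x Ax]]|F0] := pselect (exists2 A, F A & exists x, A x); last first.
    by left; rewrite -subset0 => y [A FA Ay]; apply: F0; exists A => //; exists y.
  have gA B y : F B -> B y -> good B by move=> /FP[->|].
  right; split=> [m|a u v [B FB Bu] [C FC Cv]|n [B FB B0]].
  - by exists A => //; have [] := gA _ _ FA Ax.
  - have [BC|CB] := totF _ _ FB FC.
      have [_ CL _] := gA _ _ FC Cv.
      by exists C => //; apply: CL => //; exact: BC.
    have [_ BL _] := gA _ _ FB Bu.
    by exists B => //; apply: BL => //; exact: CB.
  - by have [_ _] := gA _ _ FB B0; exact.
have gA : good A.
  case: AP => // A0; pose B := [set (i m, f m) | m in [set: M]].
  have gB : good B.
    split=> [m|a _ _ [m _ <-] [m' _ <-]|n [m _ [im <-]]]; first by exists m.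
      by exists (a *: m + m') => //; rewrite !linearP.
    by rewrite (ii m 0) ?linear0.
  case: (Amax B); last by right.
  split; first by rewrite A0.
  by move=> /(_ (i 0, f 0)); rewrite A0; apply; exists 0.
have [fA AL A0] := gA.
have AD u v : A u -> A v -> A (u + v) by move=> Au Av; rewrite -[u]scale1r; exact: AL.
have AZ a u : A u -> A (a *: u).
  move=> Au; rewrite -[_ *: _]addr0; apply: AL => //.
  by have := fA 0; rewrite !linear0.
have uniqA q n n' : A (q, n) -> A (q, n') -> n = n'.
  move=> qn qn'; apply/eqP; rewrite -subr_eq0; apply/eqP/A0.
  by have := AD _ _ qn (AZ (-1) _ qn'); rewrite !scaleN1r /= -[_ + _]/(q - q, n - n') subrr.
have tot p : exists n, A (p, n).
  (* The criterion is applied to the scalars that carry [p] into the domain. Its value [n0] keeps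
     the graph single-valued when [(p, n0)] is adjoined, as is done in [B]. *)
  pose J : set R := [set a | exists n, A (a *: p, n)].
  have /choice[h hP] : forall a, exists n, J a -> A (a *: p, n).
    by move=> a; have [[n]|] := pselect (J a); [exists n|exists 0].
  have JL a x y : J x -> J y -> A ((a * x + y) *: p, a *: h x + h y).
    by move=> /hP Jx /hP Jy; have := AL a _ _ Jx Jy;
      rewrite -[_ + _]/(a *: (x *: p) + y *: p, a *: h x + h y) scalerA -scalerDl.
  have [|a x y Jx Jy|n0 n0P] := crit J h.
  - split=> [|x y Jx Jy|a x Jx].
    + by exists 0; rewrite scale0r; have := fA 0; rewrite !linear0.
    + by exists (1 *: h x + h y); have := JL 1 x y Jx Jy; rewrite mul1r.
    + have J0 : J 0 by exists 0; rewrite scale0r; have := fA 0; rewrite !linear0.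
      by exists (a *: h x + h 0); have := JL a x 0 Jx J0; rewrite addr0.
  - by apply: uniqA (JL a x y Jx Jy); apply: hP; eexists; exact: JL.
  apply: contrapT => np.
  pose B : set (P * N) := [set u | exists a, A (u - a *: (p, n0))].
  apply: (Amax B); last first.
    right; split=> [m|a u v [b ub] [c vc]|n [a na]].
    - by exists 0; rewrite scale0r subr0.
    - exists (a * b + c); have := AL a _ _ ub vc.
      by rewrite scalerBr scalerA addrACA -opprD -scalerDl.
    - have Ja : J (- a).
        by exists (n - a *: n0); move: na; rewrite -[_ - _]/(0 - a *: p, n - a *: n0) sub0r scaleNr.
      have := n0P _ Ja; rewrite (uniqA _ _ (n - a *: n0) (hP _ Ja)).
        by rewrite scaleNr => /(canRL (subrK _)); rewrite addNr.
      by move: na; rewrite -[_ - _]/(0 - a *: p, n - a *: n0) sub0r scaleNr.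
  split=> [u Au|/(_ (p, n0))]; first by exists 0; rewrite scale0r subr0.
  move=> BA; apply: np; exists n0; apply: BA; exists 1.
  by rewrite scale1r subrr; have := fA 0; rewrite !linear0.
have /choice[g gP] := tot.
have gL : linear g by move=> a p q; apply: (uniqA _ _ _ (gP _)); exact: (AL a (p, g p) (q, g q)).
by exists (lin gL) => m; apply: uniqA (fA m); exact: gP.
Qed.

(** On a resolution of [R / J], exactness in degree 1 is the vanishing of Ext^1(R / J, N), which is
    what Baer's criterion asks for. *)
Lemma injective_exact_on N : left_noetherian R ->
  (forall r : resolution R, exact_on N (@rdif R r 1) (@rdif R r 0)) -> injective_module N.
Proof.
move=> noeth exN; apply: baer => J f iJ fL; have [J0 JD JM] := iJ.
have [r [j0 [j0P JE]]] := ideal_resolution noeth iJ.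
have Jg l : J (@rdif R r 0 l j0).
  by apply/JE; exists (fun k => (k == l)%:R); rewrite sum_delta.
have f0 : f 0 = 0.
  have := fL 1 0 0 J0 J0; rewrite mulr0 addr0 scale1r => /eqP.
  by rewrite -subr_eq subrr eq_sym => /eqP.
have fsum q (v x : 'I_q -> R) : (forall l, J (x l)) ->
    f (\sum_l v l * x l) = \sum_l v l *: f (x l).
  move=> Jx; suff [] : J (\sum_l v l * x l) /\
    f (\sum_l v l * x l) = \sum_l v l *: f (x l) by [].
  elim/big_rec2: _ => // l y z _ [Jz fz].
  by split; [apply: JD => //; exact: JM|rewrite fL // fz].
(* The values of [f] on the generators of [J] satisfy the relations among these, so they form a
   cocycle; its primitive is the single vector [b j0]. *)
have [k|b bP] := exN r (fun l => f (@rdif R r 0 l j0)).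
  by rewrite -[LHS]fsum // rdif_complex f0.
exists (b j0) => x /JE[v ->]; rewrite fsum // scaler_suml.
apply: eq_bigr => l _; rewrite bP -scalerA; congr (_ *: _).
rewrite /act (bigD1 j0) //= big1 ?addr0 // => j.
by rewrite (j0P j) eqxx.
Qed.

End Baer.

(** * Vanishing of Ext and homological dimensions *)

Section Dimension.
Variable R : pzRingType.
Implicit Types (M N L P E C K Q A B : lmodType R).

(** Ext^1(M, N) = 0 without Ext groups: for every extension of [M] by some [A], the connecting map
    out of Hom(A, N) is zero. *)
Definition ext1_vanishes M N : Prop :=
  forall A B (i : {linear A -> B}) (e : {linear B -> M}), ses i e ->
    forall f : {linear A -> N}, exists g : {linear B -> N}, g \o i =1 f.

Lemma factor_kernel L P M A (i : {linear L -> P}) (e : {linear P -> M})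
    (f : {linear A -> P}) : ses i e -> (forall x, e (f x) = 0) ->
  exists g : {linear A -> L}, i \o g =1 f.
Proof.
move=> [ii _ ie] ef; have /choice[g gP] : forall x, exists y, i y = f x.
  by move=> x; apply/ie.
have gL : linear g by move=> a x y; apply: ii; rewrite linearP !gP linearP.
by exists (lin gL).
Qed.

(** Dimension shifting on both sides: Ext^1(L, N) = Ext^2(M, N) = Ext^1(M, C). A map to [N] first
    extends with values in [E], and a map through [P] corrects the extension so that it lands in
    [N]. *)
Lemma ext1_shift M L P N E C (i : {linear L -> P}) (e : {linear P -> M})
    (j : {linear N -> E}) (q : {linear E -> C}) :
  ses i e -> projective P -> ses j q -> injective_module E ->
  ext1_vanishes M C -> ext1_vanishes L N.
Proof.
move=> ie pP jq injE extMC A B a b ab f; have [ai bs abx] := ab; have [ji qs jqx] := jq.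
have [g gP] := injE _ _ a (mod_comp j f) ai.
have [x bx0|h hP] := factor_surj (f := mod_comp q g) bs.
  have /abx[y <-] := bx0.
  by rewrite /= [g _](gP y) (ses_comp0 _ jq).
have [h' h'P] := extMC _ _ _ _ ie h.
have [h'' h''P] := pP _ _ q h' qs.
have [x|k kP] := factor_kernel (f := g \- (mod_comp h'' (mod_comp i b))) jq.
  by rewrite /= linearB [q (h'' _)](h''P _) [h' _](h'P _) [h _](hP _) subrr.
exists k => x; apply: ji; rewrite [LHS](kP _) /= [g _](gP _).
by rewrite (ses_comp0 _ ab) !(linear0, addr0).
Qed.

(** Extending the identity of [L] gives a retraction of [i], so [M] is a direct summand of [P]. *)
Lemma ext1_splits L P M (i : {linear L -> P}) (e : {linear P -> M}) :
  ses i e -> projective P -> ext1_vanishes M L -> projective M.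
Proof.
move=> ie pP extML; have [ii es iex] := ie.
have [r rP] := extML _ _ _ _ ie (mod_id L).
have [x ex0|s sP] := factor_surj (f := mod_id P \- mod_comp i r) es.
  by have /iex[y <-] := ex0; rewrite /= [r _](rP y) subrr.
have es1 y : e (s y) = y.
  have [x <-] := es y; rewrite [s _](sP x) /= linearB (ses_comp0 _ ie) subr0 //.
move=> A B u f us; have [g gP] := pP _ _ u (mod_comp f e) us.
by exists (mod_comp g s) => y; rewrite /= [u _](gP _) /= es1.
Qed.

(** Injective dimension at most [n], by recursion on cosyzygies, the form suited to dimension
    shifting. *)
Fixpoint injective_codim n L : Prop :=
  if n is m.+1 then exists E C (j : {linear L -> E}) (q : {linear E -> C}),
    [/\ ses j q, injective_module E & injective_codim m C]
  else injective_module L.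

(** This is Ext^(n+1)(K, L) = 0; each shift trades a syzygy of [K] for a cosyzygy of [L]. *)
Lemma ext1_iter_syzygy n L K : injective_codim n L ->
  ext1_vanishes (iter n (@syzygy R) K) L.
Proof.
elim: n L => [|n IHn] L /=.
  by move=> injL A B i e [ii _ _] f; exact: injL.
move=> [E [C [j [q [jq injE /IHn extC]]]]].
by apply: ext1_shift extC => //; [exact: ses_syzygy|exact: free_projective|exact: jq|].
Qed.

Lemma idim_le_codim M n : idim_le M n -> injective_codim n M.
Proof.
elim: n M => [|n IHn] M [E [d [e [injE E0 ei ex0 ex]]]].
  (* Here [E 1] is zero, so [e] is bijective and [M] inherits injectivity from [E 0]. *)
  have /choice[s es] : forall y, exists x, e x = y.
    by move=> y; apply/ex0; exact: (E0 1%N).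
  move=> A B i f ii; have [g gP] := injE 0%N _ _ i (mod_comp e f) ii.
  have sL : linear s by move=> a x y; apply: ei; rewrite linearP !es.
  by exists (mod_comp (lin sL) g) => x; apply: ei; rewrite /= es [LHS]gP.
have dd x : d 1%N (d 0%N x) = 0 by apply/(ex 0%N); exists x.
exists (E 0%N), (ker (d 1%N)), e, (corestr (S := ker_sub (d 1%N)) dd); split=> //.
  split=> // [[y yP]|y]; first by have [x xy] := (ex 0%N y).1 yP; exists x; exact: subm_eq.
  split=> [y0|/ex0 y0]; last exact: subm_eq.
  by apply/ex0; exact: (congr1 (@subm_val _ _ _) y0).
apply: IHn; exists (fun i => E i.+1), (fun i => d i.+1), (subm_incl (ker_sub (d 1%N))).
split=> //; first by move=> i ni; exact: E0.
  exact: subm_incl_inj.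
move=> y; split=> [y0|[x <-]]; first by exists (SubmElt (S := ker_sub (d 1%N)) y0).
exact: (subm_valP x).
Qed.

(** Ext vanishes above the injective dimension. For [L = R] this makes the tail of a resolution,
    from degree [n] on, a chain. *)
Lemma exact_on_codim n L (r : resolution R) i : injective_codim n L -> (n <= i)%N ->
  exact_on L (@rdif R r i.+1) (@rdif R r i).
Proof.
elim: n L i => [|n IHn] L i /=; first by move=> injL _; exact: exact_on_injective.
move=> [E [C [j [q [jq injE codC]]]]]; case: i => // i ni.
apply: (exact_on_sub jq (@rdif_complex _ r i)); first exact: exact_on_injective.
exact: IHn.
Qed.

Definition enough_injectives : Prop :=
  forall M, exists E (i : {linear M -> E}), injective_module E /\ injective i.

(** Exactness passes from [L] to a cosyzygy one degree lower, until [injective_exact_on] applies. *)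
Lemma codim_exact_on n L : left_noetherian R -> enough_injectives ->
  (forall r : resolution R, exact_on L (@rdif R r n.+1) (@rdif R r n)) ->
  injective_codim n L.
Proof.
move=> noeth inj; elim: n L => [|n IHn] L exL; first exact: injective_exact_on.
have [E [j [injE ji]]] := inj L; have jq := ses_coker ji.
exists E, (coker j), j, (quot_proj (im_sub j)); split=> //; apply: IHn => r.
apply: (exact_on_quotient jq (@rdif_complex _ r n.+1)) => //.
exact: exact_on_injective.
Qed.

Lemma zero_projective M : (forall x : M, x = 0) -> projective M.
Proof. by move=> M0 A B e f _; exists \0 => x; rewrite (M0 x) !linear0. Qed.

Definition zero_mod : lmodType R := ('I_0 -> (R^o : lmodType R)).

Lemma zero_mod_eq0 (x : zero_mod) : x = 0.
Proof. by apply/funext; case. Qed.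

Lemma projective_pdim_le P : projective P -> pdim_le P 0.
Proof.
move=> pP; pose X i := if i is 0 then P else zero_mod.
have X0 i (x : X i.+1) : x = 0 by exact: zero_mod_eq0.
exists X, (fun i => \0), (mod_id P); split.
- by case=> [//|i]; apply: zero_projective; exact: X0.
- by case=> [//|i] _; exact: X0.
- by move=> y; exists y.
- by move=> y; split=> [y0|[x <-]] //; exists 0; exact/esym/y0.
- by move=> i y; split=> // _; exists 0; rewrite (X0 i y).
Qed.

Lemma pdim_le_succ L P M (i : {linear L -> P}) (e : {linear P -> M}) n :
  ses i e -> projective P -> pdim_le L n -> pdim_le M n.+1.
Proof.
move=> [ii es ie] pP [X [d [e' [pX X0 e's ex0 ex]]]].
pose Y j := if j is k.+1 then X k else P.
pose dY j : {linear Y j.+1 -> Y j} :=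
  match j with 0 => mod_comp i e' | k.+1 => d k end.
exists Y, dY, e; split=> //.
- by case.
- by case=> // j; exact: X0.
- move=> y; split=> [/ie[x <-]|[x <-]]; first by have [z <-] := e's x; exists z.
  by apply/ie; exists (e' x).
case=> [y|j]; last exact: ex.
split=> [iy0|/ex0 y0]; last by rewrite /= y0 linear0.
by apply/ex0/ii; rewrite linear0.
Qed.

Lemma pdim_le_iter_syzygy n K : projective (iter n (@syzygy R) K) -> pdim_le K n.
Proof.
elim: n K => [|n IHn] K /=; first exact: projective_pdim_le.
rewrite -iterS iterSr => /IHn; apply: pdim_le_succ (ses_syzygy K) _.
exact: free_projective.
Qed.

(** The kernel of [e] has a shorter resolution, and acyclicity passes to quotients. *)
Lemma finite_pdim_acyclic M : finite_pdim M -> acyclic M.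
Proof.
move=> [n]; elim: n M => [|n IHn] M [P [d [e [pP P0 es ex0 ex]]]].
  apply: (acyclic_quotient (ses_ker es)); last exact: acyclic_projective.
  apply: acyclic_projective; apply: zero_projective => x; apply: subm_eq.
  by have [y /= <-] := (ex0 (subm_val x)).1 (subm_valP x); rewrite [y](P0 1%N) // linear0.
have ed x : e (d 0%N x) = 0 by apply/ex0; exists x.
apply: (acyclic_quotient (ses_ker es)); last exact: acyclic_projective.
apply: IHn; exists (fun i => P i.+1), (fun i => d i.+1), (corestr (S := ker_sub e) ed).
split=> //; first by move=> i ni; exact: P0.
- by move=> [y yK]; have [x xy] := (ex0 y).1 yK; exists x; exact: subm_eq.
- move=> y; rewrite -ex; split=> [/(congr1 (@subm_val _ _ _))//|dy].
  exact: subm_eq.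
Qed.

Hypothesis noethl : left_noetherian R.
Hypothesis ext : extendable_chains R.
Hypothesis inj : enough_injectives.
Hypothesis idR : finite_idim (R^o : lmodType R).

Lemma acyclic_finite_pdim K : acyclic K -> finite_pdim K.
Proof.
move=> aK; have [n /idim_le_codim codR] := idR; exists n.
have aS j : acyclic (iter j (@syzygy R) K).
  elim: j => //= j aj; apply: acyclic_sub (ses_syzygy _) _ aj => //.
  exact/acyclic_projective/free_projective.
(* The same [n] serves twice: the acyclic syzygy of order [n.+1] has injective dimension at most
   [n], hence Ext^1 from the syzygy of order [n] to it vanishes. *)
apply: pdim_le_iter_syzygy; apply: ext1_splits (ses_syzygy _) (@free_projective _ _) _.
apply: ext1_iter_syzygy; apply: codim_exact_on => // r.
(* With the index [i + n] successors reduce by computation; degree 1 of this tail is degree [n.+1]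
   of the resolution. *)
pose c := @Chain R (fun i => rdim r (i + n)) (fun i => @rdif R r (i + n))
  (fun i => @rdif_complex R r (i + n))
  (fun i => exact_on_codim (r := r) codR (leq_addl i n)).
exact: (aS n.+1 c).
Qed.

Lemma acyclicP M : finite_pdim M <-> acyclic M.
Proof. by split; [exact: finite_pdim_acyclic|exact: acyclic_finite_pdim]. Qed.

End Dimension.

(** * Injective modules from coinduction over a field *)

Lemma field_injective (k : fieldType) (N : lmodType k) : injective_module N.
Proof.
apply: baer => J f [J0 JD JM] fL.
have f0 : f 0 = 0.
  have := fL 1 0 0 J0 J0; rewrite mulr0 addr0 scale1r => /eqP.
  by rewrite -subr_eq subrr eq_sym => /eqP.
have [[x Jx x0]|nx] := pselect (exists2 x, J x & x != 0); last first.
  exists 0 => x Jx; rewrite scaler0; have [->//|x0] := eqVneq x 0.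
  by case: nx; exists x.
exists (x^-1 *: f x) => y Jy.
by have := fL (y / x) x 0 Jx J0; rewrite !addr0 divfK // f0 addr0 scalerA.
Qed.

(* Coinduction along [phi], which need not be central: [Hom_k(R, M)]. *)
Section Coinduction.
Variables (k : fieldType) (R : pzRingType) (phi : {rmorphism k -> R}).
Implicit Types (M N P : lmodType R).

Section Restriction.
Variable M : lmodType R.
(** An alias of [M] that carries [phi], to which the [k]-module structure through [phi] is
    attached. *)
Definition restr of {rmorphism k -> R} : Type := M.
Local Notation restr_phi := (restr phi).
HB.instance Definition _ := GRing.Zmodule.on restr_phi.
Definition restr_scale (c : k) (x : restr_phi) : restr_phi := phi c *: (x : M).
Lemma restrA a b x : restr_scale a (restr_scale b x) = restr_scale (a * b) x.
Proof. by rewrite /restr_scale scalerA -rmorphM. Qed.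
Lemma restr1 : left_id 1 restr_scale.
Proof. by move=> x; rewrite /restr_scale rmorph1 scale1r. Qed.
Lemma restrDr : right_distributive restr_scale +%R.
Proof. by move=> a x y; exact: scalerDr. Qed.
Lemma restrDl x : {morph restr_scale^~ x : a b / a + b}.
Proof. by move=> a b; rewrite /restr_scale rmorphD scalerDl. Qed.
HB.instance Definition _ := GRing.Zmodule_isLmodule.Build k restr_phi
  restrA restr1 restrDr restrDl.

Record coind := Coind {
  coind_fun : R -> M;
  coind_lin : forall c x y,
    coind_fun (phi c * x + y) = phi c *: coind_fun x + coind_fun y }.

Lemma coind_eq (f h : coind) : coind_fun f =1 coind_fun h -> f = h.
Proof.
case: f => f fL; case: h => h hL /= /funext efh.
by case: _ / efh in hL *; rewrite (Prop_irrelevance fL hL).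
Qed.

HB.instance Definition _ := gen_eqMixin coind.
HB.instance Definition _ := gen_choiceMixin coind.

Definition coind0 : coind.
Proof. by exists (fun=> 0) => c x y; rewrite scaler0 addr0. Defined.
Definition coindN (f : coind) : coind.
Proof.
by exists (fun r => - coind_fun f r) => c x y; rewrite coind_lin opprD scalerN.
Defined.
Definition coindD (f h : coind) : coind.
Proof.
exists (fun r => coind_fun f r + coind_fun h r) => c x y.
by rewrite !coind_lin scalerDr addrACA.
Defined.
Definition coindZ (s : R) (f : coind) : coind.
Proof.
by exists (fun r => coind_fun f (r * s)) => c x y; rewrite mulrDl -mulrA coind_lin.
Defined.

Lemma coindDA : associative coindD.
Proof. by move=> a b c; apply: coind_eq => r; exact: addrA. Qed.
Lemma coindDC : commutative coindD.
Proof. by move=> a b; apply: coind_eq => r; exact: addrC. Qed.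
Lemma coindD0 : left_id coind0 coindD.
Proof. by move=> a; apply: coind_eq => r; exact: add0r. Qed.
Lemma coindDN : left_inverse coind0 coindN coindD.
Proof. by move=> a; apply: coind_eq => r; exact: addNr. Qed.
HB.instance Definition _ := GRing.isZmodule.Build coind coindDA coindDC coindD0 coindDN.

Lemma coind_funD (f : coind) x y : coind_fun f (x + y) = coind_fun f x + coind_fun f y.
Proof. by have := coind_lin f 1 x y; rewrite rmorph1 mul1r scale1r. Qed.

Lemma coind_funM (f : coind) c x : coind_fun f (phi c * x) = phi c *: coind_fun f x.
Proof.
have := coind_funD f 0 0; rewrite addr0 => /eqP; rewrite -subr_eq subrr eq_sym => /eqP f0.
by rewrite -[_ * _]addr0 coind_lin f0 addr0.
Qed.

Lemma coindZA a b f : coindZ a (coindZ b f) = coindZ (a * b) f.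
Proof. by apply: coind_eq => r; rewrite /= mulrA. Qed.
Lemma coindZ1 : left_id 1 coindZ.
Proof. by move=> f; apply: coind_eq => r; rewrite /= mulr1. Qed.
Lemma coindZDr : right_distributive coindZ +%R.
Proof. by move=> a f h; exact: coind_eq. Qed.
Lemma coindZDl f : {morph coindZ^~ f : a b / a + b}.
Proof. by move=> a b; apply: coind_eq => r; rewrite /= mulrDr coind_funD. Qed.
HB.instance Definition _ := GRing.Zmodule_isLmodule.Build R coind
  coindZA coindZ1 coindZDr coindZDl.

End Restriction.

(** By adjunction a map to the coinduced module amounts to a [k]-linear map to [M], its evaluation
    at 1, and the latter extends over the field. *)
Lemma coind_injective M : injective_module (coind M).
Proof.
move=> A B i f ii.
have fL : linear (fun a : restr A phi => coind_fun (f a) 1 : restr M phi).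
  move=> c x y; rewrite [f _](linearP f (phi c)).
  by rewrite -[LHS]/(coind_fun (f x) (1 * phi c) + _) mul1r -[phi c]mulr1 coind_funM.
have iL : linear (fun a : restr A phi => i a : restr B phi).
  by move=> c x y; exact: (linearP i (phi c)).
have [g gP] := field_injective (i := lin iL) (lin fL) ii.
have hL b c x y : g ((phi c * x + y) *: (b : B)) = phi c *: g (x *: (b : B)) + g (y *: (b : B)).
  by rewrite scalerDl -scalerA; exact: (linearP g c).
pose h b := Coind (hL b).
have hP : linear h.
  move=> s x y; apply: coind_eq => r.
  rewrite /= scalerDr scalerA; exact: (linearD g).
exists (lin hP) => a; apply: coind_eq => r; rewrite /= -linearZ.
by apply: etrans (gP _) _; rewrite /= linearZ /= mul1r.
Qed.

Lemma coinduction_enough_injectives : enough_injectives R.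
Proof.
move=> M; exists (coind M).
have uL (m : M) c x y : (phi c * x + y) *: m = phi c *: (x *: m) + y *: m.
  by rewrite scalerDl scalerA.
have uP : linear (fun m => Coind (uL m)).
  by move=> a x y; apply: coind_eq => r; rewrite /= scalerDr scalerA.
exists (lin uP); split; first exact: coind_injective.
by move=> x y /(congr1 (fun f => coind_fun f 1)); rewrite /= !scale1r.
Qed.

End Coinduction.

(** * The Hecke algebra and smooth representations *)

Section HeckeAlgebra.
Variables (k : fieldType) (p : nat) (G : topologicalGroupType).
Variable I : open_pro_p_subgroup p G.

Local Notation X := (ind_rep k I).
Local Notation H := (hecke k I).

Lemma homothety_act (c : k) g (x : X) :
  (c \*: (mod_id X) : {linear X -> X}) (rep_act g x) =
  rep_act g ((c \*: (mod_id X) : {linear X -> X}) x).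
Proof. by rewrite /= linearZ. Qed.

Definition homothety (c : k) : H := RepHom (homothety_act c).

Lemma homothety_zmod : zmod_morphism homothety.
Proof. by move=> a b; apply: rep_hom_eq => x; rewrite /= scalerBl. Qed.
Lemma homothety_monoid : monoid_morphism homothety.
Proof.
split=> [|a b]; apply: rep_hom_eq => x /=; first by rewrite scale1r.
by rewrite scalerA mulrC.
Qed.
HB.instance Definition _ :=
  GRing.isZmodMorphism.Build k H homothety homothety_zmod.
HB.instance Definition _ :=
  GRing.isMonoidMorphism.Build k H homothety homothety_monoid.

Lemma hecke_enough_injectives : enough_injectives H.
Proof. exact: (@coinduction_enough_injectives k H homothety). Qed.

(* The left module [X^I] is free on [ind_one]. *)
Lemma exact_on_invariants q r s (d1 : 'I_s -> 'I_r -> H) (d0 : 'I_r -> 'I_q -> H) :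
  exact_on (H^o : lmodType H) d1 d0 ->
  exact_on (invariants I X : lmodType H) d1 d0.
Proof.
have iP : linear (fun v : invariants I X =>
    (frob (inv_valP v) : H) : (H^o : lmodType H)).
  move=> h u v; apply/rep_hom_eq/frob_uniq.
  apply: etrans (frob_one (inv_valP (h *: u + v))) _ => /=.
  by congr (_ + _); apply/esym/(frob_one (inv_valP v)).
have rP : linear (fun h : (H^o : lmodType H) =>
    Invariant (rep_hom_invariant (h : rep_hom X X) (@ind_one_invariant k p G I))).
  move=> h u v; apply: inv_eq => /=; congr (_ + _).
  pose w := Invariant (rep_hom_invariant (u : rep_hom X X) (@ind_one_invariant k p G I)).
  by apply: (frob_uniq (a := u : rep_hom X X) (b := frob (inv_valP w)));
    rewrite [RHS](frob_one (inv_valP w)).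
apply: (@exact_on_retract _ _ _ (lin iP) (lin rP)) => v.
by apply: inv_eq; exact: frob_one (inv_valP v).
Qed.

End HeckeAlgebra.

(** * Direct sums, products and quotients of smooth representations *)

Section RepresentationConstructions.
Variables (k : fieldType) (G : topologicalGroupType).
Implicit Types V W Y Z : smooth_rep k G.

Section FiniteSupport.
Variables (T : choiceType) (V : smooth_rep k G).

Definition finsupp_act (g : G) : {linear finsupp T V -> finsupp T V} :=
  lift (fun t => mod_comp (single t) (rep_act g)).

Lemma coef_finsupp_act g (f : finsupp T V) t :
  coef (finsupp_act g f) t = rep_act g (coef f t).
Proof.
pose a : {linear finsupp T V -> V} := mod_comp (coef_map V t) (finsupp_act g).
pose b : {linear finsupp T V -> V} := mod_comp (rep_act g) (coef_map V t).
apply: (finsupp_ext (f := a) (h := b)) => s x.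
rewrite -[LHS]/(coef (finsupp_act g (single s x)) t) -[RHS]/(rep_act g (coef (single s x) t)).
rewrite /finsupp_act lift_single -[mod_comp _ _ x]/(single s (rep_act g x)) !coef_single.
by case: eqP => // _; rewrite linear0.
Qed.

Lemma finsupp_act1 f : finsupp_act 1%g f = f.
Proof. by apply: coef_eq => t; rewrite coef_finsupp_act rep_act1. Qed.
Lemma finsupp_actM g h f : finsupp_act (g * h)%g f = finsupp_act g (finsupp_act h f).
Proof. by apply: coef_eq => t; rewrite !coef_finsupp_act rep_actM. Qed.

Lemma rep_act_near1 W (v : W) : \forall g \near (1%g : G), rep_act g v = v.
Proof. by apply: open_nbhs_nbhs; split; [exact: rep_smooth|exact: rep_act1]. Qed.

(** Only finitely many coordinates are non-zero, so their stabilizers intersect in a neighbourhood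
    of 1. *)
Lemma finsupp_smooth f : open [set g | finsupp_act g f = f].
Proof.
apply: (@open_stabilizer _ _ (fun g h => finsupp_act g h)); first exact: finsupp_actM.
have near1 : \forall g \near (1%g : G),
    forall t, t \in supp f -> rep_act g (coef f t) = coef f t.
  elim: (supp f) => [|t r IHr]; first by apply: nearW.
  have t1 := rep_act_near1 (coef f t).
  by near=> g => s; rewrite inE => /orP[/eqP->|sr];
    [near: g; exact: t1|move: s sr; near: g; exact: IHr].
apply: filterS near1 => g gf; apply: coef_eq => t; rewrite coef_finsupp_act.
have [/gf//|] := boolP (t \in supp f).
by rewrite mem_supp negbK => /eqP->; rewrite linear0.
Unshelve. all: by end_near. Qed.

Definition finsupp_rep : smooth_rep k G :=
  @SmoothRep k G (finsupp T V) finsupp_act finsupp_act1 finsupp_actM finsupp_smooth.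

Lemma finsupp_act_single g t (x : V) : finsupp_act g (single t x) = single t (rep_act g x).
Proof. exact: lift_single. Qed.

Section Lift.
Variables (Y : smooth_rep k G) (w : T -> rep_hom V Y).

Lemma finsupp_lift_act g (f : finsupp_rep) :
  lift (fun t => rep_hom_fun (w t)) (rep_act g f) =
  rep_act g (lift (fun t => rep_hom_fun (w t)) f).
Proof.
pose l := lift (fun t => rep_hom_fun (w t)).
apply: (finsupp_ext (f := mod_comp l (finsupp_act g)) (h := mod_comp (rep_act g) l)) => t x.
apply: etrans (congr1 l (finsupp_act_single g t x)) _.
rewrite [LHS]lift_single rep_hom_act; congr (rep_act g _).
exact/esym/lift_single.
Qed.

Definition finsupp_lift : rep_hom finsupp_rep Y := RepHom finsupp_lift_act.
End Lift.
End FiniteSupport.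

Section Product.
Variables V W : smooth_rep k G.

Lemma prod_act_linear g : linear (fun v : V * W => (rep_act g v.1, rep_act g v.2)).
Proof. by move=> a u v; congr pair; exact: linearP. Qed.
Definition prod_act g : {linear (V * W)%type -> (V * W)%type} := lin (prod_act_linear g).

Lemma prod_act1 v : prod_act 1%g v = v.
Proof. by case: v => v w; congr pair; exact: rep_act1. Qed.
Lemma prod_actM g h v : prod_act (g * h)%g v = prod_act g (prod_act h v).
Proof. by congr pair; exact: rep_actM. Qed.
Lemma prod_smooth v : open [set g | prod_act g v = v].
Proof.
rewrite (_ : [set _ | _] = [set g | rep_act g v.1 = v.1] `&` [set g | rep_act g v.2 = v.2]).
  by apply: openI; exact: rep_smooth.
apply/seteqP; case: v => v w; split=> g /=; first by case.
by move=> [gv gw]; congr pair.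
Qed.

Definition prod_rep : smooth_rep k G := SmoothRep prod_act1 prod_actM prod_smooth.
End Product.

Section Quotient.
Variables (V : smooth_rep k G) (S : submodule V).
Hypothesis Sact : forall g x, S x -> S (rep_act g x).

Lemma quot_act_wd g x : quot_proj S x = 0 ->
  mod_comp (quot_proj S) (rep_act g) x = 0.
Proof. by move=> /quot_proj_eq0 Sx; apply/quot_proj_eq0/Sact. Qed.

Definition quot_act g : {linear quot S -> quot S} :=
  projT1 (cid (factor_surj (@quot_proj_surj _ _ S) (@quot_act_wd g))).

Lemma quot_act_proj g x : quot_act g (quot_proj S x) = quot_proj S (rep_act g x).
Proof. exact: (projT2 (cid (factor_surj (@quot_proj_surj _ _ S) (@quot_act_wd g)))). Qed.

Lemma quot_act1 x : quot_act 1%g x = x.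
Proof. by have [y <-] := quot_proj_surj x; rewrite quot_act_proj rep_act1. Qed.
Lemma quot_actM g h x : quot_act (g * h)%g x = quot_act g (quot_act h x).
Proof. by have [y <-] := quot_proj_surj x; rewrite !quot_act_proj rep_actM. Qed.
Lemma quot_smooth x : open [set g | quot_act g x = x].
Proof.
apply: (@open_stabilizer _ _ (fun g y => quot_act g y)); first exact: quot_actM.
have [y <-] := quot_proj_surj x; apply: filterS (rep_act_near1 y) => g gy.
by rewrite quot_act_proj gy.
Qed.

Definition quot_rep : smooth_rep k G := SmoothRep quot_act1 quot_actM quot_smooth.

Lemma quot_rep_proj_act g x :
  (quot_proj S : {linear V -> quot_rep}) (rep_act g x) = rep_act g (quot_proj S x : quot_rep).
Proof. exact/esym/quot_act_proj. Qed.
Definition quot_rep_proj : rep_hom V quot_rep := RepHom quot_rep_proj_act.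

Lemma quot_rep_proj_surj : surj quot_rep_proj.
Proof. exact: quot_proj_surj. Qed.

Lemma quot_rep_proj_eq0 x : quot_rep_proj x = 0 <-> S x.
Proof. exact: quot_proj_eq0. Qed.

Lemma quot_rep_ext Y (f h : rep_hom quot_rep Y) :
  rep_comp f quot_rep_proj = rep_comp h quot_rep_proj -> f = h.
Proof.
move=> fh; apply: rep_hom_eq => x; have [y <-] := quot_rep_proj_surj x.
exact: (congr1 (fun u : rep_hom V Y => u y) fh).
Qed.

Section Lift.
Variables (Y : smooth_rep k G) (f : rep_hom V Y) (Sf : forall x, S x -> f x = 0).

Lemma quot_lift_wd x : quot_proj S x = 0 -> f x = 0.
Proof. by move=> /quot_proj_eq0/Sf. Qed.
Definition quot_lift_linear : {linear quot S -> Y} :=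
  projT1 (cid (factor_surj (@quot_proj_surj _ _ S) quot_lift_wd)).
Lemma quot_lift_linearE x : quot_lift_linear (quot_proj S x) = f x.
Proof. exact: (projT2 (cid (factor_surj (@quot_proj_surj _ _ S) quot_lift_wd))). Qed.
Lemma quot_lift_act g (x : quot_rep) :
  (quot_lift_linear : {linear quot_rep -> Y}) (rep_act g x) = rep_act g (quot_lift_linear x).
Proof.
have [y <-] := quot_rep_proj_surj x.
by rewrite -rep_hom_act [LHS]quot_lift_linearE [quot_lift_linear _]quot_lift_linearE rep_hom_act.
Qed.
Definition quot_lift : rep_hom quot_rep Y := RepHom quot_lift_act.
Lemma quot_lift_proj : rep_comp quot_lift quot_rep_proj = f.
Proof. by apply: rep_hom_eq => x; exact: quot_lift_linearE. Qed.
End Lift.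
End Quotient.

End RepresentationConstructions.

(** * Adjoining invariant vectors to a representation *)

Section Attachment.
Variables (k : fieldType) (p : nat) (G : topologicalGroupType).
Variable I : open_pro_p_subgroup p G.
Implicit Types V W Y Z : smooth_rep k G.

Local Notation X := (ind_rep k I).
Local Notation H := (hecke k I).
Local Notation inv := (invariants I).

Lemma frob_fun_map V W (a : rep_hom V W) (v : V) (x : X) :
  a (frob_fun v x) = frob_fun (a v) x.
Proof.
have xT : {subset cind_seq x <= transversal I}.
  by move=> t; rewrite cind_seqP !inE => -[].
rewrite !(@frobE _ _ _ _ _ x (cind_seq x)) ?fset_uniq // linear_sum.
by apply: eq_bigr => t _; rewrite linearZ rep_hom_act.
Qed.

Lemma frob_fun0 V (x : X) : frob_fun (0 : V) x = 0.
Proof. exact: (esym (frob_fun_map (rep_hom0 V V) 0 x)). Qed.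

(* The Hecke action, extended to vectors that need not be [I]-invariant. *)
Definition hecke_op V (h : H) (v : V) : V :=
  frob_fun v ((h : rep_end X) (ind_one k I)).

(** The counterpart of [act] for vectors that may be invariant only modulo relations still to be
    imposed; on invariants both agree by [inv_val_act]. *)
Definition rep_mx V q r (d : 'I_r -> 'I_q -> H) (a : 'I_q -> V) (l : 'I_r) : V :=
  \sum_j hecke_op (d l j) (a j).

Lemma rep_mx_map V W (f : rep_hom V W) q r (d : 'I_r -> 'I_q -> H) (a : 'I_q -> V) l :
  f (rep_mx d a l) = rep_mx d (fun j => f (a j)) l.
Proof. by rewrite linear_sum; apply: eq_bigr => j _; exact: frob_fun_map. Qed.

Lemma eq_rep_mx V q r (d : 'I_r -> 'I_q -> H) (a b : 'I_q -> V) l :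
  a =1 b -> rep_mx d a l = rep_mx d b l.
Proof. by move=> ab; apply: eq_bigr => j _; rewrite ab. Qed.

Lemma rep_mx0 V q r (d : 'I_r -> 'I_q -> H) (a : 'I_q -> V) l :
  (forall j, a j = 0) -> rep_mx d a l = 0.
Proof. by move=> a0; apply: big1 => j _; rewrite a0; exact: frob_fun0. Qed.

Lemma inv_val_act V q r (d : 'I_r -> 'I_q -> H) (a : 'I_q -> inv V) l :
  inv_val (act (M := inv V) d a l) = rep_mx d (fun j => inv_val (a j)) l.
Proof. exact: (big_morph (@inv_val k p G I V) (id1 := 0) (op1 := +%R)). Qed.

Section Generators.
Variables (V : smooth_rep k G) (T : choiceType).

(** Invariant vectors indexed by [T] are freely adjoined to [V]: by Frobenius reciprocity, a map out
    of the result is a map on [V] with a family of invariants. *)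
Definition attach : smooth_rep k G := prod_rep V (finsupp_rep T X).

Lemma attach_in_linear : linear (fun v : V => (v, 0) : attach).
Proof. by move=> a u v; congr pair; rewrite -[RHS]/(a *: 0 + 0) scaler0 addr0. Qed.
Lemma attach_in_act g v :
  (lin attach_in_linear) (rep_act g v) = rep_act g (lin attach_in_linear v).
Proof. by congr pair; rewrite linear0. Qed.
Definition attach_in : rep_hom V attach := RepHom attach_in_act.

Lemma attach_gen_inv t : I_invariant I ((0, single t (ind_one k I)) : attach).
Proof.
move=> i Ii; congr pair; first exact: linear0.
rewrite finsupp_act_single; congr (single t _); exact: ind_one_invariant.
Qed.
Definition attach_gen t : inv attach := Invariant (@attach_gen_inv t).

Lemma attach_sum (v : V) (s : seq (X * T)) :
  ((v, \sum_(u <- s) single u.2 u.1) : attach) =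
  attach_in v + \sum_(u <- s) frob_fun (inv_val (attach_gen u.2)) u.1.
Proof.
have fE t x : frob_fun (inv_val (attach_gen t)) x = (0, single t x) :> attach.
  have sL : linear (fun x : X => (0, single t x) : attach).
    by move=> a y z; congr pair; [rewrite -[RHS]/(a *: 0 + 0) scaler0 addr0|exact: linearP].
  have sA g y : (lin sL) (rep_act g y) = rep_act g (lin sL y).
    by congr pair; [rewrite linear0|exact/esym/finsupp_act_single].
  apply: (frob_uniq (a := frob (inv_valP (attach_gen t))) (b := RepHom sA)).
  exact: frob_one (inv_valP _).
under [X in _ = _ + X]eq_bigr do rewrite fE.
rewrite -[RHS]/(v + _, 0 + _) add0r.
have -> : \sum_(u <- s) ((0, single u.2 u.1) : attach) =
    (0, \sum_(u <- s) single u.2 u.1).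
  elim: s => [|u s IHs]; first by rewrite !big_nil.
  by rewrite !big_cons IHs; congr pair; rewrite -[LHS]/(0 + 0) addr0.
by rewrite /= addr0.
Qed.

Section Lift.
Variables (Y : smooth_rep k G) (f : rep_hom V Y) (w : T -> inv Y).

Let lift_gen : rep_hom (finsupp_rep T X) Y := finsupp_lift (fun t => frob (inv_valP (w t))).
Lemma attach_lift_linear : linear (fun x : attach => f x.1 + lift_gen x.2).
Proof. by move=> a x y; rewrite !linearP scalerDr addrACA. Qed.
Lemma attach_lift_act g x :
  (lin attach_lift_linear) (rep_act g x) = rep_act g (lin attach_lift_linear x).
Proof.
rewrite -[LHS]/(f (rep_act g x.1) + lift_gen (rep_act g x.2)).
by rewrite !rep_hom_act -linearD.
Qed.
Definition attach_lift : rep_hom attach Y := RepHom attach_lift_act.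

Lemma attach_lift_in v : attach_lift (attach_in v) = f v.
Proof. by rewrite -[LHS]/(f v + lift_gen 0) linear0 addr0. Qed.

Lemma attach_lift_gen t : inv_map attach_lift (attach_gen t) = w t.
Proof.
apply: inv_eq; rewrite -[LHS]/(f 0 + lift_gen (single t (ind_one k I))) linear0 add0r.
by rewrite [LHS]lift_single; exact: frob_one (inv_valP _).
Qed.
End Lift.

Lemma attach_ext Y (f h : rep_hom attach Y) :
  (forall v, f (attach_in v) = h (attach_in v)) ->
  (forall t, inv_map f (attach_gen t) = inv_map h (attach_gen t)) -> f = h.
Proof.
move=> fhV fhT; apply: rep_hom_eq => -[v x].
have -> : ((v, x) : attach) = (v, \sum_(u <- [seq (coef x t, t) | t <- supp x]) single u.2 u.1).
  by rewrite big_map /= -finsupp_sum.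
rewrite attach_sum !linearD !linear_sum fhV; congr (_ + _); apply: eq_bigr => u _.
rewrite !frob_fun_map; congr (frob_fun _ _).
exact: (congr1 (@inv_val _ _ _ _ _) (fhT u.2)).
Qed.

End Generators.
End Attachment.

(** * Cell attachment *)

Section CellAttachment.
Variables (k : fieldType) (p : nat) (G : topologicalGroupType).
Variable I : open_pro_p_subgroup p G.
Implicit Types V W Y Z : smooth_rep k G.

Local Notation X := (ind_rep k I).
Local Notation H := (hecke k I).
Local Notation inv := (invariants I).

(* [a] is a family of formal elements of the representation under construction;
   the nesting replaces the iteration of the small object argument. *)
Inductive cell_gen (V W : smooth_rep k G) : Type :=
| Base of inv W
| Cell (c : chain H) (a : 'I_(dim c 1) -> V * seq (X * cell_gen V W)) (i : 'I_(dim c 0)).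

HB.instance Definition _ V W := gen_eqMixin (cell_gen V W).
HB.instance Definition _ V W := gen_choiceMixin (cell_gen V W).

Section Fold.
Variables (V W : smooth_rep k G) (K : Type) (bs : inv W -> K).
Variable cs : forall c : chain H,
  ('I_(dim c 1) -> V * seq (X * K)) -> 'I_(dim c 0) -> K.

Fixpoint cell_fold (t : cell_gen V W) : K :=
  match t with
  | Base w => bs w
  | Cell c a i =>
      cs (fun j => ((a j).1, map (fun u => (u.1, cell_fold u.2)) (a j).2)) i
  end.
End Fold.

(** Structural induction that reaches the terms nested in the lists, by an inner induction on each
    list. [clear IH] keeps the closing tactics from an unguarded recursive call. *)
Lemma cell_gen_nested_ind V W (P : cell_gen V W -> Prop) :
  (forall w, P (Base V w)) ->
  (forall c (a : 'I_(dim c 1) -> V * seq (X * cell_gen V W)) i,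
     (forall j u, u \in (a j).2 -> P u.2) -> P (Cell a i)) ->
  forall t, P t.
Proof.
move=> Pb Pc; fix IH 1 => -[w|c a i]; first exact: Pb.
apply: Pc => j; elim: (a j).2 => [|u s IHs] u'; first by rewrite in_nil; clear IH.
by rewrite inE => /orP[/eqP->|/IHs]; [exact: IH|clear IH].
Qed.

Section Map.
Variables (V W V' W' : smooth_rep k G) (al : rep_hom V V') (be : rep_hom W W').

Definition cell_map : cell_gen V W -> cell_gen V' W' :=
  cell_fold (fun w => Base V' (inv_map be w))
    (fun c a i => Cell (fun j => (al (a j).1, (a j).2)) i).

Definition raw_map (r : V * seq (X * cell_gen V W)) :=
  (al r.1, map (fun u => (u.1, cell_map u.2)) r.2).

Lemma cell_map_Cell c (a : 'I_(dim c 1) -> V * seq (X * cell_gen V W)) i :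
  cell_map (Cell a i) = Cell (fun j => raw_map (a j)) i.
Proof. by []. Qed.
End Map.

Lemma raw_surj V W (x : attach I V (cell_gen V W)) :
  exists r : V * seq (X * cell_gen V W),
    x = attach_in I V (cell_gen V W) r.1 +
        \sum_(u <- r.2) frob_fun (inv_val (attach_gen I V u.2)) u.1.
Proof.
case: x => v x; exists (v, [seq (coef x t, t) | t <- supp x]).
by rewrite -attach_sum big_map /= -finsupp_sum.
Qed.

Section Step.
Variables (V W : smooth_rep k G) (f : rep_hom V W).

Local Notation gen := (cell_gen V W).
Local Notation A := (attach I V gen).

Definition raw_val (r : V * seq (X * gen)) : A :=
  attach_in I V gen r.1 + \sum_(u <- r.2) frob_fun (inv_val (attach_gen I V u.2)) u.1.

(** The base generators make the map surjective on invariants; the cells have to lie in its kernel,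
    since they solve equations there. *)
Definition cell_target (t : gen) : inv W := if t is Base w then w else 0.
Definition attach_target : rep_hom A W := attach_lift f cell_target.

(* The smallest subrepresentation modulo which every family of invariants of
   the kernel that is a cocycle in degree 1 of a chain [c] is the image of the
   generators [Cell a i] under the differential. *)
Inductive cell_rel : A -> Prop :=
| cell_rel0 : cell_rel 0
| cell_rel_lin a x y : cell_rel x -> cell_rel y -> cell_rel (a *: x + y)
| cell_rel_act g x : cell_rel x -> cell_rel (rep_act g x)
| cell_rel_cell c (a : 'I_(dim c 1) -> V * seq (X * gen)) j :
    (forall j i, (I : set G) i ->
       cell_rel (rep_act i (raw_val (a j)) - raw_val (a j))) ->
    (forall j, attach_target (raw_val (a j)) = 0) ->
    (forall l, cell_rel (rep_mx (@dif _ c 1) (fun j => raw_val (a j)) l)) ->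
    cell_rel (raw_val (a j) -
      rep_mx (@dif _ c 0) (fun i => inv_val (attach_gen I V (Cell a i))) j).

Definition cell_sub : submodule A := Submodule cell_rel0 cell_rel_lin.

Lemma cell_sub_act g x : cell_sub x -> cell_sub (rep_act g x).
Proof. exact: cell_rel_act. Qed.

Definition cell_rep : smooth_rep k G := quot_rep cell_sub_act.
Definition cell_proj : rep_hom A cell_rep := quot_rep_proj cell_sub_act.

Lemma cell_rel_target x : cell_rel x -> attach_target x = 0.
Proof.
elim=> [|a {}x y _ x0 _ y0|g {}x _ x0|c a j _ _ a0 _ _].
- exact: linear0.
- by rewrite linearP x0 y0 scaler0 addr0.
- by rewrite rep_hom_act x0 linear0.
rewrite linearB a0 rep_mx_map rep_mx0 ?subr0 // => i.
exact: (congr1 (@inv_val _ _ _ _ _) (attach_lift_gen f cell_target (Cell a i))).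
Qed.

Definition cell_left : rep_hom V cell_rep := rep_comp cell_proj (attach_in I V gen).
Definition cell_right : rep_hom cell_rep W := quot_lift cell_sub_act cell_rel_target.

Lemma cell_right_proj x : cell_right (cell_proj x) = attach_target x.
Proof.
exact: (congr1 (fun h : rep_hom A W => h x) (quot_lift_proj cell_sub_act cell_rel_target)).
Qed.

Lemma cell_fact : rep_comp cell_right cell_left = f.
Proof. by apply: rep_hom_eq => v; rewrite /= [LHS]cell_right_proj attach_lift_in. Qed.

Lemma cell_ext Y (h h' : rep_hom cell_rep Y) :
  (forall v, h (cell_left v) = h' (cell_left v)) ->
  (forall t, h (cell_proj (inv_val (attach_gen I V t))) =
     h' (cell_proj (inv_val (attach_gen I V t)))) ->
  h = h'.
Proof.
move=> hV hT; apply: quot_rep_ext; apply: attach_ext => [|t]; first exact: hV.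
exact/inv_eq/hT.
Qed.

Lemma cell_right_surj : surj (inv_map (I := I) cell_right).
Proof.
move=> w; exists (inv_map cell_proj (attach_gen I V (Base V w))).
apply: inv_eq; rewrite /= [LHS]cell_right_proj.
exact: (congr1 (@inv_val _ _ _ _ _) (attach_lift_gen f cell_target (Base V w))).
Qed.

(** A family of invariants of the quotient lifts to formal elements [r] over the generators, and
    [Cell r i] is again one of the generators; so a single construction solves all equations. *)
Lemma cell_right_acyclic : acyclic_kernel (inv_map (I := I) cell_right).
Proof.
move=> c a a0 fa.
have /choice[x xP] : forall j, exists x, cell_proj x = inv_val (a j).
  by move=> j; exact: quot_rep_proj_surj.
have /choice[r rP] : forall j, exists r, x j = raw_val r by move=> j; exact: raw_surj.
have prE j : cell_proj (raw_val (r j)) = inv_val (a j) by rewrite -rP xP.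
pose b i := inv_map cell_proj (attach_gen I V (Cell r i)).
exists b; split=> [i|j].
  apply: inv_eq; rewrite /= [LHS]cell_right_proj.
  exact: (congr1 (@inv_val _ _ _ _ _) (attach_lift_gen f cell_target (Cell r i))).
apply: inv_eq; rewrite inv_val_act -prE -[RHS](rep_mx_map cell_proj).
apply/eqP; rewrite -subr_eq0 -linearB; apply/eqP/quot_rep_proj_eq0.
apply: cell_rel_cell => [l i Ii|l|l].
- apply/(quot_rep_proj_eq0 cell_sub_act); rewrite linearB.
  by rewrite rep_hom_act [quot_rep_proj _ _]prE inv_valP // subrr.
- rewrite -cell_right_proj prE.
  exact: (congr1 (@inv_val _ _ _ _ _) (fa l)).
- apply/(quot_rep_proj_eq0 cell_sub_act).
  rewrite (rep_mx_map cell_proj) (eq_rep_mx _ _ prE) -inv_val_act.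
  exact: (congr1 (@inv_val _ _ _ _ _) (a0 l)).
Qed.

Section Lifting.
Variables (Y Z : smooth_rep k G) (q : rep_hom Y Z).
Hypothesis qs : surj (inv_map (I := I) q).
Hypothesis qa : acyclic_kernel (inv_map (I := I) q).
Variables (u : rep_hom V Y) (z : rep_hom cell_rep Z).
Hypothesis quz : rep_comp q u = rep_comp z cell_left.

(** If the equation has a solution over [zt], one is taken; otherwise arbitrary lifts of [zt] serve
    as default. *)
Lemma cell_choice (c : chain H) (b : 'I_(dim c 1) -> Y) (zt : 'I_(dim c 0) -> inv Z) :
  exists y : 'I_(dim c 0) -> inv Y, (forall i, inv_map q (y i) = zt i) /\
    ((exists y' : 'I_(dim c 0) -> inv Y, (forall i, inv_map q (y' i) = zt i) /\
        forall j, b j = rep_mx (@dif _ c 0) (fun i => inv_val (y' i)) j) ->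
     forall j, b j = rep_mx (@dif _ c 0) (fun i => inv_val (y i)) j).
Proof.
have [[y yP]|ny] := pselect (exists y' : 'I_(dim c 0) -> inv Y,
    (forall i, inv_map q (y' i) = zt i) /\
    forall j, b j = rep_mx (@dif _ c 0) (fun i => inv_val (y' i)) j).
  by exists y; split=> [|_]; have [] := yP.
by have /choice[y yP] := fun i => qs (zt i); exists y.
Qed.

Let gen_target (t : gen) : inv Z := inv_map (rep_comp z cell_proj) (attach_gen I V t).

(* Whether the equation of a cell is solvable is not known during the recursion,
   whence the conditional form of [cell_choice]. *)
Fixpoint cell_lift (t : gen) : inv Y :=
  match t with
  | Base w => projT1 (cid (qs (gen_target (Base V w))))
  | Cell c a i => projT1 (cid (cell_choice
      (fun j => u (a j).1 +
         foldr +%R 0 (map (fun v => frob_fun (inv_val (cell_lift v.2)) v.1) (a j).2))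
      (fun i => gen_target (Cell a i)))) i
  end.

Lemma cell_lift_target t : inv_map q (cell_lift t) = gen_target t.
Proof.
case: t => [w|c a i] /=; first exact: (projT2 (cid (qs _))).
by case: (cid _) => y [/= yP _].
Qed.

Lemma attach_lift_raw_val r : attach_lift u cell_lift (raw_val r) =
  u r.1 + \sum_(v <- r.2) frob_fun (inv_val (cell_lift v.2)) v.1.
Proof.
rewrite linearD attach_lift_in linear_sum; congr (_ + _); apply: eq_bigr => v _.
rewrite frob_fun_map; congr (frob_fun _ _).
exact: (congr1 (@inv_val _ _ _ _ _) (attach_lift_gen u cell_lift v.2)).
Qed.

Lemma attach_lift_target x : q (attach_lift u cell_lift x) = z (cell_proj x).
Proof.
suff e : rep_comp q (attach_lift u cell_lift) = rep_comp z cell_proj.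
  exact: (congr1 (fun h : rep_hom A Z => h x) e).
apply: attach_ext => [v|t].
  apply: etrans (congr1 q (attach_lift_in u cell_lift v)) _.
  exact: (congr1 (fun h : rep_hom V Z => h v) quz).
rewrite -[RHS]cell_lift_target; apply: inv_eq; congr (q _).
exact: (congr1 (@inv_val _ _ _ _ _) (attach_lift_gen u cell_lift t)).
Qed.

(** By induction the lifted family [b] of a cell relation is invariant and a cocycle. This makes the
    equation of the cell solvable in [Y], and then [cell_lift] has picked a solution. *)
Lemma cell_rel_lift x : cell_rel x -> attach_lift u cell_lift x = 0.
Proof.
elim=> [|a {}x y _ x0 _ y0|g {}x _ x0|c a j relI aI a0 relD aD].
- exact: linear0.
- by rewrite linearP x0 y0 scaler0 addr0.
- by rewrite rep_hom_act x0 linear0.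
pose b j : Y := attach_lift u cell_lift (raw_val (a j)).
have bI j' : I_invariant I (b j').
  move=> i Ii; apply/eqP; rewrite -subr_eq0 -rep_hom_act -linearB.
  by apply/eqP/aI.
(* The induction concerns one index [j], whereas solvability involves all of them; the premises
   cover the whole family. *)
have relj j' : cell_rel (raw_val (a j') -
    rep_mx (@dif _ c 0) (fun i => inv_val (attach_gen I V (Cell a i))) j').
  exact: cell_rel_cell.
(* Since [z] is defined on the quotient, the relations become equations in [Z]. *)
have qb j' : q (b j') = rep_mx (@dif _ c 0) (fun i => inv_val (gen_target (Cell a i))) j'.
  rewrite attach_lift_target; apply/eqP; rewrite -subr_eq0.
  rewrite -(rep_mx_map (rep_comp z cell_proj)) -(linearB (rep_comp z cell_proj)).
  by apply/eqP/(etrans (congr1 z ((quot_rep_proj_eq0 cell_sub_act _).2 (relj j')))); exact: linear0.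
have sol : exists y' : 'I_(dim c 0) -> inv Y,
    (forall i, inv_map q (y' i) = gen_target (Cell a i)) /\
    forall j, b j = rep_mx (@dif _ c 0) (fun i => inv_val (y' i)) j.
  have /choice[y yP] := fun i => qs (gen_target (Cell a i)).
  pose b' j : inv Y := Invariant (bI j).
  (* The defect of the arbitrary lifts [y] is a cocycle in the kernel of [q], where acyclicity
     provides the correction [e]. *)
  have [l|j'|e [qe eE]] := qa (c := c) (a := fun j => b' j - act (@dif _ c 0) y j).
  - rewrite actB act_act; last exact: dif_complex.
    rewrite subr0; apply: inv_eq; rewrite inv_val_act -[RHS](aD l) rep_mx_map //.
  - rewrite linearB act_map; apply/eqP; rewrite subr_eq0; apply/eqP.
    apply: inv_eq; rewrite inv_val_act -[LHS]/(q (b j')) qb.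
    by apply: eq_rep_mx => i; rewrite yP.
  exists (fun i => e i + y i); split=> [i|j']; first by rewrite linearD qe yP add0r.
  by rewrite -inv_val_act actD -eE subrK.
rewrite linearB rep_mx_map; apply/eqP; rewrite subr_eq0; apply/eqP.
have -> : (fun i => attach_lift u cell_lift (inv_val (attach_gen I V (Cell a i)))) =
    fun i => inv_val (cell_lift (Cell a i)).
  apply/funext => i.
  exact: (congr1 (@inv_val _ _ _ _ _) (attach_lift_gen u cell_lift (Cell a i))).
have bE j' : u (a j').1 +
    foldr +%R 0 (map (fun v => frob_fun (inv_val (cell_lift v.2)) v.1) (a j').2) = b j'.
  by rewrite /b attach_lift_raw_val foldr_map unlock.
have [_ yE] := projT2 (cid (cell_choice
  (fun j => u (a j).1 +
     foldr +%R 0 (map (fun v => frob_fun (inv_val (cell_lift v.2)) v.1) (a j).2))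
  (fun i => gen_target (Cell a i)))).
rewrite -[LHS]/(b j) -bE; apply: yE.
have [y' [y'P y'E]] := sol; exists y'; split=> // j'.
by rewrite bE.
Qed.

Lemma cell_left_lifting : exists h : rep_hom cell_rep Y,
  rep_comp h cell_left = u /\ rep_comp q h = z.
Proof.
have e := quot_lift_proj cell_sub_act cell_rel_lift.
exists (quot_lift cell_sub_act cell_rel_lift); split.
  apply: rep_hom_eq => v; apply: etrans (attach_lift_in u cell_lift v).
  exact: (congr1 (fun h : rep_hom A Y => h (attach_in I V gen v)) e).
apply: quot_rep_ext; apply: rep_hom_eq => x; apply: etrans (attach_lift_target x).
exact: (congr1 (fun h : rep_hom A Y => q (h x)) e).
Qed.
End Lifting.

End Step.
End CellAttachment.

(** * The two functorial factorizations *)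

Section CellFactorization.
Variables (k : fieldType) (p : nat) (G : topologicalGroupType).
Variable I : open_pro_p_subgroup p G.
Implicit Types V W Y Z : smooth_rep k G.

Local Notation X := (ind_rep k I).
Local Notation inv := (invariants I).

Lemma rep_hom_congr V W (f g : rep_hom V W) v : f = g -> f v = g v.
Proof. by move->. Qed.

Lemma inv_val_congr V (u v : inv V) : u = v -> inv_val u = inv_val v.
Proof. by move->. Qed.

Lemma inv_map_comp V W Z (f : rep_hom W Z) (g : rep_hom V W) (v : inv V) :
  inv_map (rep_comp f g) v = inv_map f (inv_map g v).
Proof. exact: inv_eq. Qed.

Section Map.
Variables (V W V' W' : smooth_rep k G) (f : rep_hom V W) (f' : rep_hom V' W').
Variables (al : rep_hom V V') (be : rep_hom W W').
Hypothesis e : rep_comp be f = rep_comp f' al.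

Definition attach_map : rep_hom (attach I V (cell_gen I V W)) (attach I V' (cell_gen I V' W')) :=
  attach_lift (rep_comp (attach_in I V' (cell_gen I V' W')) al)
    (fun t => attach_gen I V' (cell_map al be t)).

Lemma attach_map_gen t : attach_map (inv_val (attach_gen I V t)) =
  inv_val (attach_gen I V' (cell_map al be t)).
Proof. exact: (inv_val_congr (attach_lift_gen _ _ t)). Qed.

Lemma attach_map_raw r : attach_map (raw_val r) = raw_val (raw_map al be r).
Proof.
rewrite linearD [attach_map (attach_in _ _ _ _)]attach_lift_in linear_sum.
congr (_ + _); rewrite big_map; apply: eq_bigr => u _.
by rewrite frob_fun_map attach_map_gen.
Qed.

Lemma attach_map_target x : attach_target I f' (attach_map x) = be (attach_target I f x).
Proof.
apply: (rep_hom_congr (f := rep_comp (attach_target I f') attach_map)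
  (g := rep_comp be (attach_target I f))).
apply: attach_ext => [v|t].
  rewrite -[LHS]/(attach_target I f' (attach_map _)) -[RHS]/(be (attach_target I f _)).
  rewrite /attach_map attach_lift_in -[rep_comp _ _ v]/(attach_in _ _ _ (al v)).
  by rewrite /attach_target !attach_lift_in; exact/esym/(rep_hom_congr v e).
apply: inv_eq.
rewrite -[LHS]/(attach_target I f' (attach_map _)) -[RHS]/(be (attach_target I f _)).
rewrite attach_map_gen [LHS](inv_val_congr (attach_lift_gen _ _ _)).
rewrite [attach_target I _ _](inv_val_congr (attach_lift_gen _ _ _)).
by case: t => [w|c a i] //=; rewrite linear0.
Qed.

(** The image of a cell is the cell of the image family, and the premises of a relation are carried
    along by induction. *)
Lemma attach_map_rel x : cell_rel f x -> cell_rel f' (attach_map x).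
Proof.
elim=> [|a {}x y _ x0 _ y0|g {}x _ x0|c a j _ relI a0 _ relD].
- by rewrite linear0; exact: cell_rel0.
- by rewrite linearP; exact: cell_rel_lin.
- by rewrite rep_hom_act; exact: cell_rel_act.
have rawE l : attach_map (raw_val (a l)) = raw_val (raw_map al be (a l)) by exact: attach_map_raw.
rewrite linearB rawE rep_mx_map (eq_rep_mx _ _ (fun i => attach_map_gen (Cell a i))).
apply: (@cell_rel_cell _ _ _ _ _ _ f' c (fun l => raw_map al be (a l))) => [l i Ii|l|l].
- by rewrite -rawE -rep_hom_act -linearB; exact: relI.
- by rewrite -rawE attach_map_target a0 linear0.
- by have := relD l; rewrite rep_mx_map (eq_rep_mx _ _ rawE).
Qed.

Lemma cell_fmap_rel x : cell_sub I f x -> rep_comp (cell_proj I f') attach_map x = 0.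
Proof. by move=> /attach_map_rel ?; apply/quot_rep_proj_eq0. Qed.

Definition cell_fmap : rep_hom (cell_rep I f) (cell_rep I f') :=
  quot_lift (@cell_sub_act _ _ _ _ _ _ f) cell_fmap_rel.

Lemma cell_fmap_proj x : cell_fmap (cell_proj I f x) = cell_proj I f' (attach_map x).
Proof. exact: (rep_hom_congr x (quot_lift_proj _ cell_fmap_rel)). Qed.

Lemma cell_fmap_gen t : cell_fmap (cell_proj I f (inv_val (attach_gen I V t))) =
  cell_proj I f' (inv_val (attach_gen I V' (cell_map al be t))).
Proof. by rewrite cell_fmap_proj attach_map_gen. Qed.

Lemma cell_fmap_left v : cell_fmap (cell_left I f v) = cell_left I f' (al v).
Proof. by rewrite [LHS]cell_fmap_proj [attach_map _]attach_lift_in. Qed.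

Lemma cell_fmap_right x : cell_right I f' (cell_fmap x) = be (cell_right I f x).
Proof.
have [y <-] := quot_rep_proj_surj x.
rewrite [cell_fmap _]cell_fmap_proj cell_right_proj attach_map_target.
by rewrite [cell_right I f _]cell_right_proj.
Qed.
End Map.

(** Terms are mapped syntactically, without choices, so functoriality holds strictly. *)
Lemma cell_map_id V W (t : cell_gen I V W) : cell_map (rep_id V) (rep_id W) t = t.
Proof.
elim/cell_gen_nested_ind: t => [w|c a i IHa].
  by congr (Base V _); exact: inv_eq.
rewrite cell_map_Cell; congr (Cell _ i); apply/funext => j.
have := IHa j; rewrite /raw_map; case: (a j) => v s /= IHs; congr pair.
by rewrite -[RHS]map_id; apply/eq_in_map => -[x u] us; congr pair; exact: (IHs _ us).
Qed.

Lemma cell_map_comp V W V' W' V'' W'' (al : rep_hom V V') (be : rep_hom W W')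
    (al' : rep_hom V' V'') (be' : rep_hom W' W'') (t : cell_gen I V W) :
  cell_map (rep_comp al' al) (rep_comp be' be) t = cell_map al' be' (cell_map al be t).
Proof.
elim/cell_gen_nested_ind: t => [w|c a i IHa].
  by congr (Base _ _); exact: inv_eq.
rewrite !cell_map_Cell; congr (Cell _ i); apply/funext => j.
have := IHa j; rewrite /raw_map; case: (a j) => v s /= IHs; congr pair.
by rewrite -map_comp; apply/eq_in_map => -[x u] us; congr pair; exact: (IHs _ us).
Qed.

Definition cell_factorization : functorial_factorization (Rep k G).
Proof.
refine (@FunctorialFactorization (Rep k G)
  (fun V W f => cell_rep I f) (fun V W f => cell_left I f)
  (fun V W f => cell_right I f) _ (fun V W V' W' f f' al be e => cell_fmap e) _ _ _ _).
- by move=> V W f; exact: cell_fact.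
- by move=> V W V' W' f f' al be e; apply: rep_hom_eq => v; exact: cell_fmap_left.
- by move=> V W V' W' f f' al be e; apply: rep_hom_eq => x; exact: cell_fmap_right.
- move=> V W f e; apply: cell_ext => [v|t]; first exact: cell_fmap_left.
  by rewrite [LHS](cell_fmap_gen e) cell_map_id.
- move=> V W V' W' V'' W'' f f' f'' al be al' be' e e' e''.
  apply: cell_ext => [v|t].
    by rewrite [LHS]cell_fmap_left [RHS](congr1 (cell_fmap e') (cell_fmap_left e v)) cell_fmap_left.
  rewrite [LHS](cell_fmap_gen e'') [RHS](congr1 (cell_fmap e') (cell_fmap_gen e t)).
  by rewrite cell_fmap_gen cell_map_comp.
Defined.

Section FreeFactorization.

Definition free_right V W (f : rep_hom V W) : rep_hom (attach I V (inv W)) W :=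
  attach_lift f id.

Definition free_fmap V W V' W' (al : rep_hom V V') (be : rep_hom W W') :
    rep_hom (attach I V (inv W)) (attach I V' (inv W')) :=
  attach_lift (rep_comp (attach_in I V' (inv W')) al)
    (fun w => attach_gen I V' (inv_map be w)).

Definition free_factorization : functorial_factorization (Rep k G).
Proof.
refine (@FunctorialFactorization (Rep k G)
  (fun V W f => attach I V (inv W)) (fun V W f => attach_in I V (inv W))
  free_right _ (fun V W V' W' f f' al be e => free_fmap al be) _ _ _ _).
- by move=> V W f; apply: rep_hom_eq => v; exact: attach_lift_in.
- by move=> V W V' W' f f' al be e; apply: rep_hom_eq => v; exact: attach_lift_in.
- move=> V W V' W' f f' al be e; apply: attach_ext => [v|w].
    rewrite [LHS](congr1 (free_right f') (attach_lift_in _ _ v)) [LHS]attach_lift_in.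
    rewrite [RHS](congr1 be (attach_lift_in _ _ v)).
    exact/esym/(rep_hom_congr v e).
  by rewrite [LHS]inv_map_comp [RHS]inv_map_comp !attach_lift_gen.
- move=> V W f e; apply: attach_ext => [v|w]; first exact: attach_lift_in.
  rewrite [LHS]attach_lift_gen; apply: inv_eq.
  by congr (inv_val (attach_gen I V _)); exact: inv_eq.
- move=> V W V' W' V'' W'' f f' f'' al be al' be' e e' e''.
  apply: attach_ext => [v|w].
    rewrite [LHS]attach_lift_in [RHS](congr1 (free_fmap al' be') (attach_lift_in _ _ v)).
    by rewrite [RHS]attach_lift_in.
  rewrite [RHS]inv_map_comp !attach_lift_gen.
  by congr (attach_gen I _ _); exact: inv_eq.
Defined.

Lemma free_right_surj V W (f : rep_hom V W) : surj (inv_map (I := I) (free_right f)).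
Proof. by move=> w; exists (attach_gen I V w); exact: attach_lift_gen. Qed.

(** The adjoined generators are free, so it is enough to lift each of them separately. *)
Lemma attach_in_lifting V (T : choiceType) Y Z (q : rep_hom Y Z) :
  surj (inv_map (I := I) q) ->
  @has_lifting (Rep k G) _ _ _ _ (attach_in I V T : @hom (Rep k G) V (attach I V T)) q.
Proof.
move=> qs u z quz; have /choice[y yP] := fun t => qs (inv_map z (attach_gen I V t)).
exists (attach_lift u y); split.
  by apply: rep_hom_eq => v; exact: attach_lift_in.
apply: attach_ext => [v|t].
  rewrite [LHS](congr1 q (attach_lift_in _ _ v)); exact: (rep_hom_congr v quz).
by rewrite [LHS]inv_map_comp attach_lift_gen yP.
Qed.

End FreeFactorization.
End CellFactorization.

(** * The transferred model structure *)

Section Transfer.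
Variables (k : fieldType) (p : nat) (G : topologicalGroupType).
Variable I : open_pro_p_subgroup p G.
Implicit Types V W Y Z : smooth_rep k G.

Local Notation X := (ind_rep k I).
Local Notation H := (hecke k I).
Local Notation inv := (invariants I).
Local Notation U := (invariants_functor k I).

Section AttachmentAcyclic.
Variables (V : smooth_rep k G) (T : choiceType).

Lemma attach_fst_linear : linear (fun x : attach I V T => x.1). Proof. by []. Qed.
Definition attach_fst : rep_hom (attach I V T) V :=
  @RepHom _ _ (attach I V T) V (lin attach_fst_linear) (fun _ _ => erefl).

Lemma attach_coef_linear t : linear (fun x : attach I V T => coef x.2 t).
Proof. by []. Qed.
Lemma attach_coef_act t g x : lin (attach_coef_linear t) (rep_act g x) =
  rep_act g (lin (attach_coef_linear t) x).
Proof. exact: coef_finsupp_act. Qed.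
Definition attach_coef t : rep_hom (attach I V T) X := RepHom (attach_coef_act t).

Lemma attach_fst_surj : surj (inv_map (I := I) attach_fst).
Proof. by move=> v; exists (inv_map (attach_in I V T) v); exact: inv_eq. Qed.

(** The kernel is a direct sum of copies of [X]; equations on its invariants are solved
    coordinatewise in [X^I], with the zero solution where the data vanish so that supports stay
    finite. *)
Lemma attach_fst_acyclic : acyclic_kernel (inv_map (I := I) attach_fst).
Proof.
move=> c a a0 fa.
have /choice[b bP] : forall t, exists b : 'I_(dim c 0) -> inv X,
    (forall j, inv_map (attach_coef t) (a j) = act (@dif _ c 0) b j) /\
    ((forall j, inv_map (attach_coef t) (a j) = 0) -> b = fun=> 0).
  move=> t; have [at0|nat0] := pselect (forall j, inv_map (attach_coef t) (a j) = 0).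
    by exists (fun=> 0); split=> // j; rewrite act0.
  have ex := exact_on_invariants (@dif_exact _ c 0).
  have [l|b bP] := ex (fun j => inv_map (attach_coef t) (a j)); last by exists b; split.
  by rewrite -(act_map _ (inv_map (attach_coef t))) a0 linear0.
have bfin i : finsupp_sub T X (fun t => inv_val (b t i)).
  apply: (sub_finite_set (B := \bigcup_(j in [set: 'I_(dim c 1)])
      [set t | coef (inv_val (a j)).2 t != 0])).
    move=> t /= bt; apply: contrapT => nt; case/eqP: bt.
    rewrite (bP t).2 // => j; apply: inv_eq; apply/eqP/negPn/negP => atj.
    by apply: nt; exists j.
  by apply: bigcup_finite => // j _; exact: (subm_valP (inv_val (a j)).2).
pose b' i : attach I V T := (0, SubmElt (bfin i)).
have b'I i : I_invariant I (b' i).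
  move=> g Ig; congr pair; first exact: linear0.
  by apply: coef_eq => t; rewrite coef_finsupp_act; exact: (inv_valP (b t i)).
pose b'' i : inv (attach I V T) := Invariant (b'I i).
exists b''; split=> [i|j]; first exact: inv_eq.
have e1 : inv_map attach_fst (a j) = inv_map attach_fst (act (@dif _ c 0) b'' j).
  by rewrite act_map fa act0 // => i; exact: inv_eq.
have e2 t : inv_map (attach_coef t) (a j) = inv_map (attach_coef t) (act (@dif _ c 0) b'' j).
  by rewrite act_map (bP t).1; apply: eq_act => i; exact: inv_eq.
apply: inv_eq; move: (inv_val_congr e1) (fun t => inv_val_congr (e2 t)) => {e1 e2} /=.
case: (inv_val (a j)) => v x; case: (inv_val (act _ _ _)) => v' x' /= -> xx'.
by congr pair; exact: coef_eq.
Qed.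

End AttachmentAcyclic.

Hypothesis gorenstein : gorenstein_ring H.

Lemma hecke_extendable : extendable_chains H.
Proof. by case: gorenstein => _ nr _ _; exact: right_noetherian_extendable. Qed.

Lemma hecke_acyclicP (M : lmodType H) : finite_pdim M <-> acyclic M.
Proof.
case: gorenstein => nl _ idl _; apply: acyclicP => //; first exact: hecke_extendable.
exact: hecke_enough_injectives.
Qed.

Definition inv_iso V W (f : rep_hom V W) : Prop := tate_iso (inv_map (I := I) f).

Lemma transferred_weqP V W (f : rep_hom V W) :
  preimage_class U (@gp_weq H) (f : @hom (Rep k G) V W) <-> inv_iso f.
Proof. exact: (gp_weqP hecke_extendable hecke_acyclicP). Qed.

Lemma transferred_tfibP V W (f : rep_hom V W) :
  preimage_class U (tfib (gorenstein_projective_model H)) (f : @hom (Rep k G) V W) <->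
  surj (inv_map (I := I) f) /\ acyclic_kernel (inv_map (I := I) f).
Proof.
split=> [[fs /(gp_weqP hecke_extendable hecke_acyclicP) fw]|[fs fa]].
  by split=> //; apply/(tate_iso_surj hecke_extendable fs).
split=> //; apply/(gp_weqP hecke_extendable hecke_acyclicP).
exact/(tate_iso_surj hecke_extendable fs).
Qed.

Lemma inv_map_compE V W Z (g : rep_hom W Z) (f : rep_hom V W) :
  (inv_map (I := I) (rep_comp g f) : {linear _ -> _}) =
  mod_comp (inv_map (I := I) g) (inv_map (I := I) f).
Proof. exact: (fmap_comp U g f). Qed.

Lemma inv_iso_2of3 V W Z (f : rep_hom V W) (g : rep_hom W Z) :
  [/\ inv_iso f -> inv_iso g -> inv_iso (rep_comp g f),
      inv_iso f -> inv_iso (rep_comp g f) -> inv_iso g &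
      inv_iso g -> inv_iso (rep_comp g f) -> inv_iso f].
Proof.
rewrite /inv_iso inv_map_compE; split.
- by move=> tf tg; exact: tate_iso_comp tf tg.
- exact: tate_iso_cancel_left.
- exact: tate_iso_cancel_right.
Qed.

(** The projection back to [V] is a retraction with acyclic kernel, so two-out-of-three applies. *)
Lemma attach_in_iso V (T : choiceType) : inv_iso (attach_in I V T).
Proof.
have [_ _ h] := inv_iso_2of3 (attach_in I V T) (attach_fst V T); apply: h.
  apply/(tate_iso_surj hecke_extendable); first exact: attach_fst_surj.
  exact: attach_fst_acyclic.
rewrite (_ : rep_comp _ _ = rep_id V); last exact: rep_hom_eq.
by rewrite /inv_iso (fmap_id U V : inv_map _ = _ :> {linear _ -> _}); exact: tate_iso_id.
Qed.

End Transfer.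

(** * Classes defined by a left lifting property, and the model structure *)

Lemma left_lifting_subcategory (C : category) (W : morphism_class C) :
  is_subcategory (left_lifting W).
Proof.
split=> [x a b q _ f g e|x y z g f Wg Wf a b q Wq u v e].
  by exists f; rewrite compm1; split=> //; rewrite e compm1.
have [|h [hf qh]] := Wf _ _ _ Wq u (v ∘ g); first by rewrite e compmA.
have [h' [h'g qh']] := Wg _ _ _ Wq h v qh.
by exists h'; rewrite compmA h'g.
Qed.

Lemma left_lifting_retract (C : category) (W : morphism_class C) :
  retract_closed (left_lifting W).
Proof.
move=> x y x' y' f g [i [r [j [s [ri sj gi fr]]]]] Wg a b q Wq u v quv.
have [|h [hg qh]] := Wg _ _ _ Wq (u ∘ r) (v ∘ s).
  by rewrite compmA quv -compmA fr compmA.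
exists (h ∘ j); split; first by rewrite -compmA -gi compmA hg -compmA ri compm1.
by rewrite compmA qh -compmA sj compm1.
Qed.

Theorem proposition4p10 (k : fieldType) (p : nat) (hp : p \in [pchar k])
    (G : topologicalGroupType) (I : open_pro_p_subgroup p G)
    (hH : gorenstein_ring (hecke k I)) :
  right_transfer_exists (hecke_adjunction k I)
    (gorenstein_projective_model (hecke k I)).
Proof.
have weqP := transferred_weqP hH; have tfibP := transferred_tfibP hH.
pose U := invariants_functor k I.
have free_left_cof V W (f : rep_hom V W) :
    left_lifting (preimage_class U (tfib (gorenstein_projective_model (hecke k I))))
      (ff_left (free_factorization k I) f).
  by move=> Y Z q /tfibP[qs _]; exact: attach_in_lifting.
split.
- split=> [V|V W Z g f /weqP wg /weqP wf]; apply/weqP.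
    by rewrite /inv_iso (fmap_id U V : inv_map _ = _ :> {linear _ -> _}); exact: tate_iso_id.
  by have [h _ _] := inv_iso_2of3 I f g; exact: h.
- exact: left_lifting_subcategory.
- split=> [V v|V W Z g f gs fs z]; first by exists v; exact: inv_eq.
  have [y <-] := gs z; have [x <-] := fs y; exists x; exact: inv_map_comp.
- move=> V W Z f g; have [h1 h2 h3] := inv_iso_2of3 I f g.
  by split=> /weqP w1 /weqP w2; apply/weqP; [exact: h1|exact: h2|exact: h3].
- move=> V W V' W' f g [i [r [j [s [ri sj gi fr]]]]] /weqP wg; apply/weqP.
  have E A B C (a : rep_hom A B) (b : rep_hom B C) x : inv_map (I := I) (rep_comp b a) x =
      inv_map b (inv_map a x) := inv_map_comp b a x.
  apply: (tate_iso_retract (i := inv_map i) (r := inv_map r) (j := inv_map j)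
    (s := inv_map s)) wg => x /=.
  + by rewrite -E [rep_comp _ _]ri; exact: inv_eq.
  + by rewrite -E [rep_comp _ _]sj; exact: inv_eq.
  + by rewrite -!E [rep_comp _ _]gi.
  + by rewrite -!E [rep_comp _ _]fr.
- exact: left_lifting_retract.
- move=> V W V' W' f g [i [r [j [s [ri sj gi fr]]]]] gs y.
  have [x xE] := gs (inv_map j y); exists (inv_map r x).
  apply: etrans (esym (inv_map_comp _ _ _)) _; rewrite [rep_comp _ _]fr.
  apply: etrans (inv_map_comp _ _ _) _; rewrite [inv_map g x]xE.
  by rewrite -inv_map_comp [rep_comp _ _]sj; exact: inv_eq.
- move=> V W Y Z i q [ci /weqP wi] fq.
  (* Retract argument: by two-out-of-three the second map of the free factorization of [i] is a
     trivial fibration, so the cofibration [i] lifts against it. *)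
  have fw : inv_iso I (free_right I i).
    have [_ h _] := inv_iso_2of3 I (attach_in I V (invariants I W)) (free_right I i).
    apply: h; first exact: (attach_in_iso hH).
    by rewrite (_ : rep_comp _ _ = i) //; apply: rep_hom_eq => v; exact: attach_lift_in.
  have tf : preimage_class U (tfib (gorenstein_projective_model (hecke k I)))
      (free_right I i : @hom (Rep k G) _ W).
    by split; [exact: free_right_surj|apply/weqP].
  have [|h [hi fh]] := ci _ _ _ tf (attach_in I V (invariants I W)) (idm (W : Rep k G)).
    by rewrite comp1m; apply: rep_hom_eq => v; exact: attach_lift_in.
  move=> f g e.
  (* [h] exhibits [i] as a retract of [attach_in], which lifts against every fibration; composing
     with [h] gives the lift for [i]. *)
  have [|l [lf lq]] := @attach_in_lifting _ _ _ I V (invariants I W) Y Z q fq f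
      (g ∘ free_right I i).
    rewrite -compmA e; congr (_ ∘ _).
    by apply: rep_hom_eq => v; exact/esym/attach_lift_in.
  exists (l ∘ h); split; first by rewrite -compmA hi.
  by rewrite compmA lq -compmA fh compm1.
- by move=> V W Y Z i q ci; exact: ci.
- exists (cell_factorization k I) => V W f; split.
    move=> Y Z q /tfibP[qs qa] u z e; exact: cell_left_lifting.
  by apply/tfibP; split; [exact: cell_right_surj|exact: cell_right_acyclic].
- exists (free_factorization k I) => V W f; split; last exact: free_right_surj.
  by split; [exact: free_left_cof|apply/weqP; exact: attach_in_iso].
Qed.
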